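(* Let $G$ be a connected reductive linear algebraic group over $\mathbb{C}$ and let $(\rho,V)$ be a finite-dimensional rational representation of $G$. Let $\mathfrak{g}=\mathrm{Lie}(G)$ and let $d\rho$ be the infinitesimal representation of $\mathfrak{g}$ on $V$. Assume that $(\mathfrak{g},d\rho,V)$ satisfies the following: $\mathfrak{g}$ is a reductive Lie algebra with one-dimensional center, i.e. $\mathfrak{g}=Z(\mathfrak{g})\oplus[\mathfrak{g},\mathfrak{g}]$ with $\dim Z(\mathfrak{g})=1$, and $Z(\mathfrak{g})$ acts on $V$ by a non-trivial character, i.e. $d\rho(Z(\mathfrak{g}))=\mathbb{C}\,\mathrm{Id}_V$. Then the following conditions are equivalent: 1. The triplet $(G,\rho,V)$ is a regular prehomogeneous vector space. 2. For any non-degenerate invariant bilinear form $B$ on $\mathfrak{g}$, the pentad $(\mathfrak{g},d\rho,V,V^*,B)$ has elements $X\in V$ and $Y\in V^*$ such that $(Y,H_0,X)$ is an $\mathfrak{sl}_2$-triple and such that the conditions $(P)^!_{(\cdot,H_0,X)}$ and $(P)^!_{(Y,H_0,\cdot)}$ hold, where $H_0\in\mathfrak{g}$ is a grading element of the pentad.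
   Context: Everything is over $\mathbb{C}$. **Prehomogeneous vector spaces.** A triplet $(G,\rho,V)$, where $G$ is a connected linear algebraic group and $(\rho,V)$ is a finite-dimensional rational representation, is a prehomogeneous vector space (PV) if there is a Zariski-dense orbit $\rho(G)x$ in $V$. The points of this orbit are called generic points. A relative invariant is a non-zero rational function $f$ on $V$ such that $f(\rho(g)v)=\chi(g)f(v)$ for some rational character $\chi:G\to\mathbb{C}^\times$; then $\chi$ is said to correspond to $f$. **Regularity.** Let $(G,\rho,V)$ be a PV with generic point $x$, let $G_x=\{g\in G\mid\rho(g)x=x\}$, let $\mathfrak{g}_1$ be the subalgebra of $\mathrm{Lie}(G)$ generated by $\mathrm{Lie}(G_x)$ and $[\mathrm{Lie}(G),\mathrm{Lie}(G)]$, and put $\overline{X}_1=\{\omega\in \mathrm{Lie}(G)^*\mid\omega|_{\mathfrak{g}_1}=0\}$. Let $\rho^*$ denote the contragredient representation of $G$ on $V^*$, and let $\langle\cdot,\cdot\rangle:V\times V^*\to\mathbb{C}$ be the canonical pairing. An element $\omega\in\overline{X}_1$ is called non-degenerate if there is a rational map $\varphi_\omega:\rho(G)x\to V^*$ such that $$\varphi_\omega(\rho(g)x')=\rho^*(g)\varphi_\omega(x'),\qquad \langle d\rho(A)x',\varphi_\omega(x')\rangle=\omega(A)$$ for all $A\in\mathrm{Lie}(G)$, $g\in G$, $x'\in\rho(G)x$, and such that the image of $\varphi_\omega$ is Zariski-dense in $V^*$. The PV is quasi-regular if a non-degenerate $\omega\in\overline{X}_1$ exists. It is regular if there is a character $\chi$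 of $G$ corresponding to some relative invariant such that $\omega=d\chi$ is non-degenerate. **Pentads and brackets.** For a finite-dimensional Lie algebra $\mathfrak{g}$ with a non-degenerate invariant bilinear form $B$ and a finite-dimensional representation $\pi$ on $V$, the pentad $(\mathfrak{g},\pi,V,V^*,B)$ has a $\Phi$-map $\Phi_\pi:V\otimes V^*\to\mathfrak{g}$, determined by $B(a,\Phi_\pi(v\otimes\phi))=\langle\pi(a)v,\phi\rangle$ for all $a\in\mathfrak{g}$, $v\in V$, $\phi\in V^*$. There is an associated graded Lie algebra $L(\mathfrak{g},\pi,V,V^*,B)=\bigoplus_{n\in\mathbb{Z}}U_n$ with $U_0=\mathfrak{g}$, $U_1=V$, $U_{-1}=V^*$, in which, for $a\in\mathfrak{g}$, $v\in V$, $\phi\in V^*$: $[a,v]=\pi(a)v$; $[a,\phi]$ is the contragredient action, $\langle v,[a,\phi]\rangle=-\langle\pi(a)v,\phi\rangle$; and $[v,\phi]=\Phi_\pi(v\otimes\phi)$. Only these brackets, and the bracket of $\mathfrak{g}$, are needed here. **Grading element.** An element $H_0\in\mathfrak{g}$ is a grading element of the pentad if $[H_0,A]=0$, $[H_0,X]=2X$, $[H_0,Y]=-2Y$ for all $A\in\mathfrak{g}$, $X\in V$, $Y\in V^*$. **$\mathfrak{sl}_2$-triples.** A triple $(y,h,x)$ of elements of $L(\mathfrak{g},\pi,V,V^*,B)$ is an $\mathfrak{sl}_2$-triple if $[h,x]=2x$, $[h,y]=-2y$, $[x,y]=h$. **Conditions $(P)^!$.** For $H\in\mathfrak{g}$ and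 $X\in V$, the condition $(P)^!_{(\cdot,H,X)}$ means that there exists a unique $\eta\in V^*$ such that $(\eta,H,X)$ is an $\mathfrak{sl}_2$-triple. For $H\in\mathfrak{g}$ and $Y\in V^*$, the condition $(P)^!_{(Y,H,\cdot)}$ means that there exists a unique $\xi\in V$ such that $(Y,H,\xi)$ is an $\mathfrak{sl}_2$-triple. *)

(* Defs.v *)
From mathcomp Require Import all_boot all_order all_algebra.
From mathcomp Require Import complex classical_sets reals.
From mathcomp Require Import mpoly.

Set Implicit Arguments.
Unset Strict Implicit.
Unset Printing Implicit Defensive.

Import GRing.Theory.
Local Open Scope classical_set_scope.
Local Open Scope ring_scope.

(* V is the space 'cV_m of columns and V^* the space 'rV_m of rows.  Groups are
   subsets of 'M_n and Lie algebras are linear subsets of 'M_n; maps attached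
   to them are total functions of which only the values on these subsets are
   ever used. *)

(** Zariski topology on matrix spaces *)

(* Polynomial functions on 'M_(a, b): the variable of index mxvec_index i j
   stands for the entry (i, j). *)
Definition mxeval (K : fieldType) (a b : nat) (p : {mpoly K[a * b]})
    (A : 'M[K]_(a, b)) : K :=
  p.@[mxvec A 0].

Definition mxdir_deriv (K : fieldType) (a b : nat) (p : {mpoly K[a * b]})
    (A D : 'M[K]_(a, b)) : K :=
  \sum_(k < a * b) (p^`M(k)).@[mxvec A 0] * mxvec D 0 k.

Definition zariski_closed (K : fieldType) (a b : nat)
    (Z : set 'M[K]_(a, b)) : Prop :=
  exists F : set {mpoly K[a * b]},
    Z = [set A | forall p, F p -> mxeval p A = 0].

Definition zariski_dense (K : fieldType) (a b : nat)
    (S : set 'M[K]_(a, b)) : Prop :=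
  forall Z, zariski_closed Z -> S `<=` Z -> Z = setT.

Definition zariski_connected (K : fieldType) (a b : nat)
    (S : set 'M[K]_(a, b)) : Prop :=
  forall Z1 Z2, zariski_closed Z1 -> zariski_closed Z2 ->
    S `<=` Z1 `|` Z2 -> S `&` Z1 `&` Z2 = set0 -> S `<=` Z1 \/ S `<=` Z2.

(** Linear algebraic groups *)

Definition lin_alg_group (K : fieldType) (n : nat) (G : set 'M[K]_n) : Prop :=
  [/\ exists2 Z, zariski_closed Z & G = [set g | g \in unitmx /\ Z g],
      G 1%:M,
      forall g h, G g -> G h -> G (g *m h)
    & forall g, G g -> G (invmx g)].

Definition unipotent (K : fieldType) (n : nat) (u : 'M[K]_n) : Prop :=
  exists k : nat, (u - 1%:M) ^+ k = 0.

(* The unipotent radical is trivial. *)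
Definition reductive_group (K : fieldType) (n : nat) (G : set 'M[K]_n) : Prop :=
  forall U : set 'M[K]_n, lin_alg_group U -> U `<=` G ->
    (forall g u, G g -> U u -> U (g *m u *m invmx g)) ->
    zariski_connected U -> (forall u, U u -> unipotent u) ->
    U = [set 1%:M].

(* The tangent space at 1: all D killed by the differentials at 1 of the
   polynomials vanishing on G. *)
Definition Lie (K : fieldType) (n : nat) (G : set 'M[K]_n) : set 'M[K]_n :=
  [set D | forall p : {mpoly K[n * n]},
     (forall g, G g -> mxeval p g = 0) -> mxdir_deriv p 1%:M D = 0].

(* A regular function on a closed subgroup of GL_n is the restriction of an
   element p / det^k of K[GL_n]. *)
Definition represents (K : fieldType) (n : nat) (G : set 'M[K]_n)
    (f : 'M[K]_n -> K) (p : {mpoly K[n * n]}) (k : nat) : Prop :=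
  forall g, G g -> f g = mxeval p g / \det g ^+ k.

Definition regular_fun (K : fieldType) (n : nat) (G : set 'M[K]_n)
    (f : 'M[K]_n -> K) : Prop :=
  exists p k, represents G f p k.

(* c is the derivative at 1 of the regular function f along D.  The formula is
   the derivative of p / det^k, since det has derivative \tr D at 1; for D in
   Lie G it does not depend on the choice of (p, k). *)
Definition is_diff1 (K : fieldType) (n : nat) (G : set 'M[K]_n)
    (f : 'M[K]_n -> K) (D : 'M[K]_n) (c : K) : Prop :=
  exists p k, represents G f p k /\
    c = mxdir_deriv p 1%:M D - k%:R * \tr D * mxeval p 1%:M.

(** Rational representations and characters *)

Definition rational_rep (K : fieldType) (n m : nat) (G : set 'M[K]_n)
    (rho : 'M[K]_n -> 'M[K]_m) : Prop :=
  [/\ forall g, G g -> rho g \in unitmx,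
      forall g h, G g -> G h -> rho (g *m h) = rho g *m rho h
    & forall i j, regular_fun G (fun g => rho g i j)].

Definition infinitesimal_rep (K : fieldType) (n m : nat) (G : set 'M[K]_n)
    (rho drho : 'M[K]_n -> 'M[K]_m) : Prop :=
  forall A, Lie G A ->
    forall i j, is_diff1 G (fun g => rho g i j) A (drho A i j).

Definition rational_character (K : fieldType) (n : nat) (G : set 'M[K]_n)
    (chi : 'M[K]_n -> K) : Prop :=
  [/\ forall g, G g -> chi g != 0,
      forall g h, G g -> G h -> chi (g *m h) = chi g * chi h
    & regular_fun G chi].

Definition character_diff (K : fieldType) (n : nat) (G : set 'M[K]_n)
    (chi omega : 'M[K]_n -> K) : Prop :=
  forall A, Lie G A -> is_diff1 G chi A (omega A).

Definition pairing (K : fieldType) (m : nat) (v : 'cV[K]_m) (phi : 'rV[K]_m) : K :=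
  (phi *m v) 0 0.

Definition contragredient (K : fieldType) (n m : nat)
    (rho : 'M[K]_n -> 'M[K]_m) (g : 'M[K]_n) (phi : 'rV[K]_m) : 'rV[K]_m :=
  phi *m invmx (rho g).

(** Lie subalgebras of 'M_n *)

Definition lie_br (K : fieldType) (n : nat) (A B : 'M[K]_n) : 'M[K]_n :=
  A *m B - B *m A.

Definition lin_subspace (K : fieldType) (n : nat) (h : set 'M[K]_n) : Prop :=
  h 0 /\ forall c A B, h A -> h B -> h (c *: A + B).

Definition lie_subalgebra (K : fieldType) (n : nat) (h : set 'M[K]_n) : Prop :=
  lin_subspace h /\ forall A B, h A -> h B -> h (lie_br A B).

Definition lin_span (K : fieldType) (n : nat) (S : set 'M[K]_n) : set 'M[K]_n :=
  [set A | forall h, lin_subspace h -> S `<=` h -> h A].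

Definition lie_generated (K : fieldType) (n : nat) (S : set 'M[K]_n) :
    set 'M[K]_n :=
  [set A | forall h, lie_subalgebra h -> S `<=` h -> h A].

Definition derived (K : fieldType) (n : nat) (g : set 'M[K]_n) : set 'M[K]_n :=
  lin_span [set C | exists A B, [/\ g A, g B & C = lie_br A B]].

Definition lie_center (K : fieldType) (n : nat) (g : set 'M[K]_n) :
    set 'M[K]_n :=
  [set A | g A /\ forall B, g B -> lie_br A B = 0].

Definition one_dimensional (K : fieldType) (n : nat) (h : set 'M[K]_n) : Prop :=
  exists2 A, A != 0 & h = [set c *: A | c in [set: K]].

Definition direct_sum (K : fieldType) (n : nat) (g h1 h2 : set 'M[K]_n) : Prop :=
  g = [set A + B | A in h1 & B in h2] /\ h1 `&` h2 = [set 0].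

(** Prehomogeneous vector spaces *)

Definition orbit_of (K : fieldType) (n m : nat) (G : set 'M[K]_n)
    (rho : 'M[K]_n -> 'M[K]_m) (x : 'cV[K]_m) : set 'cV[K]_m :=
  [set rho g *m x | g in G].

Definition isotropy (K : fieldType) (n m : nat) (G : set 'M[K]_n)
    (rho : 'M[K]_n -> 'M[K]_m) (x : 'cV[K]_m) : set 'M[K]_n :=
  [set g | G g /\ rho g *m x = x].

Definition generic_point (K : fieldType) (n m : nat) (G : set 'M[K]_n)
    (rho : 'M[K]_n -> 'M[K]_m) (x : 'cV[K]_m) : Prop :=
  zariski_dense (orbit_of G rho x).

(* chi corresponds to the relative invariant p / q; the identity
   (p / q) (rho g v) = chi g * (p / q) (v) of rational functions of v is
   written with cleared denominators. *)
Definition corresponds_to_rel_invariant (K : fieldType) (n m : nat)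
    (G : set 'M[K]_n) (rho : 'M[K]_n -> 'M[K]_m) (chi : 'M[K]_n -> K) : Prop :=
  exists p q : {mpoly K[m * 1]}, [/\ p != 0, q != 0 &
    forall g (v : 'cV[K]_m), G g ->
      mxeval p (rho g *m v) * mxeval q v
        = chi g * (mxeval p v * mxeval q (rho g *m v))].

(* Each coordinate of phi is a rational function p / q whose domain of
   definition contains U: at every point of U some fraction p' / q' equal to
   p / q has a nonzero denominator and takes the value prescribed by phi. *)
Definition rational_map_on (K : fieldType) (m : nat) (U : set 'cV[K]_m)
    (phi : 'cV[K]_m -> 'rV[K]_m) : Prop :=
  forall j, exists p q : {mpoly K[m * 1]}, q != 0 /\
    forall v, U v -> exists p' q' : {mpoly K[m * 1]},
      [/\ p * q' = p' * q, mxeval q' v != 0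
        & phi v 0 j = mxeval p' v / mxeval q' v].

Definition g1 (K : fieldType) (n m : nat) (G : set 'M[K]_n)
    (rho : 'M[K]_n -> 'M[K]_m) (x : 'cV[K]_m) : set 'M[K]_n :=
  lie_generated (Lie (isotropy G rho x) `|` derived (Lie G)).

Definition X1bar (K : fieldType) (n m : nat) (G : set 'M[K]_n)
    (rho : 'M[K]_n -> 'M[K]_m) (x : 'cV[K]_m) : set ('M[K]_n -> K) :=
  [set omega |
     (forall c A B, Lie G A -> Lie G B ->
        omega (c *: A + B) = c * omega A + omega B) /\
     (forall A, g1 G rho x A -> omega A = 0)].

Definition nondegenerate_at (K : fieldType) (n m : nat) (G : set 'M[K]_n)
    (rho drho : 'M[K]_n -> 'M[K]_m) (x : 'cV[K]_m) (omega : 'M[K]_n -> K) :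
    Prop :=
  exists phi : 'cV[K]_m -> 'rV[K]_m,
    [/\ rational_map_on (orbit_of G rho x) phi,
        forall g x', G g -> orbit_of G rho x x' ->
          phi (rho g *m x') = contragredient rho g (phi x'),
        forall A x', Lie G A -> orbit_of G rho x x' ->
          pairing (drho A *m x') (phi x') = omega A
      & zariski_dense (phi @` orbit_of G rho x)].

Definition regular_pv (K : fieldType) (n m : nat) (G : set 'M[K]_n)
    (rho drho : 'M[K]_n -> 'M[K]_m) : Prop :=
  exists2 x : 'cV[K]_m, generic_point G rho x &
    exists chi omega : 'M[K]_n -> K,
      [/\ rational_character G chi,
          corresponds_to_rel_invariant G rho chi,
          character_diff G chi omega,
          X1bar G rho x omega
        & nondegenerate_at G rho drho x omega].

(** Pentads *)

Definition nondeg_invariant_form (K : fieldType) (n : nat) (g : set 'M[K]_n)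
    (B : 'M[K]_n -> 'M[K]_n -> K) : Prop :=
  [/\ forall c A A' C, g A -> g A' -> g C ->
        B (c *: A + A') C = c * B A C + B A' C,
      forall c A C C', g A -> g C -> g C' ->
        B A (c *: C + C') = c * B A C + B A C',
      forall A C D, g A -> g C -> g D -> B (lie_br A C) D = B A (lie_br C D),
      forall A, g A -> (forall C, g C -> B A C = 0) -> A = 0
    & forall C, g C -> (forall A, g A -> B A C = 0) -> C = 0].

(* The Phi-map as a function of the pair (v, phi).  By non-degeneracy of B it
   exists, is unique and is bilinear. *)
Definition is_Phi_map (K : fieldType) (n m : nat) (g : set 'M[K]_n)
    (pi : 'M[K]_n -> 'M[K]_m) (B : 'M[K]_n -> 'M[K]_n -> K)
    (Phi : 'cV[K]_m -> 'rV[K]_m -> 'M[K]_n) : Prop :=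
  forall v phi, g (Phi v phi) /\
    forall a, g a -> B a (Phi v phi) = pairing (pi a *m v) phi.

(* Brackets of the graded Lie algebra between U_0 and U_1 = V and between U_0
   and U_{-1} = V^*; the bracket of U_1 with U_{-1} is Phi. *)
Definition br01 (K : fieldType) (n m : nat) (pi : 'M[K]_n -> 'M[K]_m)
    (a : 'M[K]_n) (v : 'cV[K]_m) : 'cV[K]_m := pi a *m v.

Definition br0m1 (K : fieldType) (n m : nat) (pi : 'M[K]_n -> 'M[K]_m)
    (a : 'M[K]_n) (phi : 'rV[K]_m) : 'rV[K]_m := - (phi *m pi a).

Definition grading_element (K : fieldType) (n m : nat) (g : set 'M[K]_n)
    (pi : 'M[K]_n -> 'M[K]_m) (H0 : 'M[K]_n) : Prop :=
  [/\ g H0,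
      forall A, g A -> lie_br H0 A = 0,
      forall X, br01 pi H0 X = 2 *: X
    & forall Y, br0m1 pi H0 Y = - 2 *: Y].

Definition sl2_triple (K : fieldType) (n m : nat) (pi : 'M[K]_n -> 'M[K]_m)
    (Phi : 'cV[K]_m -> 'rV[K]_m -> 'M[K]_n)
    (y : 'rV[K]_m) (h : 'M[K]_n) (x : 'cV[K]_m) : Prop :=
  [/\ br01 pi h x = 2 *: x, br0m1 pi h y = - 2 *: y & Phi x y = h].

(* Conditions (P)^!_{(., H, X)} and (P)^!_{(Y, H, .)} *)
Definition P_HX (K : fieldType) (n m : nat) (pi : 'M[K]_n -> 'M[K]_m)
    (Phi : 'cV[K]_m -> 'rV[K]_m -> 'M[K]_n)
    (H : 'M[K]_n) (X : 'cV[K]_m) : Prop :=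
  exists! eta : 'rV[K]_m, sl2_triple pi Phi eta H X.

Definition P_YH (K : fieldType) (n m : nat) (pi : 'M[K]_n -> 'M[K]_m)
    (Phi : 'cV[K]_m -> 'rV[K]_m -> 'M[K]_n)
    (Y : 'rV[K]_m) (H : 'M[K]_n) : Prop :=
  exists! xi : 'cV[K]_m, sl2_triple pi Phi Y H xi.

(* Main.v *)
(* Write g = Lie G.  The orbit of x is dense iff drho(g) x = V, and the image of phi is dense iff
   phi(x) drho(g) = V^*: a dominant orbit map has surjective differential because in
   characteristic 0 derivations extend along field extensions.  Every linear form on g that kills
   [g, g] is proportional to B(-, H0).

   (1) => (2): since dchi is proportional to B(-, H0), a multiple Y of phi(x) satisfies
   [x, Y] = H0.  As drho(g) x = V and Y drho(g) = V^*, each of x and Y determines the other.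

   (2) => (1): a reductive g with these hypotheses has an invariant form, because the trace form is
   non-degenerate on [g, g]: otherwise Cartan's criterion and Engel's theorem produce a normal
   unipotent subgroup.  The uniqueness conditions say that drho(g) X = V and Y drho(g) = V^*, so
   both orbits are dense.  The map rho(g) X |-> Y rho(g)^-1 is rational by Cramer's rule, and the
   inverse of its Jacobian determinant is a relative invariant with character (det rho)^2, whose
   differential does not vanish on the center. *)
Require Import Defs.
From HB Require Import structures.
From mathcomp Require Import all_boot all_order all_algebra.
From mathcomp Require Import complex boolp classical_sets functions filter reals.
From mathcomp Require Import fingroup perm mpoly ring.

Set Implicit Arguments.
Unset Strict Implicit.
Unset Printing Implicit Defensive.

Import Order.TTheory GRing.Theory Num.Theory.
Local Open Scope classical_set_scope.
Local Open Scope ring_scope.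

(** * Polynomial functions on matrices *)

(** Groups are sets of points, and [Lie] is read off at 1 from the vanishing ideal, so neither
    dimension theory nor a function field of G is at hand. Differentials are moved to 1 by
    translating polynomials, and the generic point of G is replaced by an ultrafilter: functions
    modulo null functions form a field of characteristic 0. In the other direction, an ideal of the
    Lie algebra need not come from an algebraic subgroup. A commuting space of nilpotent matrices
    does, because exp and log are then polynomials; this is why the search for a normal unipotent
    subgroup must end in the center of a nilpotent ideal. The exponent 2 in (det rho)^2 arises
    because the Jacobian of an equivariant map V -> V^* is a bilinear form on V, and each of its two
    arguments contributes det(rho g)^-1. Linear forms killing [g, g] being proportional, a multiple
    of Y pairs with X to exactly the differential 2 tr(drho A). The case V = 0 is treated apart,
    since all these traces vanish there. *)

Lemma mnm_subrr N (m : 'X_{1..N}) : (m - m)%MM = 0%MM.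
Proof. by apply/mnmP => i; rewrite mnmBE mnm0E subnn. Qed.

Lemma mpoly_gen_ind (N : nat) (K : nzRingType) (P : {mpoly K[N]} -> Prop) :
  (forall c, P c%:MP) -> (forall k, P 'X_k) ->
  (forall p q, P p -> P q -> P (p + q)) ->
  (forall p q, P p -> P q -> P (p * q)) -> forall p, P p.
Proof.
move=> PC PX PD PM; elim/mpolyind=> [|c m p _ _ Pp]; first exact: (PC 0).
apply: (PD) => //; rewrite -mul_mpolyC; apply: (PM) => //.
rewrite mpolyXE_id; apply: (big_ind P); [exact: (PC 1)|exact: PM|].
move=> i _; elim: (m i) => [|j IH]; first by rewrite expr0; exact: (PC 1).
by rewrite exprS; apply: PM.
Qed.

(** In p, both sides are derivations along psi o mmap that kill constants, so they agree once they
    agree on the variables. Leaving psi and d free covers derivatives of products, of restrictions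
    to lines, and along exponential curves. *)
Lemma mmap_chain_rule (N : nat) (K S Q : comNzRingType) (c : {rmorphism K -> S})
    (psi : {rmorphism S -> Q}) (d : S -> Q) (h : 'I_N -> S) :
  (forall a b, d (a + b) = d a + d b) ->
  (forall a b, d (a * b) = psi a * d b + psi b * d a) ->
  (forall x, d (c x) = 0) ->
  forall p, d (mmap c h p) = \sum_k psi (mmap c h p^`M(k)) * d (h k).
Proof.
move=> dD dM dC; elim/mpoly_gen_ind=> [x|i|p q IHp IHq|p q IHp IHq].
- rewrite mmapC dC big1 // => k _; by rewrite mderivC !rmorph0 mul0r.
- rewrite mmapX mmap1U (bigD1 i) //= big1 => [|k ki]; last first.
    by rewrite mderivX mnm1E eq_sym (negPf ki) scale0r !rmorph0 mul0r.
  by rewrite mderivX mnm1E eqxx scale1r mnm_subrr mpolyX0 !rmorph1 mul1r addr0.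
- rewrite rmorphD dD IHp IHq -big_split; apply: eq_bigr => k _ /=.
  by rewrite mderivD !rmorphD mulrDl.
- rewrite rmorphM dM IHp IHq !mulr_sumr -big_split; apply: eq_bigr => k _ /=.
  by rewrite mderivM !(rmorphD, rmorphM) /=; ring.
Qed.

Lemma mx_empty (K : Type) a b (A B : 'M[K]_(a, b)) : a = 0%N \/ b = 0%N -> A = B.
Proof.
by move=> ab; apply/matrixP => -[i hi] [j hj]; exfalso; case: ab => E; [rewrite E in hi|rewrite E in hj].
Qed.

(** In characteristic 0 the integers 0, 1, ..., [size p] - 1 are distinct, which is one root too
    many. *)
Lemma poly_vanish (K : fieldType) (p : {poly K}) :
  [pchar K] =i pred0 -> (forall x, p.[x] = 0) -> p = 0.
Proof.
move=> ch pz; apply: (@roots_geq_poly_eq0 _ _ [seq i%:R | i <- iota 0 (size p)]).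
- by apply/allP => _ /mapP [i _ ->]; apply/rootP.
- rewrite map_inj_uniq ?iota_uniq // => i j /eqP; rewrite -subr_eq0 => H.
  apply/eqP; rewrite eqn_leq; apply/andP.
  wlog: i j H / (i <= j)%N => [W|ij].
    case/orP: (leq_total i j) => ij; first exact: W.
    by have [||-> ->] := W j i; rewrite // -opprB oppr_eq0.
  split=> //; move: H; rewrite -oppr_eq0 opprB -natrB // => H.
  by rewrite -subn_eq0; move: ch => /pcharf0P <-.
- by rewrite size_map size_iota.
Qed.

Section MxPoly.
Variables (K : fieldType) (a b : nat).
Implicit Types (p q : {mpoly K[a * b]}) (A D : 'M[K]_(a, b)).

Definition mxX (i : 'I_a) (j : 'I_b) : {mpoly K[a * b]} := 'X_(mxvec_index i j).

Lemma mxevalD p q A : mxeval (p + q) A = mxeval p A + mxeval q A.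
Proof. exact: mevalD. Qed.
Lemma mxevalM p q A : mxeval (p * q) A = mxeval p A * mxeval q A.
Proof. exact: mevalM. Qed.
Lemma mxevalC c A : mxeval c%:MP A = c.
Proof. exact: mevalC. Qed.
Lemma mxeval_mxX i j A : mxeval (mxX i j) A = A i j.
Proof. by rewrite /mxeval mevalXU mxvecE. Qed.

Lemma mxdir_derivD p q A D :
  mxdir_deriv (p + q) A D = mxdir_deriv p A D + mxdir_deriv q A D.
Proof.
rewrite /mxdir_deriv -big_split; apply: eq_bigr => k _ /=.
by rewrite mderivD mevalD mulrDl.
Qed.
Lemma mxdir_derivM p q A D :
  mxdir_deriv (p * q) A D =
    mxeval p A * mxdir_deriv q A D + mxeval q A * mxdir_deriv p A D.
Proof.
rewrite /mxdir_deriv /mxeval !mulr_sumr -big_split; apply: eq_bigr => k _ /=.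
by rewrite mderivM mevalD !mevalM; ring.
Qed.
Lemma mxdir_derivC c A D : mxdir_deriv c%:MP A D = 0.
Proof. by rewrite /mxdir_deriv big1 // => k _; rewrite mderivC meval0 mul0r. Qed.
Lemma mxevalB p q A : mxeval (p - q) A = mxeval p A - mxeval q A.
Proof. exact: mevalB. Qed.
Lemma mxdir_derivB p q A D :
  mxdir_deriv (p - q) A D = mxdir_deriv p A D - mxdir_deriv q A D.
Proof.
rewrite /mxdir_deriv -sumrB; apply: eq_bigr => k _ /=.
by rewrite mderivB mevalB mulrBl.
Qed.
Lemma mxdir_derivX k A D : mxdir_deriv 'X_k A D = mxvec D 0 k.
Proof.
rewrite /mxdir_deriv (bigD1 k) //= big1 => [|l kl]; last first.
  by rewrite mderivX mnm1E eq_sym (negPf kl) scale0r meval0 mul0r.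
by rewrite mderivX mnm1E eqxx scale1r mnm_subrr mpolyX0 meval1 mul1r addr0.
Qed.
Lemma mxdir_deriv_mxX i j A D : mxdir_deriv (mxX i j) A D = D i j.
Proof. by rewrite mxdir_derivX mxvecE. Qed.
Lemma mxdir_deriv_lin p A c D D' :
  mxdir_deriv p A (c *: D + D') = c * mxdir_deriv p A D + mxdir_deriv p A D'.
Proof.
rewrite /mxdir_deriv mulr_sumr -big_split; apply: eq_bigr => k _ /=.
by rewrite linearP !mxE; ring.
Qed.

Lemma mxdir_deriv_delta p A k :
  mxdir_deriv p A (vec_mx (delta_mx 0 k)) = (p^`M(k)).@[mxvec A 0].
Proof.
rewrite /mxdir_deriv (bigD1 k) //= big1 => [|l kl]; last first.
  by rewrite vec_mxK mxE (negPf kl) andbF mulr0.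
by rewrite vec_mxK mxE !eqxx mulr1 addr0.
Qed.

(** As a predicate on functions, being polynomial passes to determinants, adjugates and truncated
    exponentials by closure, without writing down any polynomial. *)
Definition polyfun (f : 'M[K]_(a, b) -> K) := exists p, forall A, mxeval p A = f A.

Lemma polyfunD f g : polyfun f -> polyfun g -> polyfun (fun A => f A + g A).
Proof. by move=> [p P] [q Q]; exists (p + q) => A; rewrite mxevalD P Q. Qed.
Lemma polyfunM f g : polyfun f -> polyfun g -> polyfun (fun A => f A * g A).
Proof. by move=> [p P] [q Q]; exists (p * q) => A; rewrite mxevalM P Q. Qed.
Lemma polyfunC c : polyfun (fun=> c).
Proof. by exists c%:MP => A; rewrite mxevalC. Qed.
Lemma polyfun_entry i j : polyfun (fun A => A i j).
Proof. by exists (mxX i j) => A; rewrite mxeval_mxX. Qed.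
Lemma polyfun_ext f g : f =1 g -> polyfun f -> polyfun g.
Proof. by move=> fg [p P]; exists p => A; rewrite P fg. Qed.
Lemma polyfunZ c f : polyfun f -> polyfun (fun A => c * f A).
Proof. by move=> ?; apply: polyfunM => //; apply: polyfunC. Qed.
Lemma polyfunN f : polyfun f -> polyfun (fun A => - f A).
Proof.
by move=> F; apply: (@polyfun_ext (fun A => -1 * f A)) => [A|];
  [rewrite mulN1r | apply: polyfunZ].
Qed.
Lemma polyfun_sum (I : Type) (s : seq I) (P : pred I) (f : I -> _ -> K) :
  (forall i, P i -> polyfun (f i)) -> polyfun (fun A => \sum_(i <- s | P i) f i A).
Proof.
move=> F; elim: s => [|i s IH].
  by apply: (@polyfun_ext (fun=> 0)) (polyfunC 0) => A; rewrite big_nil.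
case Pi: (P i); last by apply: polyfun_ext IH => A; rewrite big_cons Pi.
apply: (@polyfun_ext (fun A => f i A + \sum_(i <- s | P i) f i A)) => [A|].
  by rewrite big_cons Pi.
by apply: polyfunD => //; apply: F.
Qed.
Lemma polyfun_prod (I : Type) (s : seq I) (P : pred I) (f : I -> _ -> K) :
  (forall i, P i -> polyfun (f i)) -> polyfun (fun A => \prod_(i <- s | P i) f i A).
Proof.
move=> F; elim: s => [|i s IH].
  by apply: (@polyfun_ext (fun=> 1)) (polyfunC 1) => A; rewrite big_nil.
case Pi: (P i); last by apply: polyfun_ext IH => A; rewrite big_cons Pi.
apply: (@polyfun_ext (fun A => f i A * \prod_(i <- s | P i) f i A)) => [A|].
  by rewrite big_cons Pi.
by apply: polyfunM => //; apply: F.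
Qed.
Lemma polyfunX f k : polyfun f -> polyfun (fun A => f A ^+ k).
Proof.
move=> F; elim: k => [|k IH]; first exact: (polyfun_ext _ (polyfunC 1)).
by apply: polyfun_ext (polyfunM F IH) => A; rewrite exprS.
Qed.

Definition polymx (c d : nat) (F : 'M[K]_(a, b) -> 'M[K]_(c, d)) :=
  forall i j, polyfun (fun A => F A i j).

Lemma polymx_mul c d e (F : _ -> 'M_(c, d)) (G : _ -> 'M_(d, e)) :
  polymx F -> polymx G -> polymx (fun A => F A *m G A).
Proof.
move=> PF PG i j; apply: (@polyfun_ext (fun A => \sum_k F A i k * G A k j)) => [A|].
  by rewrite mxE.
by apply: polyfun_sum => k _; apply: polyfunM.
Qed.
Lemma polymx_cst c d (B : 'M_(c, d)) : polymx (fun=> B).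
Proof. by move=> i j; apply: polyfunC. Qed.
Lemma polymxD c d (F G : _ -> 'M_(c, d)) :
  polymx F -> polymx G -> polymx (fun A => F A + G A).
Proof.
move=> PF PG i j; apply: (@polyfun_ext (fun A => F A i j + G A i j)) => [A|].
  by rewrite mxE.
exact: polyfunD.
Qed.
Lemma polymxZ c d x (F : _ -> 'M_(c, d)) : polymx F -> polymx (fun A => x *: F A).
Proof.
move=> PF i j; apply: (@polyfun_ext (fun A => x * F A i j)) => [A|].
  by rewrite mxE.
exact: polyfunZ.
Qed.
Lemma polyfun_det c (F : _ -> 'M_c) : polymx F -> polyfun (fun A => \det (F A)).
Proof.
move=> PF; apply: polyfun_sum => s _; apply: polyfunZ.
by apply: polyfun_prod => i _; apply: PF.
Qed.
Lemma polymx_adj c (F : _ -> 'M_c) : polymx F -> polymx (fun A => \adj (F A)).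
Proof.
move=> PF i j; apply: (@polyfun_ext (fun A => cofactor (F A) j i)) => [A|].
  by rewrite mxE.
apply: polyfunZ; apply: polyfun_det => k l.
by apply: polyfun_ext (PF _ _) => A; rewrite !mxE.
Qed.
Lemma polymx_id : polymx id.
Proof. by move=> i j; apply: polyfun_entry. Qed.
Lemma polymx_ext c d (F G : _ -> 'M_(c, d)) : F =1 G -> polymx F -> polymx G.
Proof. by move=> FG PF i j; apply: polyfun_ext (PF i j) => A; rewrite FG. Qed.

Lemma mxeval_sum (I : Type) (s : seq I) (P : pred I) (F : I -> {mpoly K[a * b]}) A :
  mxeval (\sum_(i <- s | P i) F i) A = \sum_(i <- s | P i) mxeval (F i) A.
Proof. exact: raddf_sum. Qed.

End MxPoly.

(** * Polynomials and their partial derivatives in characteristic 0 *)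

Lemma mpoly_deriv0_const (K : fieldType) N (p : {mpoly K[N]}) :
  [pchar K] =i pred0 -> (forall k, p^`M(k) = 0) -> p = (p@_0)%:MP.
Proof.
move=> ch dp; apply/mpolyP => m; rewrite mcoeffC.
case: (eqVneq m 0%MM) => [->|m0]; first by rewrite /= mulr1.
rewrite mulr0.
have [k mk] : exists k, m k != 0%N.
  apply/existsP; apply: contraR m0; rewrite negb_exists => /forallP H.
  apply/eqP/mnmP => k; rewrite mnm0E; apply/eqP; exact: negbNE (H k).
have := congr1 (fun q => q@_(m - U_(k))) (dp k).
rewrite mcoeff_deriv mcoeff0 submK; last first.
  by apply/mnm_lepP => l; rewrite mnm1E; case: eqP => // <-; rewrite lt0n.
move/eqP; rewrite -mulr_natr mulf_eq0 => /orP[/eqP //|].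
by move: ch => /pcharf0P ->.
Qed.

Lemma msize_mderiv (K : fieldType) N (p : {mpoly K[N]}) k d :
  (msize p <= d.+1)%N -> (msize p^`M(k) <= d)%N.
Proof.
move=> pd; rewrite msizeE; apply/bigmax_leqP_seq => m mp _.
have : (m + U_(k))%MM \in msupp p.
  move: mp; rewrite !mcoeff_msupp mcoeff_deriv; apply: contraNneq => ->.
  by rewrite mul0rn.
by move/msize_mdeg_lt; rewrite mdegD mdeg1 addn1 => h; rewrite -ltnS; apply: leq_trans h pd.
Qed.

(** Taylor expansion at v, as an induction on the degree: the partial derivatives of p are zero by
    induction, so p is constant, with value 0 at v. *)
Lemma mpoly_zero_closed (K : fieldType) N (J : {mpoly K[N]} -> Prop) (v : 'I_N -> K) :
  [pchar K] =i pred0 -> (forall p k, J p -> J p^`M(k)) ->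
  (forall p, J p -> p.@[v] = 0) -> forall p, J p -> p = 0.
Proof.
move=> ch JD Jv p; have [d] := ubnP (msize p).
elim: d p => [//|d IH] p; rewrite ltnS => pd Jp.
case: d pd IH => [|d] pd IH; first by move: pd; rewrite leqn0 msize_poly_eq0 => /eqP.
have dp k : p^`M(k) = 0 by apply: IH; [rewrite ltnS; apply: msize_mderiv | apply: JD].
have pc := mpoly_deriv0_const ch dp.
by have := Jv _ Jp; rewrite pc mevalC => ->; rewrite mpolyC0.
Qed.

(** * Extending derivations *)

(** N is a prime ideal with Q / N of characteristic 0. The quotient is never formed; equations are
    stated modulo N instead. *)
Definition prime_pred (Q : comNzRingType) (N : Q -> Prop) :=
  [/\ N 0, forall a b, N a -> N b -> N (a + b), forall a b, N b -> N (a * b),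
      forall a b, N (a * b) -> N a \/ N b & forall k, ~ N k.+1%:R].

Definition derivation (A Q : pzRingType) (phi D : A -> Q) :=
  (forall a b, D (a + b) = D a + D b) /\
  (forall a b, D (a * b) = phi a * D b + phi b * D a).

(** With a measure of the form M - rank or N - size it also yields maximal objects. *)
Lemma ex_minimal (T : Type) (P : T -> Prop) (f : T -> nat) :
  (exists x, P x) -> exists2 x, P x & forall y, P y -> (f x <= f y)%N.
Proof.
move=> [x0 Px0].
have [n] := ubnP (f x0); elim: n x0 Px0 => // n IH x Px; rewrite ltnS => fx.
have [[y [Py yx]]|H] := pselect (exists y, P y /\ (f y < f x)%N).
  by apply: (IH y) => //; apply: leq_trans yx fx.
exists x => // y Py; rewrite leqNgt; apply/negP => yx; apply: H; by exists y.
Qed.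

Section DerivExt.
Variables (A Q : comNzRingType) (phi : {rmorphism A -> Q}) (N : Q -> Prop).
Hypothesis primeN : prime_pred N.
Variable D : A -> Q.
Hypothesis derD : derivation phi D.
Hypothesis kerD : forall a, N (phi a) -> N (D a).
Variable w : Q.

Let D0 : D 0 = 0.
Proof. by case: derD => dD _; apply: (addIr (D 0)); rewrite -dD !add0r. Qed.

Let ev (P : {poly A}) := (map_poly phi P).[w].
Let dc (P : {poly A}) := \sum_(i < size P) D P`_i * w ^+ i.

Let dcW n (P : {poly A}) : (size P <= n)%N -> dc P = \sum_(i < n) D P`_i * w ^+ i.
Proof.
move=> sP; rewrite /dc (big_ord_widen n (fun i => D P`_i * w ^+ i)) //.
rewrite [RHS](bigID (fun i : 'I_n => (i < size P)%N)) /= [X in _ + X]big1 ?addr0 //.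
by move=> i; rewrite -leqNgt => ?; rewrite nth_default // D0 mul0r.
Qed.

Let dcD P R : dc (P + R) = dc P + dc R.
Proof.
rewrite !(@dcW (maxn (size P) (size R))) ?leq_maxl ?leq_maxr ?size_polyD //.
rewrite -big_split; apply: eq_bigr => i _ /=.
by rewrite coefD (proj1 derD) mulrDl.
Qed.

Let evE n (P : {poly A}) : (size P <= n)%N -> ev P = \sum_(i < n) phi P`_i * w ^+ i.
Proof.
move=> sP; rewrite /ev (@horner_coef_wide _ n); last first.
  by apply: leq_trans (size_poly _ _) sP.
by apply: eq_bigr => i _; rewrite coef_map.
Qed.

Let dcZ a P : dc (a%:P * P) = phi a * dc P + ev P * D a.
Proof.
rewrite mul_polyC (@dcW (size P)) ?size_scale_leq // (@evE (size P)) // /dc.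
rewrite mulr_sumr mulr_suml -big_split; apply: eq_bigr => i _ /=.
by rewrite coefZ (proj2 derD); ring.
Qed.

Let dcX P : dc (P * 'X) = w * dc P.
Proof.
rewrite (@dcW (size P).+1); last by have [->|P0] := eqVneq P 0; rewrite ?mul0r ?size_poly0 // size_mulX.
rewrite big_ord_recl coefMX /= D0 mul0r add0r /dc mulr_sumr.
by apply: eq_bigr => i _; rewrite coefMX /= exprS; ring.
Qed.

Let evD P R : ev (P + R) = ev P + ev R.
Proof. by rewrite /ev rmorphD hornerD. Qed.
Let evM P R : ev (P * R) = ev P * ev R.
Proof. by rewrite /ev rmorphM hornerM. Qed.
Let evC a : ev a%:P = phi a.
Proof. by rewrite /ev map_polyC hornerC. Qed.
Let evX : ev 'X = w.
Proof. by rewrite /ev map_polyX hornerX. Qed.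
Let dcC a : dc a%:P = D a.
Proof. by rewrite (@dcW 1) ?size_polyC_leq1 // big_ord1 coefC mulr1. Qed.

Let dcM P R : dc (P * R) = ev P * dc R + ev R * dc P.
Proof.
elim/poly_ind: P => [|P c IH].
  have -> : dc 0 = 0 by rewrite /dc size_poly0 big_ord0.
  by rewrite mul0r /ev rmorph0 horner0 /dc size_poly0 big_ord0; ring.
rewrite mulrDl dcD dcZ (mulrAC P 'X R) dcX IH dcD dcX dcC evD evM evX evC.
by ring.
Qed.

(* Let mu be a relation of minimal degree satisfied by w modulo N.  Over a field, D would extend by
   D w = - mu^D(w) / mu'(w); the factor s = mu'(w), nonzero by minimality in characteristic 0,
   clears this denominator. *)
Lemma derivation_extension : exists (D' : {poly A} -> Q) (s : Q),
  [/\ ~ N s, derivation (fun P => (map_poly phi P).[w]) D',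
      forall a, D' a%:P = s * D a
    & forall P, N (map_poly phi P).[w] -> N (D' P)].
Proof.
have [N0 ND NM Np Nn] := primeN; have [dD dM] := derD.
have NN a : N a -> N (- a) by rewrite -mulN1r; apply: NM.
have Nsum n (F : 'I_n -> Q) : (forall i, N (F i)) -> N (\sum_i F i).
  by move=> NF; apply: big_ind.
pose smallc (P : {poly A}) := forall i, N (phi P`_i).
have small_dc P : smallc P -> N (dc P).
  by move=> sP; apply: Nsum => i; rewrite mulrC; apply: NM; apply: kerD.
have small_ev P : smallc P -> N (ev P).
  move=> sP; rewrite (@evE (size P)) //; apply: Nsum => i; rewrite mulrC; exact: NM.
have small_d P : smallc P -> smallc P^`().
  by move=> sP i; rewrite coef_deriv rmorphMn -mulr_natl; apply: NM.
pose der s c P := s * dc P + c * ev P^`().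
have der_der s c : derivation ev (der s c).
  split=> P R; rewrite /der ?dcD ?dcM derivE !evD ?evM; ring.
have derC s c a : der s c a%:P = s * D a.
  by rewrite /der dcC derivC /ev rmorph0 horner0 mulr0 addr0.
(* A non-trivial relation of w modulo N. If there is none, w is transcendental modulo N and D w = 0
   is a valid choice, with s = 1. *)
pose rel P := N (ev P) /\ ~ smallc P.
have [[P0 relP0]|norel] := pselect (exists P, rel P); last first.
  exists (der 1 0), 1; split=> //; first exact: (Nn 0%N).
  move=> P NP; rewrite /der mul1r mul0r addr0; apply: small_dc.
  by apply: contrapT => nP; apply: norel; exists P.
have [mu [Nmu smu] mumin] := @ex_minimal _ rel (fun P : {poly A} => size P) (ex_intro _ P0 relP0).
have small_lt (P : {poly A}) : (size P < size mu)%N -> N (ev P) -> smallc P.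
  move=> Pmu NP; apply: contrapT => nP.
  by have := mumin P (conj NP nP); rewrite leqNgt Pmu.
have mu0 : mu != 0.
  by apply/negP => /eqP mu0; apply: smu => i; rewrite mu0 coef0 rmorph0.
have sz : (0 < size mu)%N by rewrite size_poly_gt0.
(* Otherwise removing the leading term leaves a shorter polynomial with value in N; its coefficients
   then lie in N by minimality, and so do those of mu. *)
have lcN : ~ N (phi (lead_coef mu)).
  move=> Nlc; pose nu := take_poly (size mu).-1 mu.
  have E : mu = nu + (lead_coef mu)%:P * 'X^((size mu).-1).
    rewrite -[LHS](poly_take_drop (size mu).-1); congr (_ + _ * _).
    apply/polyP => i; rewrite coef_drop_poly coefC lead_coefE.
    case: i => [|i]; first by rewrite add0n.
    by rewrite /= nth_default // addSn -{1}(prednK sz) ltnS leq_addl.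
  have Nnu : N (ev nu).
    have -> : ev nu = ev mu - phi (lead_coef mu) * ev 'X^((size mu).-1).
      by rewrite {1}E evD evM evC addrK.
    by apply: ND => //; apply: NN; rewrite mulrC; apply: NM.
  apply: smu => i; rewrite E coefD rmorphD coefCM rmorphM; apply: ND; last first.
    by rewrite mulrC; apply: NM.
  apply: small_lt => //; apply: leq_ltn_trans (size_take_poly _ _) _.
  by rewrite -{2}(prednK sz).
have sz1 : (1 < size mu)%N.
  rewrite ltnNge; apply/negP => s1; apply: lcN.
  by move: Nmu; rewrite (size1_polyC s1) evC lead_coefC.
have sN : ~ N (ev mu^`()).
  move=> Nd; have /(_ (size mu).-2) := small_lt _ (lt_size_deriv mu0) Nd.
  rewrite coef_deriv prednK ?ltn_predRL // -mulr_natl rmorphM rmorph_nat => /Np[].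
    by case: (size mu) sz1 => [|[|k]] // _; apply: Nn.
  exact: lcN.
exists (der (ev mu^`()) (- dc mu)), (ev mu^`()); split=> // P NP.
have [dDD dDM] := der_der (ev mu^`()) (- dc mu).
set d := der _ _ in dDD dDM *.
have dmu : d mu = 0 by rewrite /d /der; ring.
(* Division by mu costs a power of its leading coefficient. This power is outside the prime N, so it
   can be cancelled at the end. *)
pose k := Pdiv.CommonRing.rscalp P mu; pose R := Pdiv.CommonRing.rmodp P mu.
have E : P * (lead_coef mu ^+ k)%:P = Pdiv.CommonRing.rdivp P mu * mu + R by rewrite mulrC mul_polyC; exact: Pdiv.ComRing.rdivp_eq.
have NR : N (ev R).
  have -> : ev R = ev P * ev (lead_coef mu ^+ k)%:P - ev (Pdiv.CommonRing.rdivp P mu) * ev mu.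
    by rewrite -!evM E evD addrC addKr.
  by apply: ND; [rewrite mulrC|apply: NN]; apply: NM.
have sR : smallc R by apply: small_lt => //; rewrite Pdiv.CommonRing.ltn_rmodp.
have NdR : N (d R).
  apply: ND; apply: NM; first exact: small_dc.
  by apply: small_ev; apply: small_d.
have : N (d (P * (lead_coef mu ^+ k)%:P)).
  rewrite E dDD dDM dmu mulr0 add0r; apply: ND => //.
  by rewrite mulrC; apply: NM.
rewrite dDM => NN1.
have : N (phi (lead_coef mu) ^+ k * d P).
  have -> : phi (lead_coef mu) ^+ k * d P =
      ev P * d (lead_coef mu ^+ k)%:P + ev (lead_coef mu ^+ k)%:P * d P
      - d (lead_coef mu ^+ k)%:P * ev P.
    by rewrite evC (rmorphXn phi); ring.
  by apply: ND => //; apply: NN; apply: NM.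
elim: k {E NR NN1} => [|k IH]; first by rewrite expr0 mul1r.
by rewrite exprS -mulrA => /Np[/lcN //|/IH].
Qed.

End DerivExt.

(** One element is adjoined at a time, each by passing to a polynomial ring. Each step rescales D by
    a factor outside N, and the product of these factors is outside N because N is prime. *)
Lemma derivation_adjoin (Q : comNzRingType) (N : Q -> Prop) (ws : seq Q) :
  prime_pred N ->
  forall (A : comNzRingType) (phi : {rmorphism A -> Q}) (D : A -> Q),
  derivation phi D -> (forall a, N (phi a) -> N (D a)) ->
  exists (A' : comNzRingType) (iota : {rmorphism A -> A'})
    (phi' : {rmorphism A' -> Q}) (D' : A' -> Q) (s : Q),
  [/\ ~ N s, derivation phi' D' /\ (forall a, N (phi' a) -> N (D' a)),
      forall a, phi' (iota a) = phi a, forall a, D' (iota a) = s * D a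
    & forall w, w \in ws -> exists a, phi' a = w].
Proof.
move=> pN; elim: ws => [|w ws IH] A phi D derD kerD.
  exists A, idfun, phi, D, 1; split=> // [|a]; last by rewrite mul1r.
  by case: pN => _ _ _ _ /(_ 0%N).
have [D1 [s1 [Ns1 der1 D1C ker1]]] := derivation_extension pN derD kerD w.
pose phi1 : {rmorphism {poly A} -> Q} := (horner_eval w \o map_poly phi).
have [A' [iota [phi' [D' [s [Ns der' phiE DE wE]]]]]] := IH _ phi1 D1 der1 ker1.
pose i1 : {rmorphism A -> A'} := (iota \o polyC).
exists A', i1, phi', D', (s * s1); split=> // [|a|a|v].
- by case: pN => _ _ _ Np _ /Np[].
- by rewrite /i1 /= phiE /phi1 /= /horner_eval map_polyC hornerC.
- by rewrite /i1 /= DE D1C mulrA.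
- rewrite inE => /orP[/eqP ->|/wE //].
  by exists (iota 'X); rewrite phiE /phi1 /= /horner_eval map_polyX hornerX.
Qed.

(** * Substitution and the determinant *)

Section PolyCompose.
Variables (K : fieldType) (a b c d : nat).
Implicit Types (PM : 'M[{mpoly K[a * b]}]_(c, d)) (A D : 'M[K]_(a, b)).

Definition mxev (A : 'M[K]_(a, b)) PM : 'M[K]_(c, d) := map_mx (fun p => mxeval p A) PM.
Definition mxdd PM A D : 'M[K]_(c, d) := map_mx (fun p => mxdir_deriv p A D) PM.

Definition mxcomp (Q : {mpoly K[c * d]}) PM : {mpoly K[a * b]} :=
  mmap (@mpolyC (a * b) K) (mxvec PM 0) Q.

Lemma mxeval_comp Q PM A : mxeval (mxcomp Q PM) A = mxeval Q (mxev A PM).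
Proof.
elim/mpoly_gen_ind: Q => [x|k|p q IHp IHq|p q IHp IHq].
- by rewrite /mxcomp mmapC !mxevalC.
- rewrite /mxcomp mmapX mmap1U; case/mxvec_indexP: k => i j.
  by rewrite -/(mxX K i j) mxeval_mxX mxvecE mxE.
- by rewrite /mxcomp rmorphD !mxevalD -!/(mxcomp _ _) IHp IHq.
- by rewrite /mxcomp rmorphM !mxevalM -!/(mxcomp _ _) IHp IHq.
Qed.

Lemma mxdir_deriv_comp Q PM A D :
  mxdir_deriv (mxcomp Q PM) A D = mxdir_deriv Q (mxev A PM) (mxdd PM A D).
Proof.
elim/mpoly_gen_ind: Q => [x|k|p q IHp IHq|p q IHp IHq].
- by rewrite /mxcomp mmapC !mxdir_derivC.
- rewrite /mxcomp mmapX mmap1U; case/mxvec_indexP: k => i j.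
  by rewrite -/(mxX K i j) mxdir_deriv_mxX mxvecE mxE.
- by rewrite /mxcomp rmorphD !mxdir_derivD -!/(mxcomp _ _) IHp IHq.
- by rewrite /mxcomp rmorphM !mxdir_derivM -!/(mxcomp _ _) IHp IHq !mxeval_comp.
Qed.
End PolyCompose.

Section Translate.
Variables (K : fieldType) (a b : nat).
Implicit Types (A D : 'M[K]_(a, b)) (U : 'M[K]_a) (W : 'M[K]_b).

Definition Xmx : 'M[{mpoly K[a * b]}]_(a, b) := \matrix_(i, j) mxX K i j.

Lemma mxev_Xmx A : mxev A Xmx = A.
Proof. by apply/matrixP => i j; rewrite !mxE mxeval_mxX. Qed.

Definition mxC c d (U : 'M[K]_(c, d)) : 'M[{mpoly K[a * b]}]_(c, d) :=
  map_mx (@mpolyC (a * b) K) U.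

(** [Lie] tests polynomials at 1 only, so the polynomial is translated rather than the point. *)
Definition mxtrans U W (p : {mpoly K[a * b]}) :=
  mxcomp p (mxC U *m Xmx *m mxC W).

Lemma mxev_trans U W A : mxev A (mxC U *m Xmx *m mxC W) = U *m A *m W.
Proof.
apply/matrixP => i j; rewrite !mxE mxeval_sum; apply: eq_bigr => k _.
rewrite mxevalM !mxE mxevalC mxeval_sum; congr (_ * _); apply: eq_bigr => l _.
by rewrite mxevalM !mxE mxevalC mxeval_mxX.
Qed.

Lemma mxdir_deriv_sum (I : Type) (s : seq I) (P : pred I)
    (F : I -> {mpoly K[a * b]}) A D :
  mxdir_deriv (\sum_(i <- s | P i) F i) A D =
    \sum_(i <- s | P i) mxdir_deriv (F i) A D.
Proof.
apply: (big_morph (fun p => mxdir_deriv p A D)) => [p q|].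
  exact: mxdir_derivD.
by rewrite -mpolyC0 mxdir_derivC.
Qed.

Lemma mxdd_trans U W A D : mxdd (mxC U *m Xmx *m mxC W) A D = U *m D *m W.
Proof.
apply/matrixP => i j; rewrite !mxE mxdir_deriv_sum; apply: eq_bigr => k _.
rewrite mxdir_derivM !mxE mxdir_derivC mxevalC mulr0 add0r mulrC; congr (_ * _).
rewrite mxdir_deriv_sum; apply: eq_bigr => l _.
by rewrite mxdir_derivM !mxE mxdir_derivC mxevalC mulr0 addr0 mxdir_deriv_mxX.
Qed.

Lemma mxeval_trans U W p A : mxeval (mxtrans U W p) A = mxeval p (U *m A *m W).
Proof. by rewrite mxeval_comp mxev_trans. Qed.
Lemma mxdir_deriv_trans U W p A D :
  mxdir_deriv (mxtrans U W p) A D = mxdir_deriv p (U *m A *m W) (U *m D *m W).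
Proof. by rewrite mxdir_deriv_comp mxev_trans mxdd_trans. Qed.
End Translate.

Section DetPoly.
Variables (K : fieldType) (n : nat).
Implicit Types (A D g : 'M[K]_n).

Definition detp : {mpoly K[n * n]} := \det (Xmx K n n).

Lemma mxeval_detp A : mxeval detp A = \det A.
Proof.
rewrite -[in RHS](mxev_Xmx A) /mxev.
exact: (esym (det_map_mx (meval (mxvec A 0)) (Xmx K n n))).
Qed.

Lemma mxeval_adj_Xmx A i j : mxeval ((\adj (Xmx K n n)) i j) A = (\adj A) i j.
Proof.
have E : map_mx (meval (mxvec A 0)) (Xmx K n n) = A.
  by apply/matrixP => k l; rewrite !mxE; exact: mxeval_mxX.
by rewrite -[in RHS]E -map_mx_adj [RHS]mxE.
Qed.

(** The exponent is 0 for i = k and 1 otherwise, so the k-th summand omits [F k]. This is what the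
    chain rule gives for a squarefree monomial. *)
Lemma mxdir_deriv_prod (F : 'I_n -> {mpoly K[n * n]}) A D :
  mxdir_deriv (\prod_i F i) A D =
   \sum_k (\prod_i mxeval (F i) A ^+ (1 - (k == i))) * mxdir_deriv (F k) A D.
Proof.
pose m := [multinom 1%N | i < n].
have -> : \prod_i F i = mmap (@mpolyC (n * n) K) F 'X_[m].
  by rewrite mmapX; apply: eq_bigr => i _; rewrite mnmE expr1.
rewrite (@mmap_chain_rule _ _ _ _ (@mpolyC (n * n) K) (meval (mxvec A 0))
  (fun p => mxdir_deriv p A D)); first last.
- by move=> x; rewrite mxdir_derivC.
- by move=> p q; rewrite mxdir_derivM.
- by move=> p q; rewrite mxdir_derivD.
apply: eq_bigr => k _; congr (_ * _).
rewrite mderivX mnmE scale1r mmapX rmorph_prod; apply: eq_bigr => i _.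
by rewrite mnmBE mnmE mnm1E rmorphXn.
Qed.

Lemma mxdir_deriv_detp1 D : mxdir_deriv detp 1%:M D = \tr D.
Proof.
rewrite /detp /determinant mxdir_deriv_sum (bigD1 (1%g : 'S_n)) //=.
rewrite [X in _ + X]big1 ?addr0 => [|s s1].
  rewrite odd_perm1 /= expr0 mul1r mxdir_deriv_prod.
  apply: eq_bigr => k _; rewrite big1 => [|i _]; last first.
    by rewrite !mxE perm1 mxeval_mxX mxE eqxx expr1n.
  by rewrite mul1r mxE perm1 mxdir_deriv_mxX.
have -> : (-1) ^+ odd_perm s = ((-1) ^+ odd_perm s)%:MP :> {mpoly K[n * n]}.
  by rewrite rmorphXn rmorphN rmorph1.
rewrite mxdir_derivM mxdir_derivC mulr0 addr0 mxdir_deriv_prod big1 ?mulr0 // => k _.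
(* A permutation other than 1 moves at least two points, so an off-diagonal factor survives the
   differentiation and vanishes at 1. *)
suff [j jk sj] : exists2 j, j != k & s j != j.
  rewrite (bigD1 j) //= !mxE mxeval_mxX mxE eq_sym (negPf sj) eq_sym (negPf jk).
  by rewrite !mul0r.
have [i si] : exists i, s i != i.
  apply/existsP; apply: contraR s1; rewrite negb_exists => /forallP H.
  apply/eqP/permP => i; rewrite perm1; apply/eqP; exact: negbNE (H i).
have [ik|ik] := eqVneq i k; last by exists i.
exists (s i); first by rewrite -ik.
by rewrite (inj_eq perm_inj).
Qed.

Lemma mxdir_derivX_exp p k A D :
  mxdir_deriv (p ^+ k) A D = k%:R * mxeval p A ^+ k.-1 * mxdir_deriv p A D.
Proof.
elim: k => [|k IH]; first by rewrite expr0 -mpolyC1 mxdir_derivC !mul0r.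
rewrite exprS mxdir_derivM IH /mxeval rmorphXn /=.
case: k {IH} => [|k]; first by rewrite !expr0; ring.
by rewrite /= exprS -(natr1 k.+1); ring.
Qed.

Lemma mxeval_exp p k A : mxeval (p ^+ k) A = mxeval p A ^+ k.
Proof. by rewrite /mxeval rmorphXn. Qed.

Lemma mxdir_deriv_detp g A : mxdir_deriv detp g (g *m A) = \det g * \tr A.
Proof.
have -> : mxdir_deriv detp g (g *m A) = mxdir_deriv (mxtrans g 1%:M detp) 1%:M A.
  by rewrite mxdir_deriv_trans !mulmx1.
have -> : mxtrans g 1%:M detp = (\det g)%:MP * detp.
  rewrite /mxtrans /mxcomp /detp -det_map_mx.
  have -> : map_mx (mmap (mpolyC (n * n) (R:=K)) (mxvec (mxC n n g *m Xmx K n n *m mxC n n 1%:M) 0)) (Xmx K n n) = mxC n n g *m Xmx K n n.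
    apply/matrixP => i j; rewrite mxE [Xmx _ _ _ i j]mxE mmapX mmap1U mxvecE.
    by rewrite /mxC map_mx1 mulmx1.
  by rewrite det_mulmx /mxC det_map_mx.
by rewrite mxdir_derivM mxdir_derivC mulr0 addr0 mxevalC mxdir_deriv_detp1.
Qed.

End DetPoly.

(** * Differentials at the identity *)

Section Diff1.
Variables (K : fieldType) (n : nat) (S : set 'M[K]_n).
Hypotheses (S1 : S 1%:M) (SU : forall g, S g -> g \in unitmx).
Implicit Types (f : 'M[K]_n -> K) (D : 'M[K]_n).

Let detU g : S g -> \det g != 0.
Proof. by move=> /SU; rewrite unitmxE unitfE. Qed.

Lemma represents1 f p k : represents S f p k -> f 1%:M = mxeval p 1%:M.
Proof. by move=> /(_ _ S1); rewrite det1 expr1n divr1. Qed.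

(** If p / det^k and q / det^l both represent f, then p det^l - q det^k vanishes on S, hence has
    derivative 0 along D. *)
Lemma diff1_uniq f D c c' :
  Lie S D -> is_diff1 S f D c -> is_diff1 S f D c' -> c = c'.
Proof.
move=> LD [p [k [fp ->]]] [q [l [fq ->]]].
have := LD (p * detp K n ^+ l - q * detp K n ^+ k).
have E : mxeval p 1%:M = mxeval q 1%:M by rewrite -(represents1 fp) -(represents1 fq).
rewrite mxdir_derivB !mxdir_derivM !mxdir_derivX_exp mxdir_deriv_detp1 !mxeval_exp.
rewrite mxeval_detp det1 !expr1n E => H.
apply/eqP; rewrite -subr_eq0; apply/eqP.
rewrite -[RHS]H; first by ring.
move=> g Sg; rewrite mxevalB !mxevalM !mxeval_exp mxeval_detp.
have := fp g Sg; rewrite fq // => /eqP.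
rewrite eqr_div ?expf_neq0 ?detU // => /eqP ->; ring.
Qed.

Lemma diff1_ext f g D c : (forall x, S x -> f x = g x) ->
  is_diff1 S f D c -> is_diff1 S g D c.
Proof.
move=> fg [p [k [fp ->]]]; exists p, k; split=> // x Sx.
by rewrite -fg // fp.
Qed.

Lemma diff1_cst x D : is_diff1 S (fun=> x) D 0.
Proof.
exists x%:MP, 0%N; split=> [g Sg|]; last by rewrite mxdir_derivC; ring.
by rewrite mxevalC expr0 divr1.
Qed.

Lemma diff1_entry i j D : is_diff1 S (fun g => g i j) D (D i j).
Proof.
exists (mxX K i j), 0%N; split=> [g Sg|]; last by rewrite mxdir_deriv_mxX; ring.
by rewrite mxeval_mxX expr0 divr1.
Qed.

Lemma diff1_detX k D : is_diff1 S (fun g => \det g ^+ k) D (k%:R * \tr D).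
Proof.
exists (detp K n ^+ k), 0%N; split=> [g Sg|].
  by rewrite mxeval_exp mxeval_detp expr0 divr1.
rewrite mxdir_derivX_exp mxdir_deriv_detp1 mxeval_detp det1 expr1n; ring.
Qed.

Lemma diff1D f g D c e : is_diff1 S f D c -> is_diff1 S g D e ->
  is_diff1 S (fun x => f x + g x) D (c + e).
Proof.
move=> [p [k [fp ->]]] [q [l [fq ->]]].
exists (p * detp K n ^+ l + q * detp K n ^+ k), (k + l)%N; split=> [x Sx|].
  rewrite fp // fq // mxevalD !mxevalM !mxeval_exp mxeval_detp exprD.
  by rewrite addf_div ?expf_neq0 ?detU.
rewrite mxdir_derivD !mxdir_derivM !mxdir_derivX_exp mxdir_deriv_detp1.
rewrite mxevalD !mxevalM !mxeval_exp mxeval_detp det1 !expr1n natrD; ring.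
Qed.

Lemma diff1M f g D c e : is_diff1 S f D c -> is_diff1 S g D e ->
  is_diff1 S (fun x => f x * g x) D (f 1%:M * e + g 1%:M * c).
Proof.
move=> [p [k [fp ->]]] [q [l [fq ->]]].
exists (p * q), (k + l)%N; split=> [x Sx|].
  by rewrite fp // fq // !mxevalM exprD mulf_div.
rewrite (represents1 fp) (represents1 fq) mxdir_derivM mxevalM natrD; ring.
Qed.

Lemma diff1Z x f D c : is_diff1 S f D c -> is_diff1 S (fun y => x * f y) D (x * c).
Proof.
by move=> /(diff1M (diff1_cst x D)); rewrite mulr0 addr0.
Qed.

Lemma diff1_sum (I : Type) (s : seq I) (f : I -> 'M[K]_n -> K) (c : I -> K) D :
  (forall i, is_diff1 S (f i) D (c i)) ->
  is_diff1 S (fun x => \sum_(i <- s) f i x) D (\sum_(i <- s) c i).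
Proof.
move=> H; elim: s => [|i s IH].
  by rewrite big_nil; apply: diff1_ext (diff1_cst 0 D) => x _; rewrite big_nil.
rewrite big_cons; apply: diff1_ext (diff1D (H i) IH) => x _ /=.
by rewrite big_cons.
Qed.

Definition mx_diff1 a b (F : 'M[K]_n -> 'M[K]_(a, b)) D (C : 'M[K]_(a, b)) :=
  forall i j, is_diff1 S (fun g => F g i j) D (C i j).

Lemma mx_diff1_uniq a b (F : _ -> 'M[K]_(a, b)) D C C' :
  Lie S D -> mx_diff1 F D C -> mx_diff1 F D C' -> C = C'.
Proof. by move=> LD H H'; apply/matrixP => i j; apply: diff1_uniq (H i j) (H' i j). Qed.

Lemma mx_diff1_ext a b (F G : _ -> 'M[K]_(a, b)) D C :
  (forall x, S x -> F x = G x) -> mx_diff1 F D C -> mx_diff1 G D C.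
Proof. by move=> FG H i j; apply: diff1_ext (H i j) => x /FG ->. Qed.

Lemma mx_diff1_cst a b (B : 'M[K]_(a, b)) D : mx_diff1 (fun=> B) D 0.
Proof. by move=> i j; rewrite mxE; apply: diff1_cst. Qed.

Lemma mx_diff1_id D : mx_diff1 id D D.
Proof. by move=> i j; apply: diff1_entry. Qed.

Lemma mx_diff1M a b c (F : _ -> 'M[K]_(a, b)) (G : _ -> 'M[K]_(b, c)) D C E :
  mx_diff1 F D C -> mx_diff1 G D E ->
  mx_diff1 (fun x => F x *m G x) D (F 1%:M *m E + C *m G 1%:M).
Proof.
move=> HF HG i j; rewrite !mxE -big_split.
apply: (@diff1_ext (fun x => \sum_k F x i k * G x k j)) => [x _|]; first by rewrite mxE.
apply: diff1_sum => k; have := diff1M (HF i k) (HG k j).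
by rewrite [G _ _ _ * _]mulrC.
Qed.

Lemma mx_diff1_poly a b (F : _ -> 'M[K]_(a, b)) D C (Q : {mpoly K[a * b]}) :
  mx_diff1 F D C ->
  is_diff1 S (fun x => mxeval Q (F x)) D (mxdir_deriv Q (F 1%:M) C).
Proof.
move=> HF; elim/mpoly_gen_ind: Q => [x|k|p q IHp IHq|p q IHp IHq].
- rewrite mxdir_derivC; apply: diff1_ext (diff1_cst x D) => g _; by rewrite mxevalC.
- case/mxvec_indexP: k => i j; rewrite -/(mxX K i j) mxdir_deriv_mxX.
  by apply: diff1_ext (HF i j) => g _; rewrite mxeval_mxX.
- rewrite mxdir_derivD; apply: diff1_ext (diff1D IHp IHq) => g _.
  by rewrite mxevalD.
- rewrite mxdir_derivM; apply: diff1_ext (diff1M IHp IHq) => g _.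
  by rewrite mxevalM.
Qed.

Lemma mx_diff1_inv D : mx_diff1 (@invmx K n) D (- D).
Proof.
(* Differentiating adj(X) X = det(X) I at 1 gives this; dividing the adjugate by the determinant
   then removes the trace term. *)
have H : mxdd (\adj (Xmx K n n)) 1%:M D = (\tr D)%:M - D.
  have E i j : mxdir_deriv ((\adj (Xmx K n n) *m Xmx K n n) i j) 1%:M D
      = mxdir_deriv ((detp K n)%:M i j) 1%:M D by rewrite mul_adj_mx.
  apply/matrixP => i j; have := E i j.
  have adj1 k l : mxeval ((\adj (Xmx K n n)) k l) 1%:M = (k == l)%:R.
    rewrite mxeval_adj_Xmx; have := mul_adj_mx (1%:M : 'M[K]_n).
    by rewrite mulmx1 det1 => ->; rewrite mxE.
  rewrite [X in mxdir_deriv X _ _]mxE mxdir_deriv_sum.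
  under eq_bigr => k _ do rewrite mxdir_derivM [Xmx _ _ _ _ _]mxE mxeval_mxX mxdir_deriv_mxX adj1 mxE.
  rewrite big_split /= (bigD1 i) //= eqxx mul1r big1 => [|k ki]; last first.
    by rewrite eq_sym (negPf ki) mul0r.
  rewrite addr0 (bigD1 j) //= eqxx mul1r big1 => [|k ki]; last first.
    by rewrite (negPf ki) mul0r.
  rewrite addr0 [(_)%:M i j]mxE => H; rewrite [LHS]mxE [RHS]mxE [(_)%:M i j]mxE [(- D) i j]mxE.
  case: (i == j) H => /= H.
    rewrite mulr1n mxdir_deriv_detp1 in H; rewrite mulr1n.
    by rewrite -H; ring.
  rewrite mulr0n -mpolyC0 mxdir_derivC in H; rewrite mulr0n.
  by rewrite -H; ring.
move=> i j; exists ((\adj (Xmx K n n)) i j), 1%N; split=> [g Sg|].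
  rewrite /invmx SU // mxE expr1 mulrC; congr (_ / _).
  by rewrite mxeval_adj_Xmx.
have := congr1 (fun M : 'M[K]_n => M i j) H; rewrite [mxdd _ _ _ _ _]mxE => ->.
rewrite mxeval_adj_Xmx.
have := mul_adj_mx (1%:M : 'M[K]_n); rewrite mulmx1 det1 => ->.
by rewrite !mxE -[(_ *+ (i == j))]mulr_natr; ring.
Qed.

Lemma diff1_comp_inv f D c : (forall g, S g -> S (invmx g)) ->
  is_diff1 S f D c -> is_diff1 S (fun g => f (invmx g)) D (- c).
Proof.
move=> SV [p [k [fp ->]]].
(* Inversion turns p / det^k into the product of p(g^-1) and det(g)^k, whose differentials are
   known. *)
apply: (@diff1_ext (fun g => mxeval p (invmx g) * \det g ^+ k)) => [g Sg|].
  rewrite fp; last exact: SV.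
  by rewrite det_inv exprVn invrK.
have := diff1M (mx_diff1_poly p (mx_diff1_inv D)) (diff1_detX k D).
rewrite invmx1 det1 expr1n mul1r -scaleN1r -[X in mxdir_deriv _ _ X]addr0.
rewrite mxdir_deriv_lin.
have -> : mxdir_deriv p 1%:M 0 = 0.
  by rewrite /mxdir_deriv big1 // => l _; rewrite linear0 mxE mulr0.
by congr is_diff1; ring.
Qed.

Lemma diff1_conj f h D c : h \in unitmx ->
  (forall g, S g -> S (h *m g *m invmx h)) ->
  is_diff1 S f (h *m D *m invmx h) c ->
  is_diff1 S (fun g => f (h *m g *m invmx h)) D c.
Proof.
move=> hU Sh [p [k [fp ->]]]; exists (mxtrans h (invmx h) p), k; split=> [g Sg|].
  rewrite fp; last exact: Sh.
  rewrite mxeval_trans !det_mulmx mulrAC -det_mulmx mulmxV // det1 mul1r //.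
by rewrite mxdir_deriv_trans mxeval_trans mulmx1 mulmxV // mxtrace_mulC mulmxA mulVmx // mul1mx.
Qed.

Lemma regular_diff1 f : regular_fun S f -> exists p k,
  represents S f p k /\ forall D, is_diff1 S f D (mxdir_deriv p 1%:M D - k%:R * \tr D * mxeval p 1%:M).
Proof. by move=> [p [k fp]]; exists p, k; split=> // D; exists p, k. Qed.

Lemma is_diff1_regular f D c : is_diff1 S f D c -> regular_fun S f.
Proof. by move=> [p [k [fp _]]]; exists p, k. Qed.

(** By uniqueness a single representative of f serves both directions, and its formula is linear in
    the direction. *)
Lemma diff1_lin f D D' x c c' : Lie S D -> Lie S D' -> 
  is_diff1 S f D c -> is_diff1 S f D' c' -> is_diff1 S f (x *: D + D') (x * c + c').
Proof.
move=> LD LD' H H'; have [p [k [fp E]]] := regular_diff1 (is_diff1_regular H).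
rewrite (diff1_uniq LD H (E D)) (diff1_uniq LD' H' (E D')).
have := E (x *: D + D'); rewrite mxdir_deriv_lin linearP /=.
by congr is_diff1; ring.
Qed.

End Diff1.

(** * Subspaces and duality *)

Section LinClosed.
Variable K : fieldType.

Definition lin_closed (V : lmodType K) (W : V -> Prop) :=
  W 0 /\ forall c u v, W u -> W v -> W (c *: u + v).

Lemma lin_closed_sum (V : lmodType K) (W : V -> Prop) (I : Type) (s : seq I)
    (c : I -> K) (u : I -> V) :
  lin_closed W -> (forall i, W (u i)) -> W (\sum_(i <- s) c i *: u i).
Proof.
move=> [W0 WD] Wu; elim: s => [|i s IH]; first by rewrite big_nil.
by rewrite big_cons; apply: WD.
Qed.

Definition lin_on (V Z : lmodType K) (W : V -> Prop) (f : V -> Z) :=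
  forall c u v, W u -> W v -> f (c *: u + v) = c *: f u + f v.

Lemma lin_on_sum (V Z : lmodType K) (W : V -> Prop) (f : V -> Z) (I : Type)
    (s : seq I) (c : I -> K) (u : I -> V) :
  lin_closed W -> lin_on W f -> (forall i, W (u i)) ->
  f (\sum_(i <- s) c i *: u i) = \sum_(i <- s) c i *: f (u i).
Proof.
move=> LW Lf Wu; elim: s => [|i s IH]; last first.
  by rewrite !big_cons Lf ?IH //; apply: lin_closed_sum.
have := Lf 1 0 0 (proj1 LW) (proj1 LW); rewrite !big_nil !scale1r addr0.
by move=> /eqP; rewrite -[X in X == _]addr0 (inj_eq (addrI _)) => /eqP.
Qed.

(** U has the largest rank among the row spaces contained in W, so adjoining a vector of W does not
    enlarge it. *)
Lemma subspace_mx (M : nat) (W : 'rV[K]_M -> Prop) : lin_closed W ->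
  exists U : 'M[K]_M, forall w, W w <-> (w <= U)%MS.
Proof.
move=> [W0 WD]; pose P (U : 'M[K]_M) := forall u : 'rV[K]_M, (u <= U)%MS -> W u.
have [|U PU Umin] := @ex_minimal _ P (fun U => M - \rank U)%N.
  by exists 0 => u; rewrite submx0 => /eqP ->.
exists U => w; split=> [Ww|]; last exact: PU.
have PUw : P (U + w)%MS.
  move=> u /sub_addsmxP [[a b] /= ->]; rewrite addrC -[_ *m w]addr0.
  have -> : b *m w = b 0 0 *: w by rewrite {1}[b]mx11_scalar mul_scalar_mx.
  by rewrite addr0; apply: WD => //; apply: PU; rewrite submxMl.
have H : (\rank (U + w)%MS <= \rank U)%N.
  have := Umin _ PUw; have := rank_leq_row U; have := rank_leq_row (U + w)%MS.
  by move=> h1 h2; rewrite leq_sub2lE.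
have : (U == U + w)%MS by rewrite -mxrank_leqif_eq ?addsmxSl // eqn_leq H mxrankS ?addsmxSl.
by case/andP => _; rewrite addsmx_sub => /andP[].
Qed.

Lemma lin_closed_full (M : nat) (W : 'rV[K]_M -> Prop) : lin_closed W ->
  (forall c : 'cV[K]_M, (forall w, W w -> w *m c = 0) -> c = 0) ->
  forall w, W w.
Proof.
move=> /subspace_mx [U WU] H w; apply/WU; rewrite submxE.
suff -> : cokermx U = 0 by rewrite mulmx0.
apply/matrixP => i j; have -> : cokermx U i j = col j (cokermx U) i 0 by rewrite [RHS]mxE.
rewrite (H (col j (cokermx U))) ?mxE // => v /WU; rewrite submxE => /eqP E.
by rewrite colE mulmxA E mul0mx.
Qed.

Lemma lin_closed_full_col (M : nat) (W : 'cV[K]_M -> Prop) : lin_closed W ->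
  (forall c : 'rV[K]_M, (forall w, W w -> c *m w = 0) -> c = 0) ->
  forall w, W w.
Proof.
move=> [W0 WD] H w; rewrite -[w]trmxK.
apply: (@lin_closed_full _ (fun v => W v^T)) => [|c Hc].
  by split=> [|c u v]; rewrite ?trmx0 // linearP /=; apply: WD.
apply: trmx_inj; rewrite trmx0; apply: H => v Wv.
by rewrite -[v]trmxK -trmx_mul Hc ?trmxK // trmx0.
Qed.

(** Finitely many vectors of the family already span its whole span. This cuts families of linear
    conditions indexed by a group or an ideal down to finite ones. *)
Lemma finite_span (T : eqType) (M : nat) (G : T -> Prop) (v : T -> 'rV[K]_M) :
  exists hs : seq T, (forall h, h \in hs -> G h) /\
   forall t (c : 'cV[K]_M), G t -> (forall h, h \in hs -> v h *m c = 0) -> v t *m c = 0.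
Proof.
pose P (hs : seq T) := forall h, h \in hs -> G h.
pose U hs := (\sum_(h <- hs) <<v h>>)%MS : 'M[K]_M.
have [|hs Phs hmin] := @ex_minimal _ P (fun hs => M - \rank (U hs))%N.
  by exists [::].
exists hs; split=> // t c Gt Hc.
have UE : U (t :: hs) = (<<v t>> + U hs)%MS by rewrite /U big_cons.
have le : (\rank (U (t :: hs)) <= \rank (U hs))%N.
  have := hmin (t :: hs); rewrite leq_sub2lE ?rank_leq_row //; apply.
  by move=> h; rewrite inE => /orP[/eqP ->|/Phs].
have : (U hs == U (t :: hs))%MS.
  have S : (U hs <= U (t :: hs))%MS by rewrite UE addsmxSr.
  by rewrite -mxrank_leqif_eq // eqn_leq le mxrankS.
case/andP => _; rewrite UE addsmx_sub genmxE => /andP[/submxP [a ->] _].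
rewrite -mulmxA; suff -> : U hs *m c = 0 by rewrite mulmx0.
rewrite /U; elim: hs Hc {Phs hmin UE le} => [|h hs IH] Hc.
  by rewrite big_nil mul0mx.
rewrite big_cons; apply/eqP; rewrite -sub_kermx.
rewrite addsmx_sub genmxE !sub_kermx Hc ?mem_head // eqxx /=.
by rewrite IH // => h' h'h; apply: Hc; rewrite inE h'h orbT.
Qed.

End LinClosed.

(** * Representing linear forms by a non-degenerate bilinear form *)

Section Riesz.
Variables (K : fieldType) (n : nat) (W : 'M[K]_n -> Prop) (B : 'M[K]_n -> 'M[K]_n -> K).
Hypothesis LW : lin_closed W.
Hypothesis Bl : forall C, W C -> lin_on W (fun A => B A C : K^o).
Hypothesis Br : forall A, W A -> lin_on W (fun C => B A C : K^o).
Hypothesis nondeg : forall A, W A -> (forall C, W C -> B A C = 0) -> A = 0.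

(** In a basis u of W the vectors (B(u_i, C))_i form a subspace. A column annihilating it yields an
    element of the left radical, hence is 0, so the subspace is everything and contains
    (l(u_i))_i. *)
Lemma riesz (l : 'M[K]_n -> K) : lin_on W (l : _ -> K^o) ->
  exists2 C, W C & forall A, W A -> B A C = l A.
Proof.
move=> Ll.
have [U WU] : exists U : 'M[K]_(n * n), forall w, W (vec_mx w) <-> (w <= U)%MS.
  apply: subspace_mx; split=> [|c u v Wu Wv]; first by rewrite linear0; case: LW.
  by rewrite linearP; apply: (proj2 LW).
pose r := \rank U; pose u (i : 'I_r) := vec_mx (row i (row_base U)) : 'M[K]_n.
have Wu i : W (u i) by apply/WU; rewrite -(eq_row_base U) row_sub.
have dec A : W A -> exists c : 'I_r -> K, A = \sum_i c i *: u i.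
  move=> WA; have : (mxvec A <= row_base U)%MS.
    by rewrite eq_row_base; apply/WU; rewrite mxvecK.
  case/submxP => a E; exists (a 0); rewrite -[LHS]mxvecK E mulmx_sum_row linear_sum.
  by apply: eq_bigr => i _; rewrite linearZ.
pose R (w : 'rV[K]_r) := exists2 C, W C & forall i, w 0 i = B (u i) C.
have Rfull : forall w, R w.
  apply: lin_closed_full.
    split=> [|c w w' [C WC wC] [C' WC' wC']].
      exists 0; first by case: LW.
      move=> i; rewrite mxE; have := Br (Wu i) 1 (proj1 LW) (proj1 LW).
      rewrite !scale1r addr0 => /eqP; rewrite -[X in X == _]addr0 (inj_eq (addrI _)).
      by move=> /eqP ->.
    exists (c *: C + C'); first by apply: (proj2 LW).
    by move=> i; rewrite !mxE (Br (Wu i)) // wC wC'.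
  move=> c Hc; have Z : \sum_i c i 0 *: u i = 0.
    apply: nondeg; first by apply: lin_closed_sum.
    move=> C WC; rewrite (lin_on_sum _ _ LW (Bl WC)) //.
    have := Hc (\row_i B (u i) C).
    move=> /(_ _)/matrixP/(_ 0 0); rewrite !mxE => E; rewrite -[RHS]E; last first.
      by exists C => // i; rewrite mxE.
    by apply: eq_bigr => i _; rewrite mxE mulrC.
  have : c^T *m row_base U = 0.
    rewrite mulmx_sum_row; apply: (can_inj vec_mxK); rewrite linear0 linear_sum -[RHS]Z.
    by apply: eq_bigr => i _; rewrite linearZ mxE.
  move/eqP; rewrite mulmx_free_eq0 ?row_base_free // => /eqP E.
  by rewrite -[c]trmxK E trmx0.
have [C WC HC] := Rfull (\row_i l (u i)).
exists C => // A WA; have [c ->] := dec A WA.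
rewrite (lin_on_sum _ _ LW (Bl WC)) // (lin_on_sum _ _ LW Ll) //.
by apply: eq_bigr => i _; rewrite -HC mxE.
Qed.
End Riesz.

(** * Dense orbits and surjective differentials *)

Lemma mpoly_vanish (K : fieldType) N (p : {mpoly K[N]}) :
  [pchar K] =i pred0 -> (forall v, p.@[v] = 0) -> p = 0.
Proof.
move=> ch; apply: (mpoly_zero_closed (J := fun p => forall v, p.@[v] = 0)
  (v := fun=> 0)) => // {}p k pz v.
(* The partial derivative at v is the coefficient of X in the restriction of p to the line v + X
   e_k, and this restriction has only zero values. *)
pose h (i : 'I_N) : {poly K} := (v i)%:P + (i == k)%:R *: 'X.
pose P := mmap (@polyC K) h p.
have ev x : P.[x] = p.@[fun i => v i + (i == k)%:R * x].
  rewrite /P; elim/mpoly_gen_ind: (p) => [c|i|q r IHq IHr|q r IHq IHr].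
  - by rewrite mmapC mevalC hornerC.
  - by rewrite mmapX mmap1U mevalXU hornerD hornerC hornerZ hornerX.
  - by rewrite rmorphD hornerD IHq IHr mevalD.
  - by rewrite rmorphM hornerM IHq IHr mevalM.
have P0 : P = 0 by apply: poly_vanish => // x; rewrite ev pz.
have := @mmap_chain_rule N K {poly K} K (@polyC K) (horner_eval 0)
  (fun q => q`_1) h _ _ _ p.
rewrite -/P P0 coef0 => /(_ _ _ _)/esym E.
have {}E := E _ _ _; rewrite -[RHS]E; last first.
- by move=> x; rewrite coefC.
- move=> q r; rewrite /= /horner_eval !horner_coef0 coefM !big_ord_recl big_ord0 /=.
  by rewrite /bump /=; ring.
- by move=> q r; rewrite coefD.
rewrite (bigD1 k) //= big1 => [|i ik]; last first.
  by rewrite /h coefD coefC coefZ coefX (negPf ik) mul0r add0r mulr0.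
rewrite /h eqxx scale1r coefD coefC coefX add0r mulr1 addr0 /= /horner_eval -/h.
elim/mpoly_gen_ind: (p^`M(k)) => [c|i|q r IHq IHr|q r IHq IHr].
- by rewrite mmapC mevalC hornerC.
- by rewrite mmapX mmap1U mevalXU /h hornerD hornerC hornerZ hornerX mulr0 addr0.
- by rewrite mevalD rmorphD hornerD IHq IHr.
- by rewrite mevalM rmorphM hornerM IHq IHr.
Qed.

Lemma mxpoly_vanish (K : fieldType) a b (p : {mpoly K[a * b]}) :
  [pchar K] =i pred0 -> (forall A, mxeval p A = 0) -> p = 0.
Proof.
move=> ch H; apply: mpoly_vanish => // v.
have := H (vec_mx (\row_i v i)); rewrite /mxeval vec_mxK => <-.
by apply: meval_eq => i; rewrite mxE.
Qed.

Lemma dense_vanish (K : fieldType) a b (S : set 'M[K]_(a, b)) p :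
  [pchar K] =i pred0 -> zariski_dense S -> (forall A, S A -> mxeval p A = 0) -> p = 0.
Proof.
move=> ch dS pS; apply: mxpoly_vanish => // A.
have : [set A | mxeval p A = 0] = setT.
  apply: dS => [|B]; last exact: pS.
  exists [set p]; apply/seteqP; split=> [B /= pB q ->//|B /= H]; exact: H.
by move/seteqP => [_ /(_ A)]; apply.
Qed.

Lemma Lie_lin_closed (K : fieldType) n (S : set 'M[K]_n) : lin_closed (Lie S).
Proof.
split=> [p _|c u v Lu Lv p pS].
  by rewrite /mxdir_deriv big1 // => k _; rewrite linear0 mxE mulr0.
by rewrite mxdir_deriv_lin Lu // Lv // mulr0 addr0.
Qed.

(** The gradients at 1 lie in a finite-dimensional space. Finiteness matters because an ultrafilter
    is closed only under finite intersections. *)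
Lemma Lie_finite (K : fieldType) n (S : set 'M[K]_n) :
  exists ps : seq {mpoly K[n * n]},
    (forall p, p \in ps -> forall g, S g -> mxeval p g = 0) /\
    forall A, (forall p, p \in ps -> mxdir_deriv p 1%:M A = 0) -> Lie S A.
Proof.
pose v (p : {mpoly K[n * n]}) := \row_k (p^`M(k)).@[mxvec (1%:M : 'M[K]_n) 0].
have vE p A : (v p *m (mxvec A)^T) 0 0 = mxdir_deriv p 1%:M A.
  by rewrite mxE; apply: eq_bigr => k _; rewrite !mxE.
have [ps [psG H]] := @finite_span K _ _ (fun p => forall g, S g -> mxeval p g = 0) v.
exists ps; split=> // A pA p pG; rewrite -vE (H p) ?mxE // => q qps.
by apply/matrixP => i j; rewrite !ord1 vE pA // mxE.
Qed.

(** The comultiplication of K[M_n]: p(hX) is a finite sum of functions of h times polynomials in X,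
    so the translates of p span a finite-dimensional space. *)
Lemma mxtrans_separable (K : fieldType) n (p : {mpoly K[n * n]}) :
  exists (I : finType) (v : 'M[K]_n -> I -> K) (q : I -> {mpoly K[n * n]}),
    forall h, mxtrans h 1%:M p = \sum_i (v h i)%:MP * q i.
Proof.
elim/mpoly_gen_ind: p => [c|k|p1 p2 [I [v [q E]]] [I' [v' [q' E']]]|p1 p2 [I [v [q E]]] [I' [v' [q' E']]]].
- exists unit, (fun _ _ => 1), (fun=> c%:MP) => h.
  by rewrite /mxtrans /mxcomp mmapC big_const card_unit /= addr0 mpolyC1 mul1r.
- case/mxvec_indexP: k => i j.
  exists 'I_n, (fun h l => h i l), (fun l => mxX K l j) => h.
  rewrite /mxtrans /mxcomp mmapX mmap1U mxvecE /mxC map_mx1 mulmx1 mxE.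
  by apply: eq_bigr => l _; rewrite !mxE.
- exists (I + I')%type, (fun h => sum_rect (fun=> K) (v h) (v' h)),
    (sum_rect (fun=> {mpoly K[n * n]}) q q') => h.
  by rewrite big_sumType /= -E -E' /mxtrans /mxcomp rmorphD.
- exists (I * I')%type, (fun h ij => v h ij.1 * v' h ij.2),
    (fun ij => q ij.1 * q' ij.2) => h.
  have -> : mxtrans h 1%:M (p1 * p2) = mxtrans h 1%:M p1 * mxtrans h 1%:M p2.
    by rewrite /mxtrans /mxcomp rmorphM.
  rewrite E E'.
  rewrite big_distrlr pair_big /=; apply: eq_bigr => ij _.
  by rewrite mpolyCM; ring.
Qed.

(* A condition on all h in G is thus implied by finitely many, which an ultrafilter can handle. *)
Lemma translates_finite (K : fieldType) n (G : set 'M[K]_n) (p : {mpoly K[n * n]}) :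
  (forall g, G g -> G (invmx g)) -> (forall g, G g -> g \in unitmx) ->
  exists hs : seq 'M[K]_n, (forall h, h \in hs -> G h) /\
   forall g y, G g ->
     (forall h, h \in hs -> mxdir_deriv (mxtrans h 1%:M p) g y = 0) ->
     mxdir_deriv p 1%:M (invmx g *m y) = 0.
Proof.
move=> GV GU; have [I [v [q E]]] := mxtrans_separable p.
have [hs [Ghs H]] := @finite_span K _ #|I| G (fun h => \row_i v h (enum_val i)).
exists hs; split=> // g y Gg Hy.
pose c := (\col_i mxdir_deriv (q (enum_val i)) g y) : 'cV[K]_#|I|.
have cE h : mxdir_deriv (mxtrans h 1%:M p) g y = ((\row_i v h (enum_val i)) *m c) 0 0.
  rewrite E mxdir_deriv_sum (reindex _ (onW_bij _ (enum_val_bij I))) mxE.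
  apply: eq_bigr => i _; rewrite !mxE mxdir_derivM mxevalC mxdir_derivC mulr0 addr0 //.
have := cE (invmx g); rewrite (H _ c) ?mxE; last first.
- by move=> h hhs; apply/matrixP => i j; rewrite !ord1 -cE Hy // mxE.
- exact: GV.
by rewrite mxdir_deriv_trans !mulmx1 mulVmx // GU.
Qed.

(** * Equivariant maps: density of the image against surjectivity of the differential *)

Section Equivariant.
Variables (K : fieldType) (n a b : nat) (G : set 'M[K]_n).
Hypothesis charK : [pchar K] =i pred0.
Hypotheses (G1 : G 1%:M) (GU : forall g, G g -> g \in unitmx).
Hypotheses (GM : forall g h, G g -> G h -> G (g *m h)).
Variables (F dF : 'M[K]_n -> 'M[K]_(a, b)).
Hypothesis FdF : forall A, Lie G A -> mx_diff1 G F A (dF A).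
Variables (U : 'M[K]_n -> 'M[K]_a) (W : 'M[K]_n -> 'M[K]_b).
Hypothesis FUW : forall h g, G h -> G g -> F (h *m g) = U h *m F g *m W h.
Hypotheses (UU : forall g, G g -> U g \in unitmx) (WU : forall g, G g -> W g \in unitmx).

Lemma mx_diff1_lin : lin_on (Lie G) dF.
Proof.
move=> c A B LA LB; have [L0 LD] := Lie_lin_closed G.
apply: (mx_diff1_uniq G1 GU (LD c A B LA LB)); first by apply: FdF; apply: LD.
move=> i j; rewrite !mxE; apply: (diff1_lin G1 GU) => //; exact: FdF.
Qed.

(* If p vanishes on F(G), then so do all its partial derivatives: translate to a point h of G
   and differentiate p o F there. *)
Lemma submersion_dense :
  (forall v, exists2 A, Lie G A & dF A = v) -> zariski_dense (F @` G).
Proof.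
move=> surj Z [P ->] FP; apply/seteqP; split=> // B _ p Pp /=.
suff -> : p = 0 by rewrite /mxeval meval0.
apply: (mpoly_zero_closed (J := fun q => forall g, G g -> mxeval q (F g) = 0)
   (v := mxvec (F 1%:M) 0)) => //.
- move=> q k Hq h Gh; pose v : 'M[K]_(a, b) := vec_mx (delta_mx 0 k).
  have [A LA dA] := surj (invmx (U h) *m v *m invmx (W h)).
  rewrite /mxeval -mxdir_deriv_delta.
  have E : mx_diff1 G (fun g => U h *m F g *m W h) A v.
    have H := mx_diff1M G1 GU (mx_diff1M G1 GU (mx_diff1_cst G (U h) A) (FdF LA))
       (mx_diff1_cst G (W h) A).
    move=> i j; have := H i j; congr is_diff1.
    rewrite mulmx0 mul0mx add0r addr0 dA !mulmxA mulmxV ?UU // mul1mx.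
    by rewrite -mulmxA mulVmx ?WU // mulmx1.
  have := mx_diff1_poly G1 GU q E; rewrite -FUW // mulmx1 => H.
  apply: (diff1_uniq G1 GU LA H).
  apply: diff1_ext (diff1_cst G 0 A) => g Gg.
  by rewrite -FUW // Hq //; apply: GM.
- by move=> q Hq; apply: Hq.
- by move=> g Gg; apply: FP => //; exists g.
Qed.

End Equivariant.

(** Modulo the null functions of an ultrafilter this ring stands in for a function field, so that no
    irreducible component of G has to be singled out. The base point makes the ring non-zero. *)
Definition fun_ring (T : pointedType) (K : fieldType) : comNzRingType :=
  [the comNzRingType of T -> K].
Definition mx_pointed (K : fieldType) n : pointedType :=
  HB.pack 'M[K]_n (isPointed.Build 'M[K]_n 0).

Section DenseSubmersion.
Variables (K : fieldType) (n a b : nat) (G : set 'M[K]_n).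
Hypothesis charK : [pchar K] =i pred0.
Hypotheses (G1 : G 1%:M) (GU : forall g, G g -> g \in unitmx).
Hypotheses (GM : forall g h, G g -> G h -> G (g *m h)).
Hypothesis GV : forall g, G g -> G (invmx g).
Variables (F dF : 'M[K]_n -> 'M[K]_(a, b)).
Hypothesis FdF : forall A, Lie G A -> mx_diff1 G F A (dF A).
Variables (U : 'M[K]_n -> 'M[K]_a) (W : 'M[K]_n -> 'M[K]_b).
Hypothesis FUW : forall h g, G h -> G g -> F (h *m g) = U h *m F g *m W h.
Hypotheses (UU : forall g, G g -> U g \in unitmx) (WU : forall g, G g -> W g \in unitmx).
Hypothesis denseF : zariski_dense (F @` G).

Let Q := fun_ring (mx_pointed K n) K.
Definition cst_fun (x : K) : Q := fun=> x.
Lemma cst_fun_zmod : zmod_morphism cst_fun.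
Proof. by move=> x y; apply/funext. Qed.
Lemma cst_fun_monoid : monoid_morphism cst_fun.
Proof. by split=> [|x y]; apply/funext. Qed.
HB.instance Definition _ := GRing.isZmodMorphism.Build K Q cst_fun cst_fun_zmod.
HB.instance Definition _ := GRing.isMonoidMorphism.Build K Q cst_fun cst_fun_monoid.

Let phi := @mmap (a * b) K Q cst_fun (fun k g => mxvec (F g) 0 k) : {rmorphism {mpoly K[a * b]} -> Q}.

Let phiE p : phi p = (fun g => mxeval p (F g)) :> Q.
Proof.
elim/mpoly_gen_ind: p => [c|k|p q IHp IHq|p q IHp IHq].
- by rewrite /phi /= mmapC; apply/funext => g; rewrite mxevalC.
- by rewrite /phi /= mmapX mmap1U; apply/funext => g; rewrite /mxeval mevalXU.
- by rewrite rmorphD IHp IHq; apply/funext => g; rewrite mxevalD.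
- by rewrite rmorphM IHp IHq; apply/funext => g; rewrite mxevalM.
Qed.

Let base : set_system 'M[K]_n :=
  [set S | exists2 p, p != 0 & forall g, G g -> mxeval p (F g) != 0 -> S g].

(** Properness is density: the empty set would belong to [base] only if some p != 0 vanished on
    F(G). *)
Let base_proper : ProperFilter base.
Proof.
apply: Build_ProperFilter.
  move=> [p p0 H]; move/eqP: p0; apply; apply: (dense_vanish charK denseF) => _ [g Gg <-].
  by apply/eqP; apply: contraT => /(H g Gg).
split.
- by exists 1; rewrite ?oner_neq0.
- move=> S T [p p0 Sp] [q q0 Tq]; exists (p * q); first by rewrite mulf_neq0.
  by move=> g Gg; rewrite mxevalM mulf_eq0 negb_or => /andP[? ?]; split; [apply: Sp|apply: Tq].
- by move=> S T ST [p p0 Sp]; exists p => // g Gg pg; apply: ST; apply: Sp.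
Qed.

(* An ultrafilter on G containing the sets [set g | p (F g) != 0], p != 0, makes the entries of F
   algebraically independent functions on G modulo null functions.  Their derivation in the
   direction U g v W g extends, up to a factor s, to the coordinate functions g_ij; at almost
   every g its values form a tangent vector y of G at g, and (s g)^-1 g^-1 y is the required A. *)
Lemma dense_submersion v : exists2 A, Lie G A & dF A = v.
Proof.
have [UF [ultra baseUF]] := ultraFilterLemma base_proper.
have UG : UF G by apply: baseUF; exists 1; rewrite ?oner_neq0.
pose N (f : Q) := UF [set g | f g = 0].
have Nae (f : Q) : (forall g, G g -> f g = 0) -> N f by move=> H; apply: filterS UG.
have pN : prime_pred N.
  split.
  - exact: Nae.
  - by move=> f g; apply: filterS2 => x /= E1 E2; rewrite -[LHS]/(f x + g x) E1 E2 addr0.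
  - by move=> f g; apply: filterS => x /= E; rewrite -[LHS]/(f x * g x) E mulr0.
  - move=> f g Nfg; have [|Nf] := in_ultra_setVsetC [set x | f x = 0] ultra; first by left.
    right; apply: filterS2 Nfg Nf => x /= /eqP; rewrite -[X in X == _]/(f x * g x) mulf_eq0.
    by case/orP => /eqP.
  - move=> k Nk; have [x /= E] := filter_ex Nk.
    have nE : forall j, (j%:R : Q) x = j%:R.
      by elim=> // j IH; rewrite -natr1 -[RHS]natr1 -IH.
    by move/eqP: E; rewrite nE; move: charK => /pcharf0P ->.
pose D (p : {mpoly K[a * b]}) : Q :=
  fun g => mxdir_deriv p (F g) (U g *m v *m W g).
have derD : derivation phi D.
  split=> p q; apply/funext => g; rewrite /D ?mxdir_derivD ?mxdir_derivM //.
  by rewrite !phiE.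
have D0 c : D c%:MP = 0 by apply/funext => g; rewrite /D mxdir_derivC.
(* For p != 0 the locus p(F g) != 0 is in the ultrafilter, so only p = 0 has a null image. *)
have kerD p : N (phi p) -> N (D p).
  move=> Np; have [->|p0] := eqVneq p 0; first by rewrite -mpolyC0 D0; exact: Nae.
  have Up : UF [set g | mxeval p (F g) <> 0].
    by apply: baseUF; exists p => // g _ /eqP.
  by have [g /= [E1]] := filter_ex (filterI Np Up); rewrite phiE in E1.
pose ws := codom (fun ij : 'I_n * 'I_n => (fun g : 'M[K]_n => g ij.1 ij.2) : Q).
have [A' [iota [phi' [D' [s [Ns [derD' kerD'] phiI DI wsE]]]]]] :=
  derivation_adjoin ws pN derD kerD.
have /choice [am amE] : forall ij : 'I_n * 'I_n, exists x, phi' x = (fun g : 'M[K]_n => g ij.1 ij.2) :> Q.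
  by move=> ij; apply: wsE; apply: codom_f.
pose c : {rmorphism K -> A'} := (iota \o @mpolyC (a * b) K).
pose aM : 'M[A']_n := \matrix_(i, j) am (i, j).
pose ev := mmap c (mxvec aM 0) : {rmorphism {mpoly K[n * n]} -> A'}.
have phiev p : phi' (ev p) = (fun g => mxeval p g) :> Q.
  elim/mpoly_gen_ind: p => [x|k|p q IHp IHq|p q IHp IHq].
  - rewrite /ev /= mmapC /c /= phiI phiE; apply/funext => g; by rewrite !mxevalC.
  - rewrite /ev /= mmapX mmap1U; case/mxvec_indexP: k => i j; rewrite mxvecE mxE amE /=.
    by apply/funext => g; rewrite -/(mxX K i j) mxeval_mxX.
  - by rewrite !rmorphD IHp IHq; apply/funext => g; rewrite mxevalD.
  - by rewrite !rmorphM IHp IHq; apply/funext => g; rewrite mxevalM.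
pose y (g : 'M[K]_n) : 'M[K]_n := \matrix_(i, j) D' (am (i, j)) g.
have [dD dM] := derD'.
have Dev p : D' (ev p) = (fun g => mxdir_deriv p g (y g)) :> Q.
  have Dc x : D' (c x) = 0 by rewrite /c /= DI D0 mulr0.
  elim/mpoly_gen_ind: p => [x|k|p q IHp IHq|p q IHp IHq].
  - rewrite /ev /= mmapC Dc; apply/funext => g; by rewrite mxdir_derivC.
  - rewrite /ev /= mmapX mmap1U; case/mxvec_indexP: k => i j; rewrite mxvecE mxE.
    by apply/funext => g; rewrite -/(mxX K i j) mxdir_deriv_mxX mxE.
  - by rewrite rmorphD dD IHp IHq; apply/funext => g; rewrite mxdir_derivD.
  - by rewrite rmorphM dM IHp IHq !phiev; apply/funext => g; rewrite mxdir_derivM.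
have seqUF (T : eqType) (P : T -> set 'M[K]_n) (ts : seq T) :
    (forall t, t \in ts -> UF (P t)) -> UF [set g | forall t, t \in ts -> P t g].
  elim: ts => [|t ts IH] H; first by apply: filterS filterT => g _ t.
  have H1 := H t (mem_head t ts).
  have /IH H2 : forall t', t' \in ts -> UF (P t') by move=> t' tt; apply: H; rewrite inE tt orbT.
  apply: filterS2 H1 H2 => g Pt Pts t'; rewrite inE => /orP[/eqP -> //|]; exact: Pts.
(* D' preserves null functions. Applied to a p vanishing on G, this is one equation of the tangency
   of y g to G at almost every g. *)
have van p : (forall g, G g -> mxeval p g = 0) -> UF [set g | mxdir_deriv p g (y g) = 0].
  move=> pG; have /kerD' : N (phi' (ev p)) by apply: Nae => g Gg; rewrite phiev pG.
  by rewrite Dev.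
have tangent : UF [set g | Lie G (invmx g *m y g)].
  have [ps [psG psL]] := Lie_finite G.
  have : UF [set g | forall p, p \in ps -> mxdir_deriv p 1%:M (invmx g *m y g) = 0].
    apply: (seqUF _ (fun p g => mxdir_deriv p 1%:M (invmx g *m y g) = 0)) => p pps.
    have [hs [Ghs H]] := translates_finite p GV GU.
    have Hy : UF [set g | forall h, h \in hs -> mxdir_deriv (mxtrans h 1%:M p) g (y g) = 0].
      apply: (seqUF _ (fun h g => mxdir_deriv (mxtrans h 1%:M p) g (y g) = 0)) => h hhs.
      apply: van => g Gg; rewrite mxeval_trans mulmx1; apply: psG => //.
      by apply: GM => //; apply: Ghs.
    by apply: filterS2 UG Hy => g Gg Hg; apply: H.
  by apply: filterS => g Hg; apply: psL.
pose E (ij : 'I_a * 'I_b) : set 'M[K]_n := fun g => Lie G (invmx g *m y g) ->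
   (U g *m dF (invmx g *m y g) *m W g) ij.1 ij.2 = s g * (U g *m v *m W g) ij.1 ij.2.
have UE : UF [set g | forall ij, ij \in enum {: 'I_a * 'I_b} -> E ij g].
  apply: seqUF => -[i j] _.
  have [p [k [fp _]]] := FdF (proj1 (Lie_lin_closed G)) i j.
  (* r encodes the relation F_ij det^k = p valid on G. That D' r is null says that the derivative of
     F_ij along y is s times the (i, j) entry of U v W. *)
  pose r := iota (mxX K i j) * ev (detp K n ^+ k) - ev p.
  have phir : phi' r = (fun g => F g i j * \det g ^+ k - mxeval p g) :> Q.
    rewrite /r rmorphB rmorphM phiI !phiev phiE; apply/funext => g.
    rewrite -[LHS]/(mxeval (mxX K i j) (F g) * mxeval (detp K n ^+ k) g - mxeval p g).
    by rewrite mxeval_mxX mxeval_exp mxeval_detp.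
  have Dr : D' r = (fun g => F g i j * (k%:R * \det g ^+ k.-1 * mxdir_deriv (detp K n) g (y g))
      + \det g ^+ k * (s g * (U g *m v *m W g) i j) - mxdir_deriv p g (y g)) :> Q.
    have dN x : D' (- x) = - D' x.
      apply: (addrI (D' x)); rewrite -dD !subrr.
      by apply: (addrI (D' 0)); rewrite -dD !addr0.
    rewrite /r dD dN dM !Dev DI phiI phiev phiE; apply/funext => g.
    rewrite -[LHS]/(mxeval (mxX K i j) (F g) * mxdir_deriv (detp K n ^+ k) g (y g)
       + mxeval (detp K n ^+ k) g * (s g * D (mxX K i j) g) - mxdir_deriv p g (y g)).
    rewrite /D mxeval_mxX mxeval_exp mxeval_detp mxdir_derivX_exp mxdir_deriv_mxX.
    by rewrite mxeval_detp.
  have : N (D' r).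
    apply: kerD'; apply: Nae => g Gg; rewrite phir fp // divfK ?subrr //.
    by rewrite expf_neq0 // -unitfE -unitmxE GU.
  apply: filterS2 UG => g Gg /=; rewrite Dr => H LA.
  set A := invmx g *m y g in LA *.
  have yE : y g = g *m A by rewrite mulmxA mulmxV ?GU // mul1mx.
  have dg : \det g != 0 by rewrite -unitfE -unitmxE GU.
  have H1 : is_diff1 G (fun h => F (g *m h) i j) A ((U g *m dF A *m W g) i j).
    have := mx_diff1M G1 GU (mx_diff1M G1 GU (mx_diff1_cst G (U g) A) (FdF LA))
       (mx_diff1_cst G (W g) A).
    rewrite mulmx0 mul0mx add0r addr0 => /(_ i j); apply: diff1_ext => h Gh.
    by rewrite FUW.
  have H2 : is_diff1 G (fun h => F (g *m h) i j) A
     ((mxdir_deriv p g (y g) - k%:R * \tr A * mxeval p g) / \det g ^+ k).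
    exists ((\det g ^- k)%:MP * mxtrans g 1%:M p), k; split=> [h Gh|].
      rewrite fp; last exact: GM.
      rewrite mxevalM mxevalC mxeval_trans mulmx1 det_mulmx exprMn invfM; ring.
    rewrite mxdir_derivM mxevalM mxdir_derivC mxevalC mxdir_deriv_trans mxeval_trans.
    by rewrite !mulmx1 -yE; ring.
  rewrite /= (diff1_uniq G1 GU LA H1 H2).
  move: H; rewrite yE mxdir_deriv_detp => /eqP; rewrite subr_eq0 => /eqP <-.
  rewrite fp //; have -> : mxeval p g / \det g ^+ k * (k%:R * \det g ^+ k.-1 * (\det g * \tr A))
     = k%:R * \tr A * mxeval p g.
    case: k {fp phir Dr r H2} => [|k]; first by rewrite !mul0r mulr0.
    by rewrite /= exprS; field; rewrite dg expf_neq0.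
  by rewrite [_ + \det g ^+ k * _]addrC addrK mulrC mulKf // expf_neq0.
have Us : UF [set g | s g <> 0].
  by have [|] := in_ultra_setVsetC [set g | s g = 0] ultra.
have [g [[[/= Gg LA] sg] Eg]] := filter_ex (filterI (filterI (filterI UG tangent) Us) UE).
set A := invmx g *m y g in LA *.
exists ((s g)^-1 *: A + 0).
  by apply: (proj2 (Lie_lin_closed G)) => //; apply: (proj1 (Lie_lin_closed G)).
have L0 := proj1 (Lie_lin_closed G).
have dFl := mx_diff1_lin G1 GU FdF.
have dF0 : dF 0 = 0.
  by have := dFl (-1) 0 0 L0 L0; rewrite scaler0 addr0 scaleN1r addNr.
rewrite dFl // dF0 addr0.
have : U g *m dF A *m W g = s g *: (U g *m v *m W g).
  by apply/matrixP => i j; rewrite (Eg (i, j)) ?mem_enum // [RHS]mxE.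
move/(congr1 (fun M => invmx (U g) *m M *m invmx (W g))).
rewrite -scalemxAr -scalemxAl !mulmxA !mulVmx ?UU // !mul1mx.
rewrite -!mulmxA !mulmxV ?WU // !mulmx1 => ->.
by rewrite scalerA mulVf ?scale1r //; apply/eqP.
Qed.
End DenseSubmersion.

(** * The Lie algebra of a linear algebraic group *)

Section LinAlgGroup.
Variables (K : fieldType) (n : nat) (G : set 'M[K]_n).
Hypothesis hG : lin_alg_group G.

Lemma lag1 : G 1%:M. Proof. by case: hG. Qed.
Lemma lagM g h : G g -> G h -> G (g *m h). Proof. by case: hG => _ _ + _; apply. Qed.
Lemma lagV g : G g -> G (invmx g). Proof. by case: hG => _ _ _; apply. Qed.
Lemma lagU g : G g -> g \in unitmx. Proof. by case: hG => -[Z _ ->] _ _ _ []. Qed.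
Lemma lagJ h g : G h -> G g -> G (h *m g *m invmx h).
Proof. by move=> Gh Gg; apply: lagM (lagM Gh Gg) (lagV Gh). Qed.
End LinAlgGroup.

Lemma diff1_linear (K : fieldType) n (S : set 'M[K]_n) a b (F : 'M[K]_n -> 'M[K]_(a, b))
    (l : 'M[K]_(a, b) -> K) D C :
  S 1%:M -> (forall g, S g -> g \in unitmx) -> scalar l ->
  mx_diff1 S F D C -> is_diff1 S (fun g => l (F g)) D (l C).
Proof.
move=> S1 SU ll HF.
have l0 : l 0 = 0.
  by have := ll (-1) 0 0; rewrite scaler0 addr0 mulN1r addNr.
have lS (I : Type) (s : seq I) (c : I -> K) u :
    l (\sum_(i <- s) c i *: u i) = \sum_(i <- s) c i * l (u i).
  by elim: s => [|i s IH]; rewrite ?big_nil // !big_cons ll IH.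
have lE B : l B = \sum_(ij : 'I_a * 'I_b) l (delta_mx ij.1 ij.2) * B ij.1 ij.2.
  rewrite {1}(matrix_sum_delta B) pair_big lS; apply: eq_bigr => -[i j] _ /=.
  by rewrite mulrC.
rewrite (lE C); apply: (@diff1_ext _ _ _ (fun g => \sum_(ij : 'I_a * 'I_b)
  l (delta_mx ij.1 ij.2) * F g ij.1 ij.2)) => [g _|]; first by rewrite -lE.
by apply: diff1_sum => // -[i j]; apply: diff1Z.
Qed.

Section LieGroup.
Variables (K : fieldType) (n : nat) (G : set 'M[K]_n).
Hypothesis hG : lin_alg_group G.
Let G1 := lag1 hG.
Let GU := lagU hG.

Lemma Lie_Ad h A : G h -> Lie G A -> Lie G (h *m A *m invmx h).
Proof.
move=> Gh LA p pG; have := LA (mxtrans h (invmx h) p).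
rewrite mxdir_deriv_trans mulmx1 mulmxV ?GU //; apply=> g Gg.
by rewrite mxeval_trans pG //; apply: lagJ.
Qed.

Lemma mx_diff1_Ad A C :
  mx_diff1 G (fun g => g *m A *m invmx g) C (lie_br C A).
Proof.
have := mx_diff1M G1 GU (mx_diff1M G1 GU (mx_diff1_id G C) (mx_diff1_cst G A C))
  (mx_diff1_inv GU C).
by rewrite mulmx0 add0r invmx1 mulmx1 mulmxN mul1mx addrC.
Qed.

(** For p vanishing on G, the function g |-> dp_1(g A g^-1) vanishes on G, and its derivative along
    C is dp_1([C, A]). *)
Lemma Lie_br C A : Lie G C -> Lie G A -> Lie G (lie_br C A).
Proof.
move=> LC LA p pG.
have ll : scalar (mxdir_deriv p 1%:M : 'M[K]_n -> K).
  by move=> c u v; rewrite mxdir_deriv_lin.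
have H := diff1_linear G1 GU ll (mx_diff1_Ad A C).
apply: (diff1_uniq G1 GU LC H).
apply: diff1_ext (diff1_cst G 0 C) => g Gg.
by rewrite (Lie_Ad Gg LA pG).
Qed.

Variables (m : nat) (rho drho : 'M[K]_n -> 'M[K]_m).
Hypotheses (hrho : rational_rep G rho) (hdrho : infinitesimal_rep G rho drho).

Lemma repU g : G g -> rho g \in unitmx. Proof. by case: hrho => + _ _; apply. Qed.
Lemma repM g h : G g -> G h -> rho (g *m h) = rho g *m rho h.
Proof. by case: hrho => _ + _; apply. Qed.
Lemma rep1 : rho 1%:M = 1%:M.
Proof.
have := repM G1 G1; rewrite mulmx1 => /(congr1 (mulmx (invmx (rho 1%:M)))).
by rewrite mulmxA mulVmx ?mul1mx ?repU.
Qed.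
Lemma repV g : G g -> rho (invmx g) = invmx (rho g).
Proof.
move=> Gg; have := repM Gg (lagV hG Gg); rewrite mulmxV ?GU // rep1.
move/(congr1 (mulmx (invmx (rho g)))).
by rewrite mulmxA mulVmx ?repU // mul1mx mulmx1.
Qed.

Lemma rep_diff1 A : Lie G A -> mx_diff1 G rho A (drho A).
Proof. exact: hdrho. Qed.

Lemma drho_lin : lin_on (Lie G) drho.
Proof. exact: (mx_diff1_lin G1 GU rep_diff1). Qed.

Lemma drho_Ad h A : G h -> Lie G A ->
  drho (h *m A *m invmx h) = rho h *m drho A *m invmx (rho h).
Proof.
move=> Gh LA; apply: (mx_diff1_uniq G1 GU LA (F := fun g => rho (h *m g *m invmx h))).
  move=> i j; apply: (diff1_conj (f := fun g => rho g i j)); first exact: GU.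
    by move=> g; apply: lagJ.
  by apply: rep_diff1; apply: Lie_Ad.
have := mx_diff1M G1 GU (mx_diff1M G1 GU (mx_diff1_cst G (rho h) A) (rep_diff1 LA))
  (mx_diff1_cst G (invmx (rho h)) A).
rewrite mulmx0 mul0mx add0r addr0; apply: mx_diff1_ext => g Gg.
by rewrite (repM (lagM hG Gh Gg) (lagV hG Gh)) repM // repV.
Qed.

Lemma rep_inv_diff1 A : Lie G A -> mx_diff1 G (fun g => invmx (rho g)) A (- drho A).
Proof.
move=> LA i j; rewrite mxE.
apply: (diff1_ext (f := fun g => rho (invmx g) i j)) => [g Gg|]; first by rewrite repV.
exact: (diff1_comp_inv G1 GU (f := fun g => rho g i j) (@lagV _ _ _ hG) (rep_diff1 LA i j)).
Qed.

(** This is the derivative along C of drho(g A g^-1) = rho(g) drho(A) rho(g)^-1. A fixed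
    representative replaces each entry of [drho] by a function l that is linear on all matrices and
    can be differentiated through. *)
Lemma drho_br C A : Lie G C -> Lie G A -> drho (lie_br C A) = lie_br (drho C) (drho A).
Proof.
move=> LC LA; apply/matrixP => i j.
have [p [k [_ E]]] := regular_diff1 (is_diff1_regular (rep_diff1 LA i j)).
pose l D := mxdir_deriv p 1%:M D - k%:R * \tr D * mxeval p 1%:M.
have lE D : Lie G D -> drho D i j = l D.
  by move=> LD; apply: (diff1_uniq G1 GU LD (rep_diff1 LD i j)).
have ll : scalar l.
  by move=> c u v; rewrite /l mxdir_deriv_lin linearP /=; ring.
rewrite lE; last exact: Lie_br.
apply: (diff1_uniq G1 GU LC (diff1_linear G1 GU ll (mx_diff1_Ad A C))).
have := mx_diff1M G1 GU (mx_diff1M G1 GU (rep_diff1 LC) (mx_diff1_cst G (drho A) C))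
  (rep_inv_diff1 LC) i j.
rewrite mulmx0 add0r rep1 invmx1 mulmx1 mulmxN mul1mx addrC.
apply: diff1_ext => g Gg.
by rewrite -drho_Ad // lE //; apply: Lie_Ad.
Qed.

Lemma det_rep_diff1 A k : Lie G A ->
  is_diff1 G (fun g => \det (rho g) ^+ k) A (k%:R * \tr (drho A)).
Proof.
move=> LA; have := mx_diff1_poly G1 GU (detp K m ^+ k) (rep_diff1 LA).
rewrite rep1 mxdir_derivX_exp mxdir_deriv_detp1 mxeval_detp det1 expr1n mulr1.
by apply: diff1_ext => g _; rewrite mxeval_exp mxeval_detp.
Qed.

Definition tangent_col (x : 'cV[K]_m) := forall v, exists2 A, Lie G A & drho A *m x = v.
Definition tangent_row (y : 'rV[K]_m) := forall v, exists2 A, Lie G A & y *m drho A = v.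

Lemma orbit_col_diff1 (x : 'cV[K]_m) A : Lie G A -> mx_diff1 G (fun g => rho g *m x) A (drho A *m x).
Proof.
move=> LA; have := mx_diff1M G1 GU (rep_diff1 LA) (mx_diff1_cst G x A).
by rewrite mulmx0 add0r.
Qed.

Lemma orbit_row_diff1 (y : 'rV[K]_m) A : Lie G A ->
  mx_diff1 G (fun g => y *m invmx (rho g)) A (- (y *m drho A)).
Proof.
move=> LA; have := mx_diff1M G1 GU (mx_diff1_cst G y A) (rep_inv_diff1 LA).
by rewrite mul0mx addr0 mulmxN.
Qed.

Hypothesis charK : [pchar K] =i pred0.

Lemma generic_tangent (x : 'cV[K]_m) : generic_point G rho x <-> tangent_col x.
Proof.
have FUW h g : G h -> G g -> rho (h *m g) *m x = rho h *m (rho g *m x) *m (1%:M : 'M_1).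
  by move=> Gh Gg; rewrite repM // mulmx1 mulmxA.
have W1 (g : 'M[K]_n) : G g -> (1%:M : 'M[K]_1) \in unitmx by move=> _; apply: unitmx1.
split=> H.
  exact: (dense_submersion charK G1 GU (lagM hG) (@lagV _ _ _ hG) (orbit_col_diff1 x) FUW repU W1 H).
exact: (submersion_dense charK G1 GU (lagM hG) (orbit_col_diff1 x) FUW repU W1 H).
Qed.

Lemma dense_row_tangent (y : 'rV[K]_m) :
  zariski_dense [set y *m invmx (rho g) | g in G] <-> tangent_row y.
Proof.
have FUW h g : G h -> G g -> y *m invmx (rho (h *m g)) =
    1%:M *m (y *m invmx (rho g)) *m invmx (rho h).
  move=> Gh Gg; rewrite mul1mx -mulmxA; congr (_ *m _).
  have hgU := repU (lagM hG Gh Gg).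
  apply: (can_inj (mulKmx hgU)); rewrite mulmxV // repM // -mulmxA.
  by rewrite (mulKVmx (repU Gg)) mulmxV // repU.
have U1 (g : 'M[K]_n) : G g -> (1%:M : 'M[K]_1) \in unitmx by move=> _; apply: unitmx1.
have UW g : G g -> invmx (rho g) \in unitmx by move=> Gg; rewrite unitmx_inv repU.
split=> H.
  move=> v; have [A LA E] := dense_submersion charK G1 GU (lagM hG) (@lagV _ _ _ hG)
    (orbit_row_diff1 y) FUW U1 UW H (- v).
  by exists A => //; apply: oppr_inj.
apply: (submersion_dense charK G1 GU (lagM hG) (orbit_row_diff1 y) FUW U1 UW) => v.
by have [A LA E] := H (- v); exists A => //; rewrite E opprK.
Qed.

End LieGroup.

(** * From regularity to sl2-triples *)

Section Central.
Variables (K : fieldType) (n m : nat) (G : set 'M[K]_n) (rho drho : 'M[K]_n -> 'M[K]_m).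
Hypotheses (charK : [pchar K] =i pred0) (hG : lin_alg_group G).
Hypotheses (hrho : rational_rep G rho) (hdrho : infinitesimal_rep G rho drho).
Hypothesis hsum : direct_sum (Lie G) (lie_center (Lie G)) (derived (Lie G)).
Hypothesis hdim : one_dimensional (lie_center (Lie G)).
Hypothesis hscal : drho @` lie_center (Lie G) = [set c%:M | c in [set: K]].

Lemma derived_zero (f : 'M[K]_n -> K) s : lin_on (Lie G) (f : _ -> K^o) ->
  (forall A C, Lie G A -> Lie G C -> f (lie_br A C) = 0) ->
  derived (Lie G) s -> Lie G s /\ f s = 0.
Proof.
move=> fl fb ds; have [L0 LD] := Lie_lin_closed G.
apply: (ds (fun A => Lie G A /\ f A = 0)).
  split=> [|c A C [LA fA] [LC fC]].
    by split=> //; have := fl (-1) 0 0 L0 L0; rewrite scaler0 addr0 scaleN1r addNr.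
  by split; [apply: LD | rewrite fl // fA fC scaler0 addr0].
move=> _ [A [C [LA LC ->]]]; split; last exact: fb.
exact: Lie_br.
Qed.

Lemma derived_Lie s : derived (Lie G) s -> Lie G s.
Proof.
move=> ds; have [|//|] := @derived_zero (fun=> 0) s _ _ ds => //.
by move=> c u v _ _; rewrite scaler0 addr0.
Qed.

Lemma central_unit : exists2 Z, lie_center (Lie G) Z & drho Z = 1%:M.
Proof.
have : (drho @` lie_center (Lie G)) 1%:M by rewrite hscal; exists 1.
by move=> [Z cZ dZ]; exists Z.
Qed.

Section Unit.
Variable Z : 'M[K]_n.
Hypotheses (cZ : lie_center (Lie G) Z) (dZ : drho Z = 1%:M) (m_gt0 : (0 < m)%N).

Lemma drho0 : drho 0 = 0.
Proof.
have L0 := proj1 (Lie_lin_closed G).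
by have := drho_lin hG hdrho (-1) L0 L0; rewrite scaler0 addr0 scaleN1r addNr.
Qed.

Lemma central_unit_neq0 : Z != 0.
Proof.
apply: contraTneq m_gt0 => Z0; move: dZ; rewrite Z0 drho0 => /matrixP E.
rewrite -leqNgt leqNgt; apply/negP => m0.
have := E (Ordinal m0) (Ordinal m0); rewrite !mxE eqxx => /eqP.
by rewrite eq_sym oner_eq0.
Qed.

Lemma central_decomp A : Lie G A -> exists z s, derived (Lie G) s /\ A = z *: Z + s.
Proof.
move=> LA; case: hsum => E _; move: LA; rewrite {1}E => -[C cC [s ds <-]].
case: hdim => Z' Z'0 cE; move: cC cZ; rewrite cE => -[x _ <-] [y _ yZ].
have y0 : y != 0 by apply: contra_neq central_unit_neq0 => y0; rewrite -yZ y0 scale0r.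
by exists (x / y), s; split=> //; rewrite -yZ scalerA divfK.
Qed.

Section Form.
Variable B : 'M[K]_n -> 'M[K]_n -> K.
Hypothesis hB : nondeg_invariant_form (Lie G) B.

Lemma form_lin_l C : Lie G C -> lin_on (Lie G) (fun A => B A C : K^o).
Proof. by case: hB => H _ _ _ _ LC c u v Lu Lv; apply: H. Qed.
Lemma form_lin_r A : Lie G A -> lin_on (Lie G) (fun C => B A C : K^o).
Proof. by case: hB => _ H _ _ _ LC c u v Lu Lv; apply: H. Qed.

Let LZ : Lie G Z. Proof. by case: cZ. Qed.
Let brZ C : Lie G C -> lie_br Z C = 0. Proof. by case: cZ => _; apply. Qed.

(** Invariance moves a bracket onto Z, where it vanishes. *)
Lemma form_center_derived s : derived (Lie G) s -> B s Z = 0 /\ B Z s = 0.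
Proof.
case: (hB) => _ _ inv _ _ ds; have L0 := proj1 (Lie_lin_closed G).
have B0l A : Lie G A -> B 0 A = 0.
  move=> LA; have := form_lin_l LA (-1) L0 L0.
  by rewrite scaler0 addr0 scaleN1r addNr.
have B0r A : Lie G A -> B A 0 = 0.
  move=> LA; have := form_lin_r LA (-1) L0 L0.
  by rewrite scaler0 addr0 scaleN1r addNr.
split.
  apply: (proj2 (derived_zero (form_lin_l LZ) _ ds)) => A C LA LC.
  rewrite inv //; have -> : lie_br C Z = 0.
    by have := brZ LC; rewrite /lie_br => /eqP; rewrite subr_eq0 => /eqP ->; rewrite subrr.
  exact: B0r.
apply: (proj2 (derived_zero (form_lin_r LZ) _ ds)) => A C LA LC.
by rewrite -inv // brZ // B0l.
Qed.

Lemma form_center_neq0 : B Z Z != 0.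
Proof.
case: (hB) => _ _ _ nl _; apply: contraTneq central_unit_neq0 => BZ; rewrite negbK.
apply/eqP; apply: nl => // C LC; have [z [s [ds ->]]] := central_decomp LC.
rewrite form_lin_r //; last exact: derived_Lie.
by rewrite BZ scaler0 add0r; case: (form_center_derived ds).
Qed.

(** Both sides are linear in A, vanish on [g, g] and agree at Z, which together exhaust g. *)
Lemma form_central_proportional (f : 'M[K]_n -> K) : lin_on (Lie G) (f : _ -> K^o) ->
  (forall s, derived (Lie G) s -> f s = 0) ->
  forall A, Lie G A -> B A Z * f Z = f A * B Z Z.
Proof.
move=> fl fs A LA; have [z [s [ds ->]]] := central_decomp LA.
have Ls := derived_Lie ds.
rewrite form_lin_l //= fl // (fs s) // (proj1 (form_center_derived ds)) !addr0.
by rewrite /GRing.scale /=; ring.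
Qed.
End Form.

Lemma grading_central : grading_element (Lie G) drho (2 *: Z).
Proof.
have L0 := proj1 (Lie_lin_closed G); have LZ : Lie G Z by case: cZ.
have d2 : drho (2 *: Z) = 2%:M.
  rewrite -[2 *: Z]addr0 (drho_lin hG hdrho) // dZ drho0 addr0.
  by rewrite scale_scalar_mx mulr1.
split.
- by rewrite -[2 *: Z]addr0; apply: (proj2 (Lie_lin_closed G)).
- move=> A LA; rewrite /lie_br -scalemxAl -scalemxAr -scalerBr.
  by case: cZ => _ /(_ A LA); rewrite /lie_br => ->; rewrite scaler0.
- by move=> X; rewrite /br01 d2 mul_scalar_mx.
- by move=> Y; rewrite /br0m1 d2 mul_mx_scalar scaleNr.
Qed.
End Unit.

Lemma sl2_pairing (B : 'M[K]_n -> 'M[K]_n -> K) Phi x y H A :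
  is_Phi_map (Lie G) drho B Phi -> Lie G A -> sl2_triple drho Phi y H x ->
  (y *m drho A *m x) 0 0 = B A H.
Proof.
move=> hPhi LA [_ _ <-]; have [_ ->] := hPhi x y; last by [].
by rewrite /pairing mulmxA.
Qed.

Lemma mx11_eq0 (w : 'M[K]_1) : w 0 0 = 0 -> w = 0.
Proof. by move=> H; apply/matrixP => i j; rewrite !ord1 H mxE. Qed.

(** The bracket equation prescribes y drho(A) x = B(A, H) for all A. It therefore fixes y on drho(g)
    x = V, and x against y drho(g) = V^*. *)
Lemma tangent_sl2_unique (B : 'M[K]_n -> 'M[K]_n -> K) Phi x y H :
  is_Phi_map (Lie G) drho B Phi -> sl2_triple drho Phi y H x ->
  tangent_col G drho x -> tangent_row G drho y ->
  P_HX drho Phi H x /\ P_YH drho Phi y H.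
Proof.
move=> hPhi hs tx ty; split.
  exists y; split=> // y' hs'; apply/eqP; rewrite -subr_eq0; apply/eqP.
  apply: (can_inj (@trmxK _ _ _)); rewrite trmx0; apply/matrixP => j k; rewrite ord1 !mxE.
  have [A LA dA] := tx (delta_mx j 0).
  have := sl2_pairing hPhi LA hs; rewrite -(sl2_pairing hPhi LA hs') -!mulmxA dA.
  by rewrite -!colE !mxE => ->; rewrite subrr.
exists x; split=> // x' hs'; apply/eqP; rewrite -subr_eq0; apply/eqP.
apply/matrixP => j k; rewrite ord1 !mxE.
have [A LA dA] := ty (delta_mx 0 j).
have := sl2_pairing hPhi LA hs; rewrite -(sl2_pairing hPhi LA hs') dA.
by rewrite -!rowE !mxE => ->; rewrite subrr.
Qed.

Lemma regular_pv_sl2 : regular_pv G rho drho ->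
  forall (B : 'M[K]_n -> 'M[K]_n -> K) (Phi : 'cV[K]_m -> 'rV[K]_m -> 'M[K]_n),
     nondeg_invariant_form (Lie G) B -> is_Phi_map (Lie G) drho B Phi ->
     exists (H0 : 'M[K]_n) (X : 'cV[K]_m) (Y : 'rV[K]_m),
       [/\ grading_element (Lie G) drho H0, sl2_triple drho Phi Y H0 X,
           P_HX drho Phi H0 X & P_YH drho Phi Y H0].
Proof.
move=> [x genx [chi [omega [_ _ _ [omegal omega0] [phi [_ phiG phiA phid]]]]]] B Phi hB hPhi.
have L0 := proj1 (Lie_lin_closed G).
(* If V = 0, [Phi] pairs to zero with all of g, hence is 0, and the zero triple works. *)
have [m0|m_gt0] := posnP m.
  have e1 (u v : 'cV[K]_m) : u = v by apply: mx_empty; left.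
  have e2 (u v : 'rV[K]_m) : u = v by apply: mx_empty; right.
  have P0 X Y : Phi X Y = 0.
    have [LP PhiB] := hPhi X Y; case: hB => _ _ _ _; apply=> // A LA.
    rewrite PhiB // /pairing (e2 Y 0) mul0mx mxE //.
  exists 0, 0, 0; split.
  - by split=> // A _; rewrite /lie_br mul0mx mulmx0 subrr.
  - by split.
  - by exists 0; split; first by split.
  - by exists 0; split; first by split.
have [Z cZ dZ] := central_unit; have LZ : Lie G Z by case: cZ.
have orbx : orbit_of G rho x x.
  by exists 1%:M; [exact: lag1 hG|rewrite (rep1 hG hrho) mul1mx].
have tx := proj1 (generic_tangent hG hrho hdrho charK x) genx.
pose y := phi x.
have ty : tangent_row G drho y.
  apply/(dense_row_tangent hG hrho hdrho charK).
  suff <- : phi @` orbit_of G rho x = [set y *m invmx (rho g) | g in G] by [].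
  apply/seteqP; split=> [_ [_ [g Gg <-] <-]|_ [g Gg <-]].
    by exists g => //; rewrite phiG.
  by exists (rho g *m x); [exists g | rewrite phiG].
have omd s : derived (Lie G) s -> omega s = 0.
  by move=> ds; apply: omega0 => h [_ _] hS; apply: hS; right.
have oml : lin_on (Lie G) (omega : _ -> K^o) by exact: omegal.
have pair A : Lie G A -> (y *m drho A *m x) 0 0 = omega A.
  by move=> LA; rewrite -(phiA A x) // /pairing mulmxA.
(* Otherwise omega = 0, so y kills drho(g) x = V; then y = 0, against y drho(g) = V^*. *)
have oZ : omega Z != 0.
  apply: contraTneq m_gt0 => oZ; rewrite -leqNgt leqNgt; apply/negP => m0.
  have y0 : y = 0.
    apply: (can_inj (@trmxK _ _ _)); rewrite trmx0; apply/matrixP => j k; rewrite ord1 !mxE.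
    have [A LA dA] := tx (delta_mx j 0).
    have := pair A LA; rewrite -mulmxA dA -colE mxE => ->.
    have [z [s [ds ->]]] := central_decomp cZ dZ m0 LA.
    by rewrite oml // ?oZ ?omd // ?scaler0 ?addr0 //; apply: derived_Lie.
  have [A _] := ty (delta_mx 0 (Ordinal m0)); rewrite y0 mul0mx.
  by move/matrixP/(_ 0 (Ordinal m0)); rewrite !mxE !eqxx => /eqP; rewrite eq_sym oner_eq0.
(* As B(A, Z) = omega(A) B(Z, Z) / omega(Z), this factor turns omega(A) into B(A, 2 Z), which makes
   [x, c y] = 2 Z. *)
pose c := 2 * B Z Z / omega Z.
have BZ := form_center_neq0 cZ dZ m_gt0 hB.
have c0 : c != 0 by rewrite !mulf_neq0 ?invr_neq0 // (proj1 (pcharf0P K) charK).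
have hg := grading_central cZ dZ.
have [LH _ gX gY] := hg.
have hs : sl2_triple drho Phi (c *: y) (2 *: Z) x.
  split=> //; case: (hB) => _ _ _ _ nr; have [LP PhiB] := hPhi x (c *: y).
  apply/eqP; rewrite -subr_eq0; apply/eqP.
  have LN : Lie G (Phi x (c *: y) - 2 *: Z).
    by rewrite -scaleN1r addrC; apply: (proj2 (Lie_lin_closed G)).
  apply: nr => // A LA; rewrite addrC -scaleN1r form_lin_r //.
  rewrite PhiB // /pairing -scalemxAl mulmxA [X in _ + X]mxE pair //.
  rewrite -[2 *: Z]addr0 form_lin_r //.
  have -> : B A 0 = 0.
    have := form_lin_r hB LA (-1) L0 L0.
    by rewrite scaler0 addr0 scaleN1r addNr.
  have := form_central_proportional cZ dZ m_gt0 hB oml omd LA => E.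
  have -> : c * omega A = 2 * (omega A * B Z Z) / omega Z by rewrite /c; field.
  by rewrite -E mulrA mulfK // addr0 /GRing.scale /=; ring.
have ty' : tangent_row G drho (c *: y).
  move=> v; have [A LA dA] := ty (c^-1 *: v); exists A => //.
  by rewrite -scalemxAl dA scalerA mulfV // scale1r.
have [P1 P2] := tangent_sl2_unique hPhi hs tx ty'.
by exists (2 *: Z), x, (c *: y).
Qed.

End Central.

(** * A relative invariant from a pair of dual points *)

Lemma diff1_sub (K : fieldType) n (S S' : set 'M[K]_n) f D c :
  S' `<=` S -> is_diff1 S f D c -> is_diff1 S' f D c.
Proof.
move=> SS [p [k [fp ->]]]; exists p, k; split=> // g /SS; exact: fp.
Qed.

Lemma row_ext (K : fieldType) m (u v : 'rV[K]_m) :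
  (forall w : 'cV[K]_m, u *m w = v *m w) -> u = v.
Proof.
move=> H; apply/matrixP => i j; have := H (delta_mx j 0).
by move/matrixP/(_ i 0); rewrite -!colE !mxE.
Qed.

Section RelativeInvariant.
Variables (K : fieldType) (n m : nat) (G : set 'M[K]_n) (rho drho : 'M[K]_n -> 'M[K]_m).
Hypotheses (charK : [pchar K] =i pred0) (hG : lin_alg_group G).
Hypotheses (hrho : rational_rep G rho) (hdrho : infinitesimal_rep G rho drho).
Variables (X : 'cV[K]_m) (Y : 'rV[K]_m).
Hypotheses (tX : tangent_col G drho X) (tY : tangent_row G drho Y).
(* The differential of the character (det rho)^2. *)
Definition omega2 (A : 'M[K]_n) := 2 * \tr (drho A).
Hypothesis XY : forall A, Lie G A -> (Y *m drho A *m X) 0 0 = omega2 A.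

Let dlin := drho_lin hG hdrho.
Let LL := Lie_lin_closed G.

Lemma omega2_lin : lin_on (Lie G) (omega2 : _ -> K^o).
Proof.
move=> c A B LA LB; rewrite /omega2 dlin // linearP /= /GRing.scale /=; ring.
Qed.

Lemma omega2_br A B : Lie G A -> Lie G B -> omega2 (lie_br A B) = 0.
Proof.
move=> LA LB; rewrite /omega2 (drho_br hG hrho hdrho) // /lie_br linearB /=.
by rewrite mxtrace_mulC subrr mulr0.
Qed.

Lemma LieV g A : G g -> Lie G A -> Lie G (invmx g *m A *m g).
Proof.
by move=> Gg LA; have := Lie_Ad hG (lagV hG Gg) LA; rewrite invmxK.
Qed.

Lemma drhoV g A : G g -> Lie G A ->
  drho (invmx g *m A *m g) = invmx (rho g) *m drho A *m rho g.
Proof.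
move=> Gg LA; have := drho_Ad hG hrho hdrho (lagV hG Gg) LA.
by rewrite invmxK (repV hG hrho) // invmxK.
Qed.

Lemma omega2_Ad g A : G g -> Lie G A -> omega2 (invmx g *m A *m g) = omega2 A.
Proof.
move=> Gg LA; rewrite /omega2 drhoV // mxtrace_mulC mulmxA mulmxV ?mul1mx //.
exact: (repU hrho).
Qed.

Lemma pairing_orbit g A : G g -> Lie G A ->
  (Y *m invmx (rho g) *m drho A *m (rho g *m X)) 0 0 = omega2 A.
Proof.
move=> Gg LA; rewrite -(omega2_Ad Gg LA) -XY; last exact: LieV.
by rewrite drhoV // !mulmxA.
Qed.

Lemma tangent_orbit g : G g -> tangent_col G drho (rho g *m X).
Proof.
move=> Gg v; have [A LA dA] := tX (invmx (rho g) *m v).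
exists (g *m A *m invmx g); first exact: Lie_Ad.
have U := repU hrho Gg.
by rewrite (drho_Ad hG hrho hdrho) // mulmxA mulmxKV // -mulmxA dA mulKVmx.
Qed.

(** Y rho(g)^-1 depends only on v = rho(g) X: its pairing with drho(A) v is omega2(A), and these
    vectors fill V. *)
Lemma dual_point : exists phi : 'cV[K]_m -> 'rV[K]_m,
  forall g, G g -> phi (rho g *m X) = Y *m invmx (rho g).
Proof.
suff /choice [phi H] : forall v, exists w, forall g, G g -> rho g *m X = v -> w = Y *m invmx (rho g).
  by exists phi => g Gg; apply: (H (rho g *m X)).
move=> v; have [[g Gg gv]|no] := pselect (exists2 g, G g & rho g *m X = v); last first.
  by exists 0 => g Gg gv; case: no; exists g.
exists (Y *m invmx (rho g)) => h Gh hv; apply: row_ext => w.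
have [A LA <-] := tangent_orbit Gg w; rewrite !mulmxA.
apply/eqP; rewrite -subr_eq0; apply/eqP; apply: mx11_eq0.
rewrite [LHS]mxE [X in _ + X]mxE -!(mulmxA _ (rho g) X).
rewrite (pairing_orbit Gg LA) gv -hv (pairing_orbit Gh LA) subrr //.
Qed.

Section Cramer.
Variable As : 'I_m -> 'M[K]_n.
Hypothesis LAs : forall i, Lie G (As i).
(** The columns are the vector fields of the [As i] at v. Where they form a frame, the dual point of
    v is the solution of the linear system with right-hand side [wrow], polynomial in v up to the
    determinant. *)
Definition Mx (v : 'cV[K]_m) : 'M[K]_m := \matrix_(k, i) (drho (As i) *m v) k 0.
Definition wrow : 'rV[K]_m := \row_i omega2 (As i).

Lemma polymx_Mx : polymx Mx.
Proof.
move=> k i; apply: (@polyfun_ext _ _ _ (fun v => (drho (As i) *m v) k 0)) => [v|].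
  by rewrite [RHS]mxE.
exact: (polymx_mul (polymx_cst _ _ _) (@polymx_id _ _ _)).
Qed.

Lemma dual_Mx g : G g -> Y *m invmx (rho g) *m Mx (rho g *m X) = wrow.
Proof.
move=> Gg; apply/matrixP => i j; rewrite !ord1 [RHS]mxE -(pairing_orbit Gg (LAs j)).
rewrite -[in RHS]mulmxA !mxE; apply: eq_bigr => k _; congr (_ * _).
by rewrite !mxE.
Qed.

Lemma dual_cramer g : G g ->
  \det (Mx (rho g *m X)) *: (Y *m invmx (rho g)) = wrow *m \adj (Mx (rho g *m X)).
Proof.
by move=> Gg; rewrite -(dual_Mx Gg) -[RHS]mulmxA mul_mx_adj mul_mx_scalar.
Qed.

(* By dual_cramer, row i is det (Mx v) times the derivative of phi : rho g X |-> Y (rho g)^-1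
   along the vector field v |-> drho (As i) v. *)
Definition Rx (v : 'cV[K]_m) : 'M[K]_m :=
  \matrix_(i, k) (- (wrow *m \adj (Mx v) *m drho (As i))) 0 k.

Lemma polymx_Rx : polymx Rx.
Proof.
move=> i k; apply: (@polyfun_ext _ _ _ (fun v => - (wrow *m \adj (Mx v) *m drho (As i)) 0 k)) => [v|].
  by rewrite [RHS]mxE [RHS]mxE.
apply: polyfunN.
apply: (polymx_mul (polymx_mul (polymx_cst _ _ _) (polymx_adj polymx_Mx)) (polymx_cst _ _ _)).
Qed.

End Cramer.

(** As omega2 kills brackets, 0 = Y [drho B, drho C] X = Y drho(B) drho(C) X, and the vectors
    drho(C) X fill V. This makes drho(A) X |-> - Y drho(A) well defined. *)
Lemma isotropy_kills_dual B : Lie G B -> drho B *m X = 0 -> Y *m drho B = 0.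
Proof.
move=> LB BX; apply: row_ext => w; rewrite mul0mx; have [C LC <-] := tX w.
have := omega2_br LB LC; rewrite -XY; last exact: Lie_br.
rewrite (drho_br hG hrho hdrho) // /lie_br mulmxBr mulmxBl -!mulmxA BX !mulmx0 subr0.
by move/mx11_eq0.
Qed.

(* J is the Jacobian at X of the rational map phi : V -> V^* sending rho g X to Y (rho g)^-1. *)
Lemma jacobian : exists2 J : 'M[K]_m, J \in unitmx &
  forall A, Lie G A -> (drho A *m X)^T *m J = - (Y *m drho A).
Proof.
have /choice [E EP] : forall i : 'I_m, exists A, Lie G A /\ drho A *m X = delta_mx i 0.
  by move=> i; have [A] := tX (delta_mx i 0); exists A.
pose J : 'M[K]_m := \matrix_i (- (Y *m drho (E i))).
have JP A : Lie G A -> (drho A *m X)^T *m J = - (Y *m drho A).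
  move=> LA; pose S := \sum_i (drho A *m X) i 0 *: E i.
  have LE i : Lie G (E i) by case: (EP i).
  have LS : Lie G S by apply: lin_closed_sum.
  have dS : drho S = \sum_i (drho A *m X) i 0 *: drho (E i).
    by rewrite (lin_on_sum _ _ LL dlin).
  have SX : drho S *m X = drho A *m X.
    rewrite dS mulmx_suml {2}(matrix_sum_delta (drho A *m X)).
    apply: eq_bigr => i _; rewrite big_ord1 -scalemxAl; case: (EP i) => _ -> //.
  have YD : Y *m drho A = Y *m drho S.
    apply/eqP; rewrite -subr_eq0 -mulmxBr.
    have -> : drho A - drho S = drho (-1 *: S + A) by rewrite dlin // scaleN1r addrC.
    rewrite isotropy_kills_dual //; first by apply: (proj2 LL).
    by rewrite dlin // mulmxDl scaleN1r mulNmx SX addNr.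
  rewrite YD dS mulmx_sumr mulmx_sum_row -sumrN; apply: eq_bigr => i _.
  by rewrite rowK mxE -scalemxAr scalerN.
(* Every row is of the form Y drho(A), hence lies in the row space of J. *)
exists J => //; rewrite -row_full_unit -cokermx_eq0.
apply/eqP/row_matrixP => i; rewrite row0 rowE; have [A LA <-] := tY (delta_mx 0 i).
by rewrite -[Y *m drho A]opprK -JP // mulNmx -mulmxA mulmx_coker mulmx0 oppr0.
Qed.

(* The Jacobian determinant of phi is multiplied by det (rho g)^-2 under v |-> rho g v, and equals
   det (Rx v) / det (Mx v) ^ (m + 1). *)
Lemma invariant_identity (As : 'I_m -> 'M[K]_n) : (forall i, Lie G (As i)) ->
  exists2 c, c != 0 & forall g, G g ->
    \det (Rx As (rho g *m X)) * \det (rho g) ^+ 2 = c * \det (Mx As (rho g *m X)) ^+ m.+1.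
Proof.
move=> LAs; have [J JU JP] := jacobian.
exists (\det J); first by rewrite -unitfE -unitmxE.
move=> g Gg; have U := repU hrho Gg; set v := rho g *m X; set M := Mx As v.
(* By equivariance this is the Jacobian of phi at v. *)
pose Jg := (invmx (rho g))^T *m J *m invmx (rho g).
have RE : Rx As v = \det M *: (M^T *m Jg).
  apply/row_matrixP => i.
  have -> : row i (Rx As v) = - (wrow As *m \adj M *m drho (As i)).
    by apply/matrixP => a b; rewrite !ord1 3![in LHS]mxE [RHS]mxE.
  rewrite linearZ /= row_mul -dual_cramer // -scalemxAl -scalerN; congr (_ *: _).
  have -> : row i M^T = (drho (As i) *m v)^T.
    by apply/matrixP => a b; rewrite !ord1 !mxE; apply: eq_bigr => l _.
  have := JP _ (LieV Gg (LAs i)); rewrite drhoV // !mulmxA => E.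
  apply: (can_inj (mulmxK U)); rewrite mulNmx -E /Jg.
  by rewrite mulmxKV // -trmx_mul !mulmxA.
rewrite RE detZ /Jg !det_mulmx !det_tr !det_inv [_ ^+ m.+1]exprS; move: (\det M ^+ m) => a.
have d0 : \det (rho g) != 0 by rewrite -unitfE -unitmxE.
by field.
Qed.

Lemma regular_pv_of_tangent : regular_pv G rho drho.
Proof.
have genX : generic_point G rho X by apply/(generic_tangent hG hrho hdrho charK).
have G1 := lag1 hG.
have LL0 := proj1 LL.
have van p : (forall g, G g -> mxeval p (rho g *m X) = 0) -> p = 0.
  by move=> H; apply: (dense_vanish charK genX) => _ [g Gg <-]; apply: H.
(* A frame adapted to the point v0; it may degenerate elsewhere on the orbit, which is why different
   points may use different frames. *)
have base v0 : tangent_col G drho v0 -> exists As : 'I_m -> 'M[K]_n,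
    (forall i, Lie G (As i)) /\ \det (Mx As v0) = 1.
  move=> t; have /choice [E EP] : forall i : 'I_m, exists A, Lie G A /\ drho A *m v0 = delta_mx i 0.
    by move=> i; have [A] := t (delta_mx i 0); exists A.
  exists E; split=> [i|]; first by case: (EP i).
  suff -> : Mx E v0 = 1%:M by rewrite det1.
  by apply/matrixP => k i; rewrite mxE; case: (EP i) => _ ->; rewrite !mxE andbT.
exists X => //; exists (fun g => \det (rho g) ^+ 2), omega2; split.
- split.
  + by move=> g Gg; rewrite expf_neq0 // -unitfE -unitmxE (repU hrho).
  + by move=> g h Gg Gh; rewrite (repM hrho) // det_mulmx exprMn.
  + exact: is_diff1_regular (det_rep_diff1 hG hrho hdrho 2 LL0).
- have [As [LAs dA]] := base X tX.
  have [c c0 cE] := invariant_identity LAs.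
  (* The invariant is p / q = det(Mx)^(m+1) / det(Rx), which on the orbit equals det(rho g)^2 up to
     a constant. *)
  have [p pE] := polyfunX m.+1 (polyfun_det (polymx_Mx As)).
  have [q qE] := polyfun_det (polymx_Rx As).
  have key g : G g -> mxeval q (rho g *m X) * \det (rho g) ^+ 2 = c * mxeval p (rho g *m X).
    by move=> Gg; rewrite pE qE cE.
  have X1 : mxeval p X = 1 by rewrite pE dA expr1n.
  have rX : rho 1%:M *m X = X by rewrite (rep1 hG hrho) mul1mx.
  exists p, q; split.
  + by apply: contra_neq (oner_neq0 K) => p0; rewrite -X1 p0 /mxeval meval0.
  + apply: contra_neq c0 => q0; have := key _ G1.
    by rewrite rX X1 mulr1 q0 /mxeval meval0 mul0r.
  + move=> g v Gg.
    (* For fixed g, the invariance with denominators cleared is polynomial in v, so it suffices to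
       check it on the dense orbit. *)
    pose P := mxtrans (rho g) 1%:M p * q - (\det (rho g) ^+ 2)%:MP * (p * mxtrans (rho g) 1%:M q).
    have P0 : P = 0.
      apply: van => h Gh; rewrite /P mxevalB !mxevalM !mxeval_trans mxevalC !mulmx1 mulmxA.
      rewrite -(repM hrho) //; apply: (mulfI c0); rewrite mulr0 mulrBr.
      have E1 := key _ (lagM hG Gg Gh); have E2 := key _ Gh.
      move: E1 E2; rewrite (repM hrho) // det_mulmx exprMn.
      move: (mxeval p _) (mxeval q _) (mxeval p _) (mxeval q _) => a b d e E1 E2.
      rewrite (_ : _ - _ = c * d * b - \det (rho g) ^+ 2 * (c * a) * e); last by ring.
      by rewrite -E1 -E2; ring.
    have := congr1 (fun p => mxeval p v) P0.
    rewrite /P mxevalB !mxevalM !mxeval_trans mxevalC !mulmx1 /mxeval meval0.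
    by move/eqP; rewrite subr_eq0 => /eqP.
- by move=> A LA; apply: det_rep_diff1.
- split; first exact: omega2_lin.
  move=> A g1A; suff [] : Lie G A /\ omega2 A = 0 by [].
  apply: (g1A (fun A => Lie G A /\ omega2 A = 0)).
    split.
      split=> [|c B C [LB B0] [LC C0]].
        by split=> //; have := omega2_lin (-1) LL0 LL0; rewrite scaler0 addr0 scaleN1r addNr.
      by split; [apply: (proj2 LL) | rewrite omega2_lin // B0 C0 scaler0 addr0].
    move=> B C [LB _] [LC _]; split; first exact: Lie_br.
    exact: omega2_br.
  move=> B [LB|dB].
    have LGB : Lie G B by move=> p pG; apply: LB => g [Gg _]; apply: pG.
    split=> //; rewrite -XY //.
    have sub : isotropy G rho X `<=` G by move=> g [].
    have i1 : isotropy G rho X 1%:M by split=> //; rewrite (rep1 hG hrho) mul1mx.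
    have -> : Y *m drho B *m X = 0; last by rewrite mxE.
    (* The orbit map is constant on the isotropy group of X, so its derivative along B is 0. *)
    rewrite -mulmxA; have -> : drho B *m X = 0; last by rewrite mulmx0.
    apply: (mx_diff1_uniq i1 (fun g ig => lagU hG (sub g ig)) LB
      (F := fun g => rho g *m X)).
      move=> i j; apply: (diff1_sub sub); exact: (orbit_col_diff1 hG hdrho X LGB i j).
    by apply: mx_diff1_ext (mx_diff1_cst _ X B) => g [_ ->].
  exact: (derived_zero hG omega2_lin omega2_br dB).
- have [phi phiE] := dual_point.
  exists phi; split.
  + move=> j; have [As [LAs dA]] := base X tX.
    have [q qE] := polyfun_det (polymx_Mx As).
    have [p pE] := polymx_mul (polymx_cst _ _ (wrow As)) (polymx_adj (polymx_Mx As)) 0 j.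
    exists p, q; split.
      by apply: contra_neq (oner_neq0 K) => q0; rewrite -dA -qE q0 /mxeval meval0.
    (* The denominator of the fraction built from the frame at X may vanish here. The frame Bs gives
       a fraction with denominator 1 at this point, equal to the first because both represent phi on
       the dense orbit. *)
    move=> _ [g Gg <-]; have [Bs [LBs dB]] := base _ (tangent_orbit Gg).
    have [q' qE'] := polyfun_det (polymx_Mx Bs).
    have [p' pE'] := polymx_mul (polymx_cst _ _ (wrow Bs)) (polymx_adj (polymx_Mx Bs)) 0 j.
    have cr Cs h (LCs : forall i, Lie G (Cs i)) : G h ->
        (wrow Cs *m \adj (Mx Cs (rho h *m X))) 0 j =
        \det (Mx Cs (rho h *m X)) * (Y *m invmx (rho h)) 0 j.
      by move=> Gh; rewrite -(dual_cramer LCs Gh) [LHS]mxE.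
    exists p', q'; split.
    * apply/eqP; rewrite -subr_eq0; apply/eqP; apply: van => h Gh.
      rewrite mxevalB !mxevalM pE qE pE' qE' !cr //; ring.
    * by rewrite qE' dB oner_neq0.
    * by rewrite qE' pE' cr // dB phiE // divr1 mul1r.
  + move=> g _ Gg [h Gh <-]; rewrite mulmxA -(repM hrho) // !phiE //; last exact: lagM.
    rewrite /contragredient; have U := repU hrho (lagM hG Gg Gh).
    apply: (can_inj (mulmxK U)); rewrite mulmxKV // (repM hrho) // !mulmxA.
    by rewrite mulmxKV ?mulmxKV ?(repU hrho).
  + move=> A _ LA [g Gg <-]; rewrite phiE // /pairing mulmxA.
    exact: pairing_orbit.
  + have : zariski_dense [set Y *m invmx (rho g) | g in G].
      by apply/(dense_row_tangent hG hrho hdrho charK).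
    suff -> : phi @` orbit_of G rho X = [set Y *m invmx (rho g) | g in G] by [].
    apply/seteqP; split=> [_ [_ [g Gg <-] <-]|_ [g Gg <-]].
      by exists g => //; rewrite phiE.
    by exists (rho g *m X); [exists g | rewrite phiE].
Qed.

End RelativeInvariant.

(** * Exponentials of nilpotent matrices *)

Section PolyMx.
Variables (K : fieldType) (n : nat).
Implicit Types (M N : 'M[{poly K}]_n) (A B C : 'M[K]_n).

Definition mxd M : 'M[{poly K}]_n := map_mx (@deriv K) M.
Definition mxh (t : K) M : 'M[K]_n := map_mx (horner_eval t) M.
Definition mxP A : 'M[{poly K}]_n := map_mx (@polyC K) A.

Lemma mxdD M N : mxd (M + N) = mxd M + mxd N.
Proof. by apply/matrixP => i j; rewrite !mxE derivD. Qed.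
Lemma mxdN M : mxd (- M) = - mxd M.
Proof. by apply/matrixP => i j; rewrite !mxE derivN. Qed.
Lemma mxdP A : mxd (mxP A) = 0.
Proof. by apply/matrixP => i j; rewrite !mxE derivC. Qed.
Lemma mxdM M N : mxd (M *m N) = mxd M *m N + M *m mxd N.
Proof.
apply/matrixP => i j; rewrite !mxE raddf_sum -big_split; apply: eq_bigr => k _ /=.
by rewrite derivM !mxE.
Qed.
Lemma mxdZ (p : {poly K}) A : mxd (p *: mxP A) = p^`() *: mxP A.
Proof. by apply/matrixP => i j; rewrite !mxE derivM derivC mulr0 addr0. Qed.

Lemma mxhM t M N : mxh t (M *m N) = mxh t M *m mxh t N.
Proof. exact: (map_mxM (horner_eval t)). Qed.
Lemma mxhD t M N : mxh t (M + N) = mxh t M + mxh t N.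
Proof. exact: (map_mxD (horner_eval t)). Qed.
Lemma mxhN t M : mxh t (- M) = - mxh t M.
Proof. exact: (map_mxN (horner_eval t)). Qed.
Lemma mxhP t A : mxh t (mxP A) = A.
Proof. by apply/matrixP => i j; rewrite !mxE /horner_eval hornerC. Qed.

Hypothesis charK : [pchar K] =i pred0.

(** Uniqueness for M' = C M with M(0) = 0: in characteristic 0 the coefficients vanish one after the
    other. *)
Lemma poly_mx_ode M C : mxd M = mxP C *m M -> mxh 0 M = 0 -> M = 0.
Proof.
move=> dM M0; suff H k i j : (M i j)`_k = 0.
  by apply/matrixP => i j; apply/polyP => k; rewrite H mxE coef0.
elim: k i j => [|k IH] i j.
  by have /matrixP/(_ i j) := M0; rewrite !mxE /horner_eval horner_coef0.
have /matrixP/(_ i j) := dM; rewrite !mxE => /(congr1 (fun p : {poly K} => p`_k)).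
rewrite coef_deriv coef_sum big1 => [/eqP|l _]; last by rewrite mxE coefCM IH mulr0.
by rewrite -mulr_natr mulf_eq0 (proj1 (pcharf0P K) charK) orbF => /eqP.
Qed.

(** This is exp(tA), with t the polynomial variable. Stopping at n loses nothing when A^n = 0. *)
Definition expt A : 'M[{poly K}]_n := \sum_(k < n) ((k`!%:R)^-1 *: 'X^k) *: mxP (A ^+ k).
Definition expm A : 'M[K]_n := \sum_(k < n) (k`!%:R)^-1 *: A ^+ k.

Lemma mx_expZ t A k : (t *: A) ^+ k = t ^+ k *: A ^+ k.
Proof.
elim: k => [|k IH]; first by rewrite !expr0 scale1r.
by rewrite !exprS IH -[LHS]/(_ *m _) -scalemxAl -scalemxAr scalerA.
Qed.

Lemma mxh_expt t A : mxh t (expt A) = expm (t *: A).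
Proof.
rewrite /mxh /expt raddf_sum; apply: eq_bigr => k _ /=.
apply/matrixP => i j; rewrite mx_expZ scalerA !mxE /horner_eval hornerM hornerC hornerZ hornerXn; ring.
Qed.

Lemma expm0 : expm 0 = 1%:M.
Proof.
rewrite /expm; case: (posnP n) => [n0|n0]; first by apply: mx_empty; left.
rewrite (bigD1 (Ordinal n0)) //= big1 => [|k k0].
  by rewrite expr0 fact0 invr1 scale1r addr0.
rewrite expr0n; case: eqP => [kE|_]; last by rewrite scaler0.
by move/eqP: k0; case; apply: val_inj.
Qed.

Lemma mxP_exp A k : mxP (A ^+ k) = mxP A ^+ k.
Proof.
elim: k => [|k IH]; first by rewrite !expr0; exact: map_mx1.
by rewrite !exprS -IH; exact: (map_mxM (@polyC K)).
Qed.

Lemma expt_comm A B : A *m B = B *m A -> mxP B *m expt A = expt A *m mxP B.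
Proof.
move=> AB; rewrite /expt mulmx_sumr mulmx_suml; apply: eq_bigr => k _.
rewrite -scalemxAr -scalemxAl; congr (_ *: _); rewrite mxP_exp.
elim: (val k) => [|l IH]; first by rewrite expr0 mulmx1 mul1mx.
rewrite exprS -[_ * _]/(_ *m _) -[in RHS]mulmxA -IH !mulmxA; congr (_ *m _).
by rewrite /mxP -!(map_mxM (@polyC K)) AB.
Qed.

(** Differentiating the sum yields A times the sum without its last term, and A times that last term
    is a multiple of A^n. *)
Lemma mxd_expt A : A ^+ n = 0 -> mxd (expt A) = mxP A *m expt A.
Proof.
move=> An; have [n0|n0] := posnP n; first by apply: mx_empty; left.
pose S (N : nat) := \sum_(k < N) ((k`!%:R)^-1 *: 'X^k) *: mxP (A ^+ k) : 'M[{poly K}]_n.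
have H1 (N : nat) : mxd (S N.+1) = mxP A *m S N.
  rewrite /S big_ord_recl mxdD mxdZ expr0 alg_polyC derivC scale0r add0r.
  rewrite mulmx_sumr /mxd raddf_sum; apply: eq_bigr => k _ /=.
  rewrite -/(mxd _) mxdZ /bump /= add1n derivZ derivXn -scalemxAr.
  have -> : mxP (A ^+ k.+1) = mxP A *m mxP (A ^+ k) by rewrite !mxP_exp exprS.
  congr (_ *: _); rewrite -scaler_nat scalerA factS natrM invfM mulrAC mulVf ?mul1r //.
  by rewrite (proj1 (pcharf0P K) charK).
have H2 (N : nat) : S N.+1 = S N + ((N`!%:R)^-1 *: 'X^N) *: mxP (A ^+ N) by rewrite /S big_ord_recr.
have n1 := prednK n0.
have := H1 n.-1; have := H2 n.-1; rewrite n1 => E1 E2.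
rewrite -[expt A]/(S n) E2 E1 mulmxDr -scalemxAr.
have -> : mxP A *m mxP (A ^+ n.-1) = mxP (A ^+ n) by rewrite !mxP_exp -[_ *m _]/(_ * _) -exprS n1.
by rewrite An /mxP map_mx0 scaler0 addr0.
Qed.


(** exp(tA) exp(tB) and exp(t(A + B)) solve the same equation M' = (A + B) M with M(0) = 1; the
    identity is their equality at t = 1. *)
Lemma expmD A B : A ^+ n = 0 -> B ^+ n = 0 -> (A + B) ^+ n = 0 -> A *m B = B *m A ->
  expm (A + B) = expm A *m expm B.
Proof.
move=> An Bn ABn AB; apply/eqP; rewrite eq_sym -subr_eq0; apply/eqP.
pose M := expt A *m expt B - expt (A + B).
suff M0 : M = 0.
  have := congr1 (mxh 1) M0; rewrite /M mxhD mxhN mxhM !mxh_expt !scale1r => ->.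
  by apply/matrixP => i j; rewrite !mxE /horner_eval horner0.
apply: (@poly_mx_ode M (A + B)).
  rewrite /M mxdD mxdN mxdM !mxd_expt //.
  have -> : expt A *m (mxP B *m expt B) = mxP B *m expt A *m expt B.
    by rewrite mulmxA expt_comm.
  have -> : mxP (A + B) = mxP A + mxP B by exact: map_mxD.
  by rewrite mulmxBr !mulmxDl !mulmxA.
by rewrite /M mxhD mxhN mxhM !mxh_expt !scale0r expm0 mulmx1 subrr.
Qed.

Definition logm A : 'M[K]_n :=
  \sum_(k < n.-1) ((-1) ^+ k / k.+1%:R) *: (A - 1%:M) ^+ k.+1.

(** The commuting factor A makes exp(A) - 1 nilpotent, and it makes A (exp(tA) - 1)^(n-1) a multiple
    of A^n. *)
Lemma expt_sub1 A : exists C : 'M[{poly K}]_n,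
  expt A - 1%:M = mxP A *m C /\ mxP A *m C = C *m mxP A.
Proof.
have [n0|n0] := posnP n; first by exists 0; split; apply: mx_empty; left.
have n1 := prednK n0.
exists (\sum_(k < n.-1) ((k.+1`!%:R)^-1 *: 'X^(k.+1)) *: mxP (A ^+ k)); split.
  have : forall N : nat, \sum_(k < N.+1) ((k`!%:R)^-1 *: 'X^k) *: mxP (A ^+ k) - 1%:M =
    mxP A *m \sum_(k < N) ((k.+1`!%:R)^-1 *: 'X^(k.+1)) *: mxP (A ^+ k) :> 'M[{poly K}]_n.
    move=> N; rewrite big_ord_recl expr0 fact0 invr1 scale1r scale1r expr0.
    have -> : mxP 1 = 1%:M by exact: map_mx1.
    rewrite addrC addKr mulmx_sumr; apply: eq_bigr => k _.
    rewrite lift0 -scalemxAr; congr (_ *: _).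
    by rewrite !mxP_exp exprS.
  by move=> /(_ n.-1); rewrite n1.
rewrite mulmx_sumr mulmx_suml; apply: eq_bigr => k _; rewrite -scalemxAr -scalemxAl.
by congr (_ *: _); rewrite mxP_exp -[_ *m _]/(_ * _) -exprS exprSr.
Qed.

Lemma mx_comm_exp0 (R : comNzRingType) (A C : 'M[R]_n) : A *m C = C *m A -> A ^+ n = 0 -> (A *m C) ^+ n = 0.
Proof.
move=> cAC An; rewrite -[_ *m _]/(_ * _) exprMn_comm; last exact: cAC.
by rewrite An mul0r.
Qed.

Lemma expm_sub1_nil A : A ^+ n = 0 -> (expm A - 1%:M) ^+ n = 0.
Proof.
move=> An; have [C [E cAC]] := expt_sub1 A.
have := congr1 (mxh 1) E; rewrite mxhD mxhN mxhM mxh_expt scale1r mxhP.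
have -> : mxh 1 1%:M = 1%:M by exact: map_mx1.
move=> ->; apply: mx_comm_exp0 => //.
by have := congr1 (mxh 1) cAC; rewrite !mxhM mxhP.
Qed.

(* The derivative of log (exp (t A)) with respect to t is A. *)
Lemma logm_expm A : A ^+ n = 0 -> logm (expm A) = A.
Proof.
move=> An; have [n0|n0] := posnP n; first by apply: mx_empty; left.
have n1 := prednK n0.
pose M := expt A; pose P := M - 1%:M.
have [C [PE cAC]] := expt_sub1 A.
pose L : 'M[{poly K}]_n := \sum_(k < n.-1) ((-1) ^+ k / k.+1%:R)%:P *: P ^+ k.+1.
have dP : mxd P = mxP A *m M.
  by rewrite /P mxdD mxdN mxd_expt // -[1%:M](map_mx1 (@polyC K)) -/(mxP _) mxdP subr0.
have MA : M *m mxP A = mxP A *m M by rewrite expt_comm.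
have PdP : P *m mxd P = mxd P *m P.
  rewrite dP /P mulmxBl mulmxBr mul1mx mulmx1; congr (_ - _).
  by rewrite mulmxA MA.
have dPk k : mxd (P ^+ k.+1) = (P ^+ k *m mxd P) *+ k.+1.
  elim: k => [|k IH]; first by rewrite expr1 expr0 mul1mx.
  have E1 : P ^+ k.+2 = P *m P ^+ k.+1 by rewrite exprS.
  have E2 : P *m (P ^+ k *m mxd P *+ k.+1) = (P ^+ k.+1 *m mxd P) *+ k.+1.
    by rewrite -scaler_nat -scalemxAr mulmxA exprS scaler_nat.
  rewrite E1 mxdM IH E2 [RHS]mulrS; congr (_ + _); elim: (k.+1) => [|l IHl].
    by rewrite expr0 mulmx1 mul1mx.
  by rewrite exprS -[_ * _]/(_ *m _) mulmxA -PdP -mulmxA IHl mulmxA.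
have Pn1 : mxP A *m P ^+ n.-1 = 0.
  have CA : GRing.comm (mxP A) C by [].
  rewrite /P PE -[_ *m C]/(_ * C) exprMn_comm // -[_ *m _]/(_ * _) mulrA -exprS n1.
  by rewrite -mxP_exp An /mxP map_mx0 mul0r.
(* With P = M - 1 and P' = A M, the derivative of the logarithm is a geometric series in -P times A
   (1 + P). It telescopes to A up to a term containing A P^(n-1) = 0. *)
have dL : mxd L = mxP A.
  rewrite /L /mxd raddf_sum /=.
  have -> : \sum_(k < n.-1) map_mx (@deriv K) (((-1) ^+ k / k.+1%:R)%:P *: P ^+ k.+1)
     = \sum_(k < n.-1) ((- P) ^+ k *m mxd P).
    apply: eq_bigr => k _.
    have -> : map_mx (@deriv K) (((-1) ^+ k / k.+1%:R)%:P *: P ^+ k.+1) =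
       ((-1) ^+ k / k.+1%:R)%:P *: mxd (P ^+ k.+1).
      by apply/matrixP => i j; rewrite !mxE derivM derivC mul0r add0r.
    rewrite dPk -scaler_nat scalerA -polyC1 -polyCMn -polyCM divfK; last first.
      by rewrite (proj1 (pcharf0P K) charK).
    rewrite scalemxAl; congr (_ *m _).
    elim: (val k) => [|l IH]; first by rewrite !expr0 polyC1 scale1r.
    rewrite !exprS polyCM polyCN polyC1 mulN1r scaleNr mulNr -IH; congr (- _).
    by rewrite -[RHS]/(_ *m _) -scalemxAr.
  rewrite -mulmx_suml dP.
  have -> : M = 1 - (- P) by rewrite opprK /P addrC subrK.
  have geo (y : 'M[{poly K}]_n) (N : nat) : (\sum_(k < N) y ^+ k) * (1 - y) = 1 - y ^+ N.
    elim: N => [|N IH]; first by rewrite big_ord0 mul0r expr0 subrr.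
    rewrite big_ord_recr mulrDl IH mulrBr mulr1 -exprSr; by rewrite addrA subrK.
  rewrite -[mxP A *m _]/(mxP A * _).
  have -> : mxP A * (1 - - P) = (1 - - P) * mxP A.
    by rewrite opprK {1 2}/P [1 + _]addrC subrK; exact: esym MA.
  rewrite -[LHS]/(_ * _) mulrA geo mulrBl mul1r exprNn -mulrA.
  have -> : P ^+ n.-1 * mxP A = mxP A * P ^+ n.-1.
    apply: esym; apply: commrX; rewrite /P PE; exact: commrM.
  by rewrite -[X in _ * X]/(mxP A *m _) Pn1 mulr0 subr0.
have LE : L - 'X *: mxP A = 0.
  apply: (@poly_mx_ode _ 0); first by rewrite mxdD mxdN mxdZ derivX scale1r dL subrr /mxP map_mx0 mul0mx.
  rewrite mxhD mxhN; have -> : mxh 0 ('X *: mxP A) = 0.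
    by apply/matrixP => i j; rewrite !mxE /horner_eval hornerM hornerX mul0r.
  rewrite subr0 /L /mxh raddf_sum big1 // => k _ /=.
  apply/matrixP => i j; rewrite !mxE /horner_eval hornerM hornerC.
  have -> : (P ^+ k.+1) i j = (P *m P ^+ k) i j by rewrite exprS.
  have -> : ((P *m P ^+ k) i j).[0] = (mxh 0 (P *m P ^+ k)) i j by rewrite [RHS]mxE.
  rewrite mxhM /P mxhD mxhN mxh_expt scale0r expm0.
  have -> : mxh 0 1%:M = 1%:M by exact: map_mx1.
  by rewrite subrr mul0mx mxE mulr0.
have := congr1 (mxh 1) LE; rewrite mxhD mxhN.
have -> : mxh 1 ('X *: mxP A) = A.
  by apply/matrixP => i j; rewrite !mxE /horner_eval hornerM hornerX hornerC mul1r.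
have hX k : mxh 1 (P ^+ k) = (expm A - 1%:M) ^+ k.
  elim: k => [|k IH]; first by rewrite !expr0; exact: map_mx1.
  rewrite !exprS -IH -[P * _]/(P *m _) mxhM /P mxhD mxhN mxh_expt scale1r.
  by congr ((_ - _) *m _); exact: map_mx1.
have -> : mxh 1 L = logm (expm A).
  rewrite /L /mxh raddf_sum; apply: eq_bigr => k _ /=; rewrite -hX.
  by apply/matrixP => i j; rewrite !mxE /horner_eval hornerM hornerC.
have -> : mxh 1 0 = 0 by exact: map_mx0.
by move/eqP; rewrite subr_eq0 => /eqP.
Qed.

End PolyMx.

(** * Unipotent subgroups obtained from nilpotent elements of the Lie algebra *)

Section OneParameter.
Variables (K : fieldType) (n : nat).
Hypothesis charK : [pchar K] =i pred0.

Definition along (A : 'M[K]_n) (p : {mpoly K[n * n]}) : {poly K} :=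
  mmap (@polyC K) (mxvec (expt A) 0) p.

Lemma horner_along (A : 'M[K]_n) p t : (along A p).[t] = mxeval p (expm (t *: A)).
Proof.
rewrite /along; elim/mpoly_gen_ind: p => [c|k|p q IHp IHq|p q IHp IHq].
- by rewrite mmapC hornerC mxevalC.
- rewrite mmapX mmap1U; case/mxvec_indexP: k => i j; rewrite mxvecE.
  by rewrite -/(mxX K i j) mxeval_mxX -mxh_expt [RHS]mxE.
- by rewrite rmorphD hornerD IHp IHq mxevalD.
- by rewrite rmorphM hornerM IHp IHq mxevalM.
Qed.

(** The left-invariant vector field of A, applied to p. *)
Definition inv_deriv (A : 'M[K]_n) (p : {mpoly K[n * n]}) : {mpoly K[n * n]} :=
  \sum_k p^`M(k) * mxvec (Xmx K n n *m mxC n n A) 0 k.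

Lemma mxeval_inv_deriv (A : 'M[K]_n) p g : mxeval (inv_deriv A p) g = mxdir_deriv p g (g *m A).
Proof.
rewrite /inv_deriv mxeval_sum; apply: eq_bigr => k _; rewrite mxevalM; congr (_ * _).
case/mxvec_indexP: k => i j; rewrite !mxvecE.
have -> : Xmx K n n *m mxC n n A = mxC n n 1%:M *m Xmx K n n *m mxC n n A.
  by rewrite [mxC n n 1%:M]map_mx1 mul1mx.
have := congr1 (fun M : 'M[K]_n => M i j) (mxev_trans 1%:M A g).
by rewrite mul1mx /= => <-; rewrite [RHS]mxE.
Qed.

Lemma deriv_along (A : 'M[K]_n) p : A ^+ n = 0 -> (along A p)^`() = along A (inv_deriv A p).
Proof.
move=> An; rewrite {1}/along.
rewrite (@mmap_chain_rule _ K {poly K} {poly K} (@polyC K) idfun (@deriv K)) /=; first last.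
- by move=> x; rewrite derivC.
- by move=> x y; rewrite derivM; ring.
- by move=> x y; rewrite derivD.
rewrite /along /inv_deriv rmorph_sum; apply: eq_bigr => k _; rewrite rmorphM; congr (_ * _).
case/mxvec_indexP: k => i j; rewrite !mxvecE.
have /matrixP/(_ i j) := mxd_expt charK An; rewrite expt_comm // [LHS]mxE => ->.
rewrite !mxE rmorph_sum; apply: eq_bigr => k _.
by rewrite rmorphM !mxE /mxX /= mmapX mmap1U mxvecE mmapC.
Qed.

(* The left-invariant derivative inv_deriv A preserves the ideal of G, so t |-> p (exp (t A))
   has all its derivatives equal to 0 at t = 0. *)
Lemma expm_vanish (G : set 'M[K]_n) A p t : lin_alg_group G ->
  Lie G A -> A ^+ n = 0 -> (forall g, G g -> mxeval p g = 0) -> mxeval p (expm (t *: A)) = 0.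
Proof.
move=> hG LA An pG; rewrite -horner_along.
suff -> : along A p = 0 by rewrite horner0.
apply/polyP => j; rewrite coef0; elim: j p pG => [|j IH] p pG.
  by rewrite -horner_coef0 horner_along scale0r expm0 // pG //; apply: lag1 hG.
have : (along A (inv_deriv A p))`_j = 0.
  apply: IH => g Gg; rewrite mxeval_inv_deriv.
  have := LA (mxtrans g 1%:M p); rewrite mxdir_deriv_trans !mulmx1; apply=> h Gh.
  by rewrite mxeval_trans mulmx1 pG //; apply: (lagM hG).
rewrite -deriv_along // coef_deriv => /eqP.
by rewrite -mulr_natr mulf_eq0 (proj1 (pcharf0P K) charK) orbF => /eqP.
Qed.

Lemma expm_unit (A : 'M[K]_n) : A ^+ n = 0 -> expm A \in unitmx.
Proof.
move=> An; have AN : (- A) ^+ n = 0 by rewrite exprNn An mulr0.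
case: (posnP n) => [n0|n0].
  by rewrite (_ : expm A = 1%:M) ?unitmx1 //; apply: mx_empty; left.
have := expmD charK An AN; rewrite subrr expm0 // expr0n.
rewrite (_ : (n == 0)%N = false) ?lt0n_neq0 //; last by case: (n) n0.
move=> /(_ erefl); rewrite mulmxN mulNmx => /(_ erefl) E.
by case: (mulmx1_unit (esym E)).
Qed.

Lemma expm_in (G : set 'M[K]_n) A : lin_alg_group G -> Lie G A -> A ^+ n = 0 -> G (expm A).
Proof.
move=> hG LA An; case: (hG) => -[Z [F ZF] GE] _ _ _; rewrite GE; split; first exact: expm_unit.
rewrite ZF => p Fp; rewrite -[A]scale1r; apply: (expm_vanish _ hG LA An) => g.
by rewrite GE ZF => -[_]; apply.
Qed.

Lemma zariski_closedI a b (Z1 Z2 : set 'M[K]_(a, b)) :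
  zariski_closed Z1 -> zariski_closed Z2 -> zariski_closed (Z1 `&` Z2).
Proof.
move=> [F1 ->] [F2 ->]; exists (F1 `|` F2); apply/seteqP; split=> A.
  by move=> [H1 H2] p [/H1|/H2].
by move=> H; split=> p Fp; apply: H; [left|right].
Qed.

Lemma zariski_closed_polymx a b c d (F : 'M[K]_(a, b) -> 'M[K]_(c, d)) :
  polymx F -> zariski_closed [set A | F A = 0].
Proof.
move=> PF; exists [set p | exists i j, forall v, mxeval p v = F v i j].
apply/seteqP; split=> A /=; first by move=> FA p [i [j ->]]; rewrite FA mxE.
by move=> H; apply/matrixP => i j; have [p pE] := PF i j; rewrite mxE -pE H //; exists i, j.
Qed.

Lemma polymx_exp (F : 'M[K]_n -> 'M[K]_n) k : polymx F -> polymx (fun A => F A ^+ k).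
Proof.
move=> PF; elim: k => [|k IH].
  by apply: polymx_ext (polymx_cst _ _ 1%:M) => A; rewrite expr0.
by apply: polymx_ext (polymx_mul PF IH) => A; rewrite exprS.
Qed.

Lemma polymx_sum a b c d (N : nat) (F : 'I_N -> 'M[K]_(a, b) -> 'M[K]_(c, d)) :
  (forall i, polymx (F i)) -> polymx (fun A => \sum_i F i A).
Proof.
move=> PF k l; apply: (@polyfun_ext _ _ _ (fun A => \sum_i F i A k l)) => [A|].
  by rewrite summxE.
by apply: polyfun_sum => i _; apply: PF.
Qed.

Lemma polymx_expm (F : 'M[K]_n -> 'M[K]_n) : polymx F -> polymx (fun A => expm (F A)).
Proof. by move=> PF; apply: polymx_sum => k; apply: polymxZ; apply: polymx_exp. Qed.

Lemma polymx_logm : polymx (@logm K n).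
Proof.
apply: polymx_sum => k; apply: polymxZ; apply: polymx_exp.
by apply: polymxD; [apply: polymx_id | apply: polymx_cst].
Qed.

Lemma expmJ (g A : 'M[K]_n) : g \in unitmx ->
  g *m expm A *m invmx g = expm (g *m A *m invmx g).
Proof.
move=> gU; rewrite /expm mulmx_sumr mulmx_suml; apply: eq_bigr => k _.
rewrite -scalemxAr -scalemxAl; congr (_ *: _).
elim: (val k) => [|l IH]; first by rewrite !expr0 mulmx1 mulmxV.
have mE (P Q : 'M[K]_n) : P * Q = P *m Q by [].
by rewrite !exprS -IH !mE !mulmxA mulmxKV.
Qed.

Lemma lin_closed_polymx (a : 'M[K]_n -> Prop) : lin_closed a ->
  exists C : 'M[K]_(n * n), forall A, a A <-> mxvec A *m C = 0.
Proof.
move=> [a0 aD]; have [U UE] : exists U : 'M[K]_(n * n), forall w, a (vec_mx w) <-> (w <= U)%MS.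
  apply: subspace_mx; split=> [|c u v]; rewrite ?linear0 // linearP /=; exact: aD.
exists (cokermx U) => A; rewrite -{1}[A]mxvecK UE submxE.
by split=> [/eqP|/eqP].
Qed.

(* exp a is a connected normal unipotent subgroup of G, hence trivial. *)
Lemma reductive_no_abelian_nil (G : set 'M[K]_n) (a : 'M[K]_n -> Prop) :
  lin_alg_group G -> reductive_group G -> lin_closed a ->
  (forall A, a A -> Lie G A) -> (forall g A, G g -> a A -> a (g *m A *m invmx g)) ->
  (forall A B, a A -> a B -> A *m B = B *m A) -> (forall A, a A -> A ^+ n = 0) ->
  forall A, a A -> A = 0.
Proof.
move=> hG hred la aL aG acomm anil.
pose U : set 'M[K]_n := [set u | exists2 A, a A & u = expm A].
have a0 : a 0 by case: la.
have aZ c A : a A -> a (c *: A) by move=> aA; rewrite -[_ *: A]addr0; apply: (proj2 la).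
have aD A B : a A -> a B -> a (A + B) by move=> aA aB; rewrite -[A]scale1r; apply: (proj2 la).
have UD A B : a A -> a B -> expm (A + B) = expm A *m expm B.
  by move=> aA aB; apply: expmD => //; [apply: anil|apply: anil|apply: anil; apply: aD|apply: acomm].
have U1 : U 1%:M by exists 0 => //; rewrite expm0.
have UV A : a A -> invmx (expm A) = expm (- A).
  move=> aA; have aN : a (- A) by rewrite -scaleN1r; apply: aZ.
  have E := UD _ _ aA aN; rewrite subrr expm0 // in E.
  apply: (can_inj (mulKmx (expm_unit (anil _ aA)))).
  by rewrite mulmxV ?expm_unit // anil.
have hU : lin_alg_group U.
  split.
  - have [C CE] := lin_closed_polymx la.
    (* U is cut out by log u in a and u = exp(log u), and both conditions are polynomial in u. *)
    exists ([set u | mxvec (logm u) *m C = 0] `&` [set u | u - expm (logm u) = 0]).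
      apply: zariski_closedI; apply: zariski_closed_polymx.
        apply: polymx_mul; last exact: polymx_cst.
        move=> i; case/mxvec_indexP => k l.
        by apply: polyfun_ext (polymx_logm k l) => u; rewrite ord1 mxvecE.
      apply: polymxD; first exact: polymx_id.
      apply: (@polymx_ext _ _ _ _ _ (fun u => -1 *: expm (logm u))) => [u|].
        by rewrite scaleN1r.
      by apply: polymxZ; apply: polymx_expm; apply: polymx_logm.
    apply/seteqP; split=> [_ [A aA ->]|u [_ [/CE au /eqP ue]]].
      split; first by apply: expm_unit; apply: anil.
      by rewrite /= logm_expm ?anil // subrr; split=> //; apply/CE.
    by exists (logm u) => //; apply/eqP; rewrite -subr_eq0.
  - exact: U1.
  - move=> _ _ [A aA ->] [B aB ->]; exists (A + B); first exact: aD.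
    by rewrite UD.
  - move=> _ [A aA ->]; exists (- A); first by rewrite -scaleN1r; apply: aZ.
    exact: UV.
have UE : U = [set 1%:M].
  apply: hred => //.
  - by move=> _ [A aA ->]; apply: expm_in => //; [apply: aL|apply: anil].
  - move=> g _ Gg [A aA ->]; exists (g *m A *m invmx g); first exact: aG.
    by rewrite expmJ // (lagU hG).
  (* The curve exp(tA) joins 1 to any point of U. If that point were outside Z1, some p1 and p2
     would have product zero along the curve, with p1 non-zero at t = 1 and p2 non-zero at t = 0. *)
  - have conn Z1 Z2 : zariski_closed Z1 -> zariski_closed Z2 -> U `<=` Z1 `|` Z2 ->
        Z1 1%:M -> ~ Z2 1%:M -> U `<=` Z1.
      move=> [F1 E1] [F2 E2] UZ Z11 Z21 _ [A aA ->]; rewrite E1 => p1 Fp1 /=.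
      apply: contrapT => p1A; apply: Z21; rewrite E2 => p2 Fp2 /=; apply: contrapT => p2A.
      have : along A p1 * along A p2 = 0.
        apply: poly_vanish => // t; rewrite hornerM !horner_along; apply/eqP.
        have : U (expm (t *: A)) by exists (t *: A) => //; apply: aZ.
        rewrite mulf_eq0; case/UZ; rewrite ?E1 ?E2 /=.
          by move/(_ _ Fp1) => ->; rewrite eqxx.
        by move/(_ _ Fp2) => ->; rewrite eqxx orbT.
      move/eqP; rewrite mulf_eq0 => /orP[] /eqP H.
        by apply: p1A; rewrite -[A]scale1r -horner_along H horner0.
      by apply: p2A; rewrite -(expm0 K n) -(scale0r A) -horner_along H horner0.
    move=> Z1 Z2 c1 c2 UZ dis; case: (UZ _ U1) => H.
      left; apply: (conn Z1 Z2) => // H2.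
      by have : (U `&` Z1 `&` Z2) 1%:M by []; rewrite dis.
    right; apply: (conn Z2 Z1) => //; first by rewrite setUC.
    by move=> H2; have : (U `&` Z1 `&` Z2) 1%:M by []; rewrite dis.
  - by move=> _ [A aA ->]; exists n; apply: expm_sub1_nil => //; apply: anil.
move=> A aA; have : U (expm A) by exists A.
rewrite UE => /= E; rewrite -(logm_expm charK (anil _ aA)) E.
by rewrite -(expm0 K n) logm_expm //; apply: anil.
Qed.

End OneParameter.

(** * Engel's theorem *)

Section Engel.
Variables (K : fieldType) (n : nat).
Implicit Types (A B Z : 'M[K]_n) (k h : 'M[K]_n -> Prop).

Definition adi (ws : seq 'M[K]_n) Z := foldr (@lie_br K n) Z ws.

Lemma lie_br_linr A c B Z : lie_br A (c *: B + Z) = c *: lie_br A B + lie_br A Z.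
Proof.
rewrite /lie_br mulmxDr mulmxDl -scalemxAr -scalemxAl scalerBr.
by rewrite opprD addrACA.
Qed.

Lemma lie_br_linl A c B Z : lie_br (c *: B + Z) A = c *: lie_br B A + lie_br Z A.
Proof.
rewrite /lie_br mulmxDr mulmxDl -scalemxAr -scalemxAl scalerBr.
by rewrite opprD addrACA.
Qed.

Lemma lie_br0 A : lie_br A 0 = 0.
Proof. by rewrite /lie_br mulmx0 mul0mx subrr. Qed.

Lemma lie_brC A B : lie_br A B = - lie_br B A.
Proof. by rewrite /lie_br opprB. Qed.

Lemma lie_jacobi A B Z : lie_br A (lie_br B Z) = lie_br (lie_br A B) Z + lie_br B (lie_br A Z).
Proof.
rewrite /lie_br !mulmxBr !mulmxBl !mulmxA !opprB.
move: (A *m B *m Z) (A *m Z *m B) (B *m Z *m A) (Z *m B *m A) (B *m A *m Z) (Z *m A *m B).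
move=> a b c d e f; apply/matrixP => i j; rewrite !mxE; ring.
Qed.

Lemma adi_lin ws c B Z : adi ws (c *: B + Z) = c *: adi ws B + adi ws Z.
Proof. by elim: ws => //= A ws ->; rewrite lie_br_linr. Qed.

Lemma adi0 ws : adi ws 0 = 0.
Proof. by elim: ws => //= A ws ->; rewrite lie_br0. Qed.

Definition all_in h (ws : seq 'M[K]_n) := forall A, A \in ws -> h A.

Lemma all_in_cons h A ws : all_in h (A :: ws) <-> h A /\ all_in h ws.
Proof.
split=> [H|[hA H] B]; last by rewrite inE => /orP[/eqP ->|/H].
by split=> [|B Bws]; apply: H; rewrite inE ?eqxx // Bws orbT.
Qed.

(** Nilpotency of ad h on all matrices, not only on h, with a uniform length N; in this form it
    passes to an extension of h by one element. *)
Definition adnil h (N : nat) :=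
  forall ws, size ws = N -> all_in h ws -> forall Z, adi ws Z = 0.

Lemma adnil_le h N M : (N <= M)%N -> adnil h N -> adnil h M.
Proof.
move=> NM hN ws sws aws Z; rewrite -(cat_take_drop (M - N) ws) /adi foldr_cat.
rewrite -/(adi _ _) -/(adi _ Z) (hN (drop (M - N) ws)) ?adi0 //.
  by rewrite size_drop sws subKn.
by move=> A /mem_drop; apply: aws.
Qed.

(* Take ws of maximal length such that P fails at adi ws Z. *)
Lemma adnil_last h N (P : 'M[K]_n -> Prop) Z : adnil h N -> P 0 -> ~ P Z ->
  exists2 ws, all_in h ws & ~ P (adi ws Z) /\ forall A, h A -> P (lie_br A (adi ws Z)).
Proof.
move=> hN P0 PZ; pose Q ws := all_in h ws /\ ~ P (adi ws Z).
have [|ws [aws Pws] wsmin] := @ex_minimal _ Q (fun ws => N - size ws)%N.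
  by exists [::]; split.
exists ws => //; split=> // A hA; apply: contrapT => PA.
have sN : (size ws < N)%N.
  rewrite ltnNge; apply/negP => Nws; apply: Pws.
  by rewrite (adnil_le Nws hN).
have /wsmin : Q (A :: ws) by split=> //; apply/all_in_cons.
by rewrite /= leqNgt ltn_sub2l.
Qed.

Lemma lin_span_closed (S : set 'M[K]_n) : lin_closed (lin_span S).
Proof.
split=> [h [h0 _] _ //|c A B HA HB h lh Sh].
by apply: (proj2 lh); [apply: HA|apply: HB].
Qed.

(** (ad z)^j Z is a combination of terms z^p Y z^q with p + q = j; for j = 2n one of the exponents
    is at least n. *)
Lemma nilpotent_ad z Z : z ^+ n = 0 -> adi (nseq (n + n) z) Z = 0.
Proof.
move=> zn; pose V j : set 'M[K]_n := lin_span
  [set C | exists p q Y, (p + q)%N = j /\ C = z ^+ p *m Y *m z ^+ q].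
have H j : V j (adi (nseq j z) Z).
  elim: j => [|j IH]; first by move=> h _; apply; exists 0%N, 0%N, Z; rewrite !expr0 mulmx1 mul1mx.
  rewrite /=; apply: (IH (fun Y => V j.+1 (lie_br z Y))); first split.
  - by rewrite lie_br0; case: (lin_span_closed [set C | exists p q Y, (p + q)%N = j.+1 /\ C = z ^+ p *m Y *m z ^+ q]).
  - by move=> c A B HA HB; rewrite lie_br_linr; apply: (proj2 (lin_span_closed _)).
  move=> _ [p [q [Y' [pq ->]]]]; rewrite /lie_br addrC -scaleN1r.
  apply: (proj2 (lin_span_closed _)) => h _; apply.
    by exists p, q.+1, Y'; rewrite addnS pq exprSr -[z ^+ q * z]/(_ *m _) mulmxA.
  by exists p.+1, q, Y'; rewrite addSn pq exprS -[z * z ^+ p]/(_ *m _) !mulmxA.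
apply: (H (n + n)%N (fun C => C = 0)).
  by split=> // c A B -> ->; rewrite scaler0 addr0.
move=> _ [p [q [Y [pq ->]]]].
have [pn|np] := leqP n p.
  by rewrite -(subnK pn) exprD zn mulr0 !mul0mx.
have qn : (n <= q)%N by rewrite -(leq_add2l n) -pq leq_add2r ltnW.
by rewrite -(subnK qn) exprD zn mulr0 mulmx0.
Qed.

Section Extend.
Variables (h : 'M[K]_n -> Prop) (z : 'M[K]_n) (N : nat).
Hypotheses (lh : lin_closed h) (hz : forall A, h A -> h (lie_br A z)).
Hypotheses (hN : adnil h N) (zn : z ^+ n = 0).

(* ad h shifts this filtration by one and ad z preserves it, so a word of length 2n in h and z,
   being c (ad z)^2n modulo the next step, also shifts it. *)
Fixpoint filt i : set 'M[K]_n :=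
  if i is i'.+1 then lin_span [set C | exists A B, [/\ h A, filt i' B & C = lie_br A B]]
  else setT.

Let fclosed i : lin_closed (filt i).
Proof. by case: i => [|i]; [split | apply: lin_span_closed]. Qed.

Let filtS i Z : filt i.+1 Z -> filt i Z.
Proof.
elim: i Z => [//|i IH] Z fZ; apply: (fZ (filt i.+1)); first exact: fclosed.
move=> _ [A [B [hA /IH fB ->]]] g _; apply; by exists A, B.
Qed.

Let filt_br i A Z : h A -> filt i Z -> filt i.+1 (lie_br A Z).
Proof. by move=> hA fZ g _; apply; exists A, Z. Qed.

Let filtz i Z : filt i Z -> filt i (lie_br z Z).
Proof.
elim: i Z => [//|i IH] Z fZ.
apply: (fZ (fun Z => filt i.+1 (lie_br z Z))); first split.
- by rewrite lie_br0; case: (fclosed i.+1).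
- by move=> c A B HA HB; rewrite lie_br_linr; apply: (proj2 (fclosed i.+1)).
move=> _ [A [B [hA fB ->]]]; rewrite lie_jacobi -[lie_br (lie_br z A) B]scale1r.
apply: (proj2 (fclosed i.+1)); last by apply: filt_br => //; apply: IH.
apply: filt_br => //; rewrite lie_brC -scaleN1r -[_ *: _]addr0.
by apply: (proj2 lh); [apply: hz | case: lh].
Qed.

Let filt_zero i Z : filt i Z -> forall ws, (size ws + i = N)%N -> all_in h ws -> adi ws Z = 0.
Proof.
elim: i Z => [|i IH] Z fZ ws; first by rewrite addn0 => sw aw; apply: hN.
move=> sw aw; apply: (fZ (fun Z => adi ws Z = 0)).
  by split=> [|c A B HA HB]; rewrite ?adi0 // adi_lin HA HB scaler0 addr0.
move=> _ [A [B [hA fB ->]]].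
rewrite -[adi ws _]/(adi ws (adi [:: A] B)) /adi -foldr_cat -/(adi _ B).
apply: IH => //; first by rewrite size_cat /= addn1 addSnnS.
by move=> C; rewrite mem_cat inE => /orP[/aw|/eqP ->].
Qed.

Definition extend A := exists a c, h a /\ A = c *: z + a.

Let word_mod i Z ws : filt i Z -> all_in extend ws ->
  exists c r, filt i.+1 r /\ adi ws Z = c *: adi (nseq (size ws) z) Z + r.
Proof.
move=> fZ; elim: ws => [|A ws IH].
  by move=> _; exists 1, 0; rewrite scale1r addr0; split=> //; case: (fclosed i.+1).
move/all_in_cons => [[a [c [ha ->]]] /IH [d [r [fr E]]]].
have fzj j : filt i (adi (nseq j z) Z) by elim: j => //= j; apply: filtz.
exists (c * d), (c *: lie_br z r + (d *: lie_br a (adi (nseq (size ws) z) Z) + lie_br a r)).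
split.
  apply: (proj2 (fclosed i.+1)); first exact: filtz.
  apply: (proj2 (fclosed i.+1)); first exact: filt_br.
  by apply: filt_br => //; apply: filtS.
rewrite /= E lie_br_linl !lie_br_linr scalerDr scalerA !addrA; congr (_ + _ + _).
Qed.

Lemma adnil_extend : adnil extend ((n + n) * N).
Proof.
have step i Z ws : filt i Z -> size ws = (n + n)%N -> all_in extend ws -> filt i.+1 (adi ws Z).
  move=> fZ sw aw; have [c [r [fr ->]]] := word_mod fZ aw.
  by rewrite sw nilpotent_ad // scaler0 add0r.
have main j : forall ws, size ws = ((n + n) * j)%N -> all_in extend ws -> forall Z, filt j (adi ws Z).
  elim: j => [//|j IH] ws; rewrite mulnS => sw aw Z.
  rewrite -(cat_take_drop (n + n) ws) /adi foldr_cat -!/(adi _ _); apply: step.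
  - by apply: IH; [rewrite size_drop sw addKn | move=> A /mem_drop; apply: aw].
  - by rewrite size_takel // sw leq_addr.
  - by move=> A /mem_take; apply: aw.
move=> ws sw aw Z; have fN := main N ws sw aw Z.
by rewrite -[LHS]/(adi [::] (adi ws Z)) (filt_zero fN).
Qed.
End Extend.

(** U is a subalgebra of k of maximal dimension among those acting nilpotently. For A in k outside
    U, a longest bracket of A with elements of U that stays outside U is a z normalizing U, and U +
    K z contradicts maximality. *)
Lemma engel_adnil k : lin_closed k -> (forall A B, k A -> k B -> k (lie_br A B)) ->
  (forall A, k A -> A ^+ n = 0) -> exists N, adnil k N.
Proof.
move=> lk kbr knil.
pose hU (U : 'M[K]_(n * n)) A := (mxvec A <= U)%MS.
have lU U : lin_closed (hU U).
  split=> [|c A B HA HB]; rewrite /hU ?linear0 ?sub0mx // linearP.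
  by apply: addmx_sub => //; apply: scalemx_sub.
pose P U := [/\ forall A, hU U A -> k A, forall A B, hU U A -> hU U B -> hU U (lie_br A B)
  & exists N, adnil (hU U) N].
have [|U [Uk Ubr [N UN]] Umin] := @ex_minimal _ P (fun U => n * n - \rank U)%N.
  exists 0; have h0 A : hU 0 A -> A = 0.
    by rewrite /hU submx0 => /eqP /(congr1 vec_mx); rewrite mxvecK linear0.
  split.
  - by move=> A /h0 ->; case: lk.
  - by move=> A B /h0 -> /h0 ->; rewrite lie_br0 /hU linear0 sub0mx.
  - exists 1%N => -[|A []] // _ /all_in_cons [/h0 -> _] Z.
    by rewrite /= lie_brC lie_br0 oppr0.
exists N => ws sws aws; apply: (UN) => // A /aws kA; apply: contrapT => nA.
have [vs avs [nz hz]] := adnil_last (P := hU U) UN (proj1 (lU U)) nA.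
set z := adi vs A in nz hz.
have kz : k z.
  rewrite /z; elim: (vs) avs => //= B vs' IH /all_in_cons [hB /IH kv].
  by apply: kbr => //; apply: Uk.
pose V := (U + mxvec z)%MS.
have VE B : hU V B -> extend (hU U) z B.
  move=> /sub_addsmxP [[u v] /= E]; exists (vec_mx (u *m U)), (v 0 0); split.
    by rewrite /hU vec_mxK submxMl.
  rewrite -[LHS]mxvecK E linearD /= addrC {1}[v]mx11_scalar mul_scalar_mx.
  by rewrite linearZ /= mxvecK.
have EV B : extend (hU U) z B -> hU V B.
  move=> [a [c [ha ->]]]; rewrite /hU linearP /= addmx_sub //.
    by rewrite scalemx_sub // /V addsmxSr.
  by apply: submx_trans ha _; rewrite addsmxSl.
have hE A' : hU U A' -> hU V A'.
  by move=> ha; apply: EV; exists A', 0; rewrite scale0r add0r.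
have /Umin : P V.
  split.
  - move=> B /VE [a [c [ha ->]]]; apply: (proj2 lk) => //; exact: Uk.
  - move=> B C /VE [a [c [ha ->]]] /VE [b [d [hb ->]]]; apply: hE.
    rewrite lie_br_linl !lie_br_linr.
    have -> : lie_br z z = 0 by rewrite /lie_br subrr.
    rewrite scaler0 add0r; apply: (proj2 (lU U)).
      rewrite lie_brC -scaleN1r -[_ *: _]addr0; apply: (proj2 (lU U)); first exact: hz.
      by case: (lU U).
    by apply: (proj2 (lU U)); [apply: hz|apply: Ubr].
  - exists ((n + n) * N)%N => us sus aus; apply: (adnil_extend (lU U) hz UN (knil _ kz)) => //.
    by move=> B /aus /VE.
rewrite leq_sub2lE ?rank_leq_row // => le.
have : (U == V)%MS by rewrite -mxrank_leqif_eq ?addsmxSl // eqn_leq le mxrankS ?addsmxSl.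
by case/andP => _; rewrite addsmx_sub => /andP[_ /nz].
Qed.

(** A longest non-zero iterated bracket of elements of k with A is annihilated by ad k. *)
Lemma engel_center k : lin_closed k -> (forall A B, k A -> k B -> k (lie_br A B)) ->
  (forall A, k A -> A ^+ n = 0) -> (exists2 A, k A & A <> 0) ->
  exists z, [/\ k z, z <> 0 & forall A, k A -> lie_br A z = 0].
Proof.
move=> lk kbr knil [A kA A0]; have [N kN] := engel_adnil lk kbr knil.
have [ws aws [nz hz]] := @adnil_last _ _ (fun Z => Z = 0) _ kN erefl A0.
exists (adi ws A); split=> //.
by elim: (ws) aws => //= B vs IH /all_in_cons [kB /IH kv]; apply: kbr.
Qed.

End Engel.

(** * Cartan's criterion *)

Section CRT.
Variable K : fieldType.
Implicit Types (p q : {poly K}) (s : seq K).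

Lemma prod_XsubC_exp_dvd s N p : uniq s ->
  (forall a, a \in s -> ('X - a%:P) ^+ N %| p) -> \prod_(a <- s) ('X - a%:P) ^+ N %| p.
Proof.
elim: s => [|a s IH] /=; first by rewrite big_nil dvd1p.
move=> /andP[as_ us] H; rewrite big_cons Gauss_dvdp.
  by rewrite H ?mem_head //= IH // => b bs; apply: H; rewrite inE bs orbT.
elim: s as_ {IH us H} => [|b s IH]; first by rewrite big_nil coprimep1.
rewrite inE negb_or => /andP[ab as_]; rewrite big_cons coprimepMr IH // andbT.
by apply: coprimep_expl; apply: coprimep_expr; apply: coprimep_XsubC2; rewrite subr_eq0 eq_sym.
Qed.

(** Chinese remainders for the coprime moduli (X - a)^N: the Bezout coefficient corrects p at the
    new node a without disturbing the others. *)
Lemma crt_poly s N (c : K -> K) : uniq s ->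
  exists p, forall a, a \in s -> ('X - a%:P) ^+ N %| p - (c a)%:P.
Proof.
elim: s => [|a s IH] /=; first by exists 0.
move=> /andP[as_ us]; have [p Hp] := IH us.
pose M := \prod_(b <- s) ('X - b%:P) ^+ N.
have : coprimep M (('X - a%:P) ^+ N).
  rewrite /M; elim: s as_ {IH us Hp M} => [|b s IH]; first by rewrite big_nil coprime1p.
  rewrite inE negb_or => /andP[ab as_]; rewrite big_cons coprimepMl IH // andbT.
  by apply: coprimep_expl; apply: coprimep_expr; apply: coprimep_XsubC2; rewrite subr_eq0.
move/Bezout_eq1_coprimepP => [[u v] /= E].
exists (p + u * M * ((c a)%:P - p)) => b; rewrite inE => /orP[/eqP ->|bs].
  have -> : p + u * M * ((c a)%:P - p) - (c a)%:P = ((c a)%:P - p) * (u * M - 1) by ring.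
  rewrite -E opprD addrA subrr sub0r mulrN dvdpNr.
  by rewrite mulrA dvdp_mulIr.
have -> : p + u * M * ((c a)%:P - p) - (c b)%:P = (p - (c b)%:P) + u * ((c a)%:P - p) * M by ring.
apply: dvdp_add; first exact: Hp.
apply: dvdp_mull; rewrite /M (perm_big _ (perm_to_rem bs)) big_cons dvdp_mulIl //.
Qed.

(** Serves to bound a characteristic polynomial by powers of its distinct linear factors. *)
Lemma prod_XsubC_dvd_exp s t : uniq t -> {subset s <= t} ->
  \prod_(a <- s) ('X - a%:P) %| \prod_(a <- t) ('X - a%:P) ^+ size s.
Proof.
move=> ut; elim: s => [|a s IH] st; first by rewrite big_nil dvd1p.
rewrite big_cons /=; under [X in _ %| X]eq_bigr do rewrite exprS.
rewrite big_split /=; apply: dvdp_mul; last first.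
  by apply: IH => b bs; apply: st; rewrite inE bs orbT.
have at_ : a \in t by apply: st; rewrite mem_head.
by rewrite (perm_big _ (perm_to_rem at_)) big_cons dvdp_mulIl.
Qed.

End CRT.

Lemma sandwich_lin (K : fieldType) n (u v A B : 'M[K]_n) c :
  -1 *: ((c *: A + B) *m v) + u *m (c *: A + B) =
    c *: (-1 *: (A *m v) + u *m A) + (-1 *: (B *m v) + u *m B).
Proof.
rewrite mulmxDl mulmxDr -scalemxAl -scalemxAr.
by apply/matrixP => i k; rewrite !mxE; ring.
Qed.

Section AdPoly.
Variables (K : fieldType) (n' : nat).
Local Notation n := n'.+1.
Variable T : 'M[K]_n.

(** This is p(ad T) applied to Z, with ad T kept as a bracket instead of a matrix of size n^2. *)
Definition adp (p : {poly K}) (Z : 'M[K]_n) : 'M[K]_n :=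
  \sum_(i < size p) p`_i *: iter i (lie_br T) Z.

Lemma adpW N (p : {poly K}) Z : (size p <= N)%N ->
  adp p Z = \sum_(i < N) p`_i *: iter i (lie_br T) Z.
Proof.
move=> sP; rewrite /adp (big_ord_widen N (fun i => p`_i *: iter i (lie_br T) Z)) //.
rewrite [RHS](bigID (fun i : 'I_N => (i < size p)%N)) /= [X in _ + X]big1 ?addr0 //.
by move=> i; rewrite -leqNgt => ?; rewrite nth_default // scale0r.
Qed.

Lemma adpD p q Z : adp (p + q) Z = adp p Z + adp q Z.
Proof.
rewrite !(@adpW (maxn (size p) (size q))) ?leq_maxl ?leq_maxr ?size_polyD //.
by rewrite -big_split; apply: eq_bigr => i _ /=; rewrite coefD scalerDl.
Qed.

Lemma adpC c Z : adp c%:P Z = c *: Z.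
Proof. by rewrite (@adpW 1) ?size_polyC_leq1 // big_ord1 coefC. Qed.

Lemma adpMX p Z : adp (p * 'X) Z = adp p (lie_br T Z).
Proof.
rewrite (@adpW (size p).+1); last by have [->|P0] := eqVneq p 0; rewrite ?mul0r ?size_poly0 // size_mulX.
rewrite big_ord_recl coefMX /= scale0r add0r; apply: eq_bigr => i _.
by rewrite coefMX /= -iterSr.
Qed.

Lemma adp0 Z : adp 0 Z = 0.
Proof. by rewrite /adp size_poly0 big_ord0. Qed.

Lemma adp_lin p c Z Z' : adp p (c *: Z + Z') = c *: adp p Z + adp p Z'.
Proof.
rewrite /adp scaler_sumr -big_split; apply: eq_bigr => i _ /=.
have -> : iter i (lie_br T) (c *: Z + Z') = c *: iter i (lie_br T) Z + iter i (lie_br T) Z'.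
  by elim: (val i) => //= j ->; rewrite lie_br_linr.
by rewrite scalerDr !scalerA mulrC.
Qed.

Lemma adp_zero p : adp p 0 = 0.
Proof. by have := adp_lin p (-1) 0 0; rewrite scaler0 addr0 scaleN1r addNr. Qed.

Lemma adp_br q Z : adp q (lie_br T Z) = lie_br T (adp q Z).
Proof.
have -> : lie_br T (adp q Z) = \sum_(i < size q) lie_br T (q`_i *: iter i (lie_br T) Z).
  apply: (big_morph (lie_br T)) => [A B|]; last exact: lie_br0.
  by rewrite -[A in A + B]scale1r lie_br_linr scale1r.
apply: eq_bigr => i _; rewrite -iterSr /= -[q`_i *: iter _ _ _ in RHS]addr0.
by rewrite lie_br_linr lie_br0 addr0.
Qed.

Lemma adpM p q Z : adp (p * q) Z = adp p (adp q Z).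
Proof.
elim/poly_ind: p Z => [|p c IH] Z; first by rewrite mul0r !adp0.
have -> : (p * 'X + c%:P) * q = p * q * 'X + c%:P * q by ring.
rewrite !adpD !adpMX adpC IH adp_br; congr (_ + _).
elim/poly_ind: q Z {IH} => [|q d IH] Z; first by rewrite mulr0 !adp0 scaler0.
rewrite mulrDr mulrA -polyCM !adpD !adpMX !adpC IH scalerDr scalerA //.
Qed.

Lemma adp_stable (r : 'M[K]_n -> Prop) p Z : lin_closed r ->
  (forall Y, r Y -> r (lie_br T Y)) -> r Z -> r (adp p Z).
Proof.
move=> lr rT rZ; apply: lin_closed_sum => // i.
by elim: (val i) => //= j; apply: rT.
Qed.

Let mE (P Q : 'M[K]_n) : P * Q = P *m Q. Proof. by []. Qed.

(** ad T - (a - b) is left multiplication by T - a minus right multiplication by T - b. These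
    commute, so in its 2n-th power each term has one of the two at least n times. *)
Lemma adp_nilpotent a b Z : (T - a%:M) ^+ n *m Z = 0 -> Z *m (T - b%:M) ^+ n = 0 ->
  adp (('X - (a - b)%:P) ^+ (n + n)) Z = 0.
Proof.
move=> aZ Zb; pose u := T - a%:M; pose v := T - b%:M.
pose V j : set 'M[K]_n := lin_span
  [set C | exists p q, (p + q)%N = j /\ C = u ^+ p *m Z *m v ^+ q].
have step Y : adp ('X - (a - b)%:P) Y = -1 *: (Y *m v) + u *m Y.
  rewrite adpD -[X in adp X]mul1r adpMX -polyCN -polyC1 !adpC !scale1r /lie_br.
  rewrite mulmxBr mulmxBl mul_scalar_mx mul_mx_scalar.
  by apply/matrixP => i j; rewrite !mxE; ring.
have H j : V j (adp (('X - (a - b)%:P) ^+ j) Z).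
  elim: j => [|j IH].
    by rewrite expr0 -polyC1 adpC scale1r => h _; apply; exists 0%N, 0%N; rewrite !expr0 mulmx1 mul1mx.
  rewrite exprS adpM step.
  apply: (IH (fun Y => V j.+1 (-1 *: (Y *m v) + u *m Y))); first split.
  - rewrite mul0mx mulmx0 scaler0 addr0; apply: (proj1 (lin_span_closed _)).
  - move=> c A B HA HB.
    rewrite sandwich_lin.
    by apply: (proj2 (lin_span_closed _)).
  move=> _ [p [q [pq ->]]].
  apply: (proj2 (lin_span_closed _)) => h _; apply.
    by exists p, q.+1; rewrite addnS pq exprSr mE mulmxA.
  by exists p.+1, q; rewrite addSn pq exprS mE !mulmxA.
apply: (H (n + n)%N (fun C => C = 0)).
  by split=> // c A B -> ->; rewrite scaler0 addr0.
move=> _ [p [q [pq ->]]].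
have [pn|np] := leqP n p.
  by rewrite -(subnK pn) exprD mE -[_ *m _ *m Z]mulmxA aZ mulmx0 mul0mx.
have qn : (n <= q)%N by rewrite -(leq_add2l n) -pq leq_add2r ltnW.
by rewrite -(subnKC qn) exprD mE mulmxA -[_ *m Z *m _]mulmxA Zb mulmx0 mul0mx.
Qed.

End AdPoly.

Section Cartan.
Variables (C : numClosedFieldType) (n' : nat).
Local Notation n := n'.+1.
Implicit Types (T : 'M[C]_n).

Lemma trig_mul T T' : is_trig_mx T -> is_trig_mx T' ->
  is_trig_mx (T *m T') /\ forall i, (T *m T') i i = T i i * T' i i.
Proof.
move=> /is_trig_mxP tT /is_trig_mxP tT'.
have E (i j l : 'I_n) : (i <= j)%N -> (l != i) || (l != j) -> T i l * T' l j = 0.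
  move=> ij lij; have [il|li] := ltnP i l; first by rewrite tT // mul0r.
  have lj : (l < j)%N.
    rewrite ltnNge; apply/negP => jl.
    have il : i = l by apply: val_inj; apply/eqP; rewrite eqn_leq li (leq_trans ij jl).
    have jE : l = j by apply: val_inj; apply/eqP; rewrite eqn_leq jl (leq_trans li ij).
    by move: lij; rewrite il jE eqxx.
  by rewrite tT' // mulr0.
split.
  apply/is_trig_mxP => i j ij; rewrite mxE big1 // => l _; apply: E; first exact: ltnW.
  by case: (eqVneq l i) => //= ->; rewrite -(inj_eq val_inj) neq_ltn ij.
move=> i; rewrite mxE (bigD1 i) //= big1 ?addr0 // => l li.
by apply: E => //; rewrite li.
Qed.

Lemma trig_horner T p : is_trig_mx T ->
  is_trig_mx (horner_mx T p) /\ forall i, horner_mx T p i i = p.[T i i].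
Proof.
move=> tT; elim/poly_ind: p => [|p c [IH1 IH2]].
  by rewrite rmorph0; split=> [|i]; [exact: mx0_is_trig | rewrite mxE horner0].
have [H1 H2] := trig_mul IH1 tT.
rewrite rmorphD rmorphM /= horner_mx_X horner_mx_C; split=> [|i].
  apply/is_trig_mxP => i j ij; rewrite mxE.
  move/is_trig_mxP: H1 => ->//; rewrite mxE add0r.
  by case: eqP => // E; rewrite E ltnn in ij.
by rewrite mxE H2 IH2 hornerMXaddC mxE eqxx.
Qed.

(* y = q(T) has eigenvalue a^* where T has eigenvalue a, and ad y is a polynomial in ad T,
   so y normalizes r and tr (T y) is the sum of the |a|^2. *)
Lemma cartan_trig T (r : 'M[C]_n -> Prop) : is_trig_mx T -> lin_closed r ->
  (forall Z, r Z -> r (lie_br T Z)) ->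
  (forall y, (forall Z, r Z -> r (lie_br y Z)) -> \tr (T *m y) = 0) -> T ^+ n = 0.
Proof.
move=> tT lr rT H.
pose d := [seq T i i | i <- enum 'I_n]; pose s := undup d.
have us : uniq s by apply: undup_uniq.
have ds i : T i i \in s by rewrite mem_undup; apply/mapP; exists i; rewrite ?mem_enum.
have chi : char_poly T = \prod_(a <- d) ('X - a%:P).
  by rewrite char_poly_trig // /d big_map big_enum.
have sd : size d = n by rewrite size_map -cardE card_ord.
have kill p : (forall a, a \in s -> ('X - a%:P) ^+ n %| p) -> horner_mx T p = 0.
  move=> Hp; have D : char_poly T %| p.
    rewrite chi; apply: dvdp_trans (prod_XsubC_exp_dvd us Hp).
    by rewrite -sd; apply: prod_XsubC_dvd_exp => // a; rewrite mem_undup.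
  by rewrite -(divpK D) rmorphM /= Cayley_Hamilton mulr0.
have [q Hq] := crt_poly n (fun a : C => a^* ) us.
pose bs := undup [seq a - b | a <- s, b <- s].
(* Conjugation is additive, so interpolating it on differences of eigenvalues makes P(ad T) agree
   with ad y. The exponent 2n matches [adp_nilpotent]. *)
have [P HP] := crt_poly (n + n) (fun a : C => a^* ) (undup_uniq [seq a - b | a <- s, b <- s]).
pose y := horner_mx T q.
have [yt yd] := trig_horner q tT.
(* The matrices e_a(T) will be the projections onto the generalized eigenspaces of T; their sum is
   1, which splits any Z into blocks E_a Z E_b. *)
have /choice [e He] : forall a, exists p : {poly C}, forall b, b \in s -> ('X - b%:P) ^+ n %| p - ((b == a)%:R)%:P.
  by move=> a; exact: (crt_poly n (fun b => (b == a)%:R) us).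
pose E a := horner_mx T (e a).
have ED a : a \in s -> (T - a%:M) ^+ n *m E a = 0 /\ E a *m (T - a%:M) ^+ n = 0.
  move=> as_; have E1 : horner_mx T (('X - a%:P) ^+ n * e a) = 0.
    apply: kill => b bs_; have := He a b bs_.
    case: (eqVneq b a) => [->|ba]; first by rewrite dvdp_mulIl.
    by rewrite subr0 => D; apply: dvdp_mull.
  have EX : horner_mx T (('X - a%:P) ^+ n) = (T - a%:M) ^+ n.
    by rewrite rmorphXn rmorphB /= horner_mx_X horner_mx_C.
  split; first by rewrite -EX -[LHS]rmorphM.
  by rewrite -EX -[LHS]rmorphM mulrC.
have E1 : \sum_(a <- s) E a = 1.
  apply/eqP; rewrite -subr_eq0 -(rmorph1 (horner_mx T)) -rmorph_sum -rmorphB; apply/eqP.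
  apply: kill => b bs_.
  have -> : \sum_(a <- s) e a - 1 = \sum_(a <- s) (e a - ((b == a)%:R)%:P).
    rewrite sumrB; congr (_ - _); rewrite (perm_big _ (perm_to_rem bs_)) big_cons eqxx big1_seq => [|a /andP[_ ar]].
      by rewrite /= addr0 polyC1.
    case: eqVneq => // ba; move: ar; rewrite -ba.
    by rewrite mem_rem_uniq // inE eqxx.
  elim/big_ind: _ => [|p1 p2|a _]; [exact: dvdp0|exact: dvdp_add|exact: He].
have actE a b Z : a \in s -> b \in s -> (T - a%:M) ^+ n *m Z = 0 -> Z *m (T - b%:M) ^+ n = 0 ->
   adp T P Z = lie_br y Z.
  move=> as_ bs_ aZ Zb.
  have yl : y *m Z = a^* *: Z.
    have /dvdpP [g Eg] := Hq a as_.
    have -> : y = horner_mx T g *m (T - a%:M) ^+ n + (a^* )%:M.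
      rewrite /y -[q](subrK (a^* )%:P) Eg rmorphD rmorphM rmorphXn rmorphB /=.
      by rewrite horner_mx_X !horner_mx_C.
    by rewrite mulmxDl -mulmxA aZ mulmx0 add0r mul_scalar_mx.
  have yr : Z *m y = b^* *: Z.
    have /dvdpP [g Eg] := Hq b bs_; rewrite mulrC in Eg.
    have -> : y = (T - b%:M) ^+ n *m horner_mx T g + (b^* )%:M.
      rewrite /y -[q](subrK (b^* )%:P) Eg rmorphD rmorphM rmorphXn rmorphB /=.
      by rewrite horner_mx_X !horner_mx_C.
    by rewrite mulmxDr mulmxA Zb mul0mx add0r mul_mx_scalar.
  have ab : a - b \in undup [seq a - b | a <- s, b <- s].
    by rewrite mem_undup; apply/allpairsP; exists (a, b).
  have /dvdpP [g Eg] := HP _ ab.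
  rewrite -[P](subrK ((a - b)^* )%:P) Eg adpD adpM adp_nilpotent // adpC.
  by rewrite adp_zero add0r /lie_br yl yr -scalerBl rmorphB.
have actY Z : adp T P Z = lie_br y Z.
  have -> : Z = \sum_(a <- s) \sum_(b <- s) E a *m Z *m E b.
    transitivity ((\sum_(a <- s) E a) *m Z *m (\sum_(b <- s) E b)).
      by rewrite E1 -[1]/(1%:M) mul1mx mulmx1.
    rewrite !mulmx_suml; apply: eq_bigr => a _; exact: mulmx_sumr.
  have W0 : adp T P 0 = lie_br y 0 by rewrite adp_zero lie_br0.
  have WD A B : adp T P A = lie_br y A -> adp T P B = lie_br y B ->
      adp T P (A + B) = lie_br y (A + B).
    by move=> HA HB; rewrite -[A]scale1r adp_lin lie_br_linr HA HB.
  rewrite big_seq; apply: (big_ind (fun Z => adp T P Z = lie_br y Z)) => // a as_.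
  rewrite big_seq; apply: (big_ind (fun Z => adp T P Z = lie_br y Z)) => // b bs_.
  apply: (actE a b) => //; first by rewrite !mulmxA (proj1 (ED a as_)) !mul0mx.
  by rewrite -!mulmxA (proj2 (ED b bs_)) !mulmx0.
have qa i : q.[T i i] = (T i i)^*.
  have := Hq _ (ds i); rewrite exprS => /(dvdp_trans (dvdp_mulr _ (dvdpp _))).
  by rewrite dvdp_XsubCl rootE hornerD hornerN hornerC subr_eq0 => /eqP.
have tr0 : \tr (T *m y) = 0.
  by apply: H => Z rZ; rewrite -actY; apply: adp_stable.
move: tr0; rewrite /mxtrace.
have [_ Ty] := trig_mul tT yt.
under eq_bigr do rewrite Ty yd qa.
move=> tr0.
have T0 i : T i i = 0.
  have := @psumr_eq0P _ _ xpredT (fun i => T i i * (T i i)^*) (fun i _ => mul_conjC_ge0 _) tr0 i isT.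
  by move/eqP; rewrite mul_conjC_eq0 => /eqP.
have := Cayley_Hamilton T; rewrite char_poly_trig //.
under eq_bigr do rewrite T0 subr0.
by rewrite prodr_const card_ord rmorphXn /= horner_mx_X.
Qed.

(** A Schur basis makes x triangular, and r is conjugated along with x. *)
Lemma cartan_nilpotent (x : 'M[C]_n) (r : 'M[C]_n -> Prop) : lin_closed r ->
  (forall Z, r Z -> r (lie_br x Z)) ->
  (forall y, (forall Z, r Z -> r (lie_br y Z)) -> \tr (x *m y) = 0) -> x ^+ n = 0.
Proof.
move=> lr rx H; have [//|P Pu] := @Schur _ _ x.
have PU := unitarymx_unit Pu; move=> tT.
pose T := P *m x *m invmx P.
have {}tT : is_trig_mx T by move: tT; rewrite /similar_to /= conjumx.
have xE : x = invmx P *m T *m P by rewrite /T !mulmxA mulVmx // mul1mx mulmxKV.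
have brJ y Z : invmx P *m lie_br y Z *m P = lie_br (invmx P *m y *m P) (invmx P *m Z *m P).
  by rewrite /lie_br mulmxBr mulmxBl !mulmxA !(mulmxK PU).
have Tn : T ^+ n = 0.
  apply: (@cartan_trig T (fun Z => r (invmx P *m Z *m P)) tT).
  - split=> [|c u v ru rv]; first by rewrite mulmx0 mul0mx; case: lr.
    by rewrite mulmxDr mulmxDl -scalemxAr -scalemxAl; apply: (proj2 lr).
  - by move=> Z rZ; rewrite brJ -xE; apply: rx.
  - move=> y ry; rewrite -(H (invmx P *m y *m P)) => [|Z rZ].
      by rewrite xE !mulmxA (mulmxK PU) [RHS]mxtrace_mulC !mulmxA mulmxV // mul1mx.
    have ZE : Z = invmx P *m (P *m Z *m invmx P) *m P by rewrite !mulmxA mulVmx // mul1mx mulmxKV.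
    by rewrite ZE -brJ; apply: ry; rewrite -ZE.
have pw k : x ^+ k = invmx P *m T ^+ k *m P.
  elim: k => [|k IH]; first by rewrite !expr0 mulmx1 mulVmx.
  rewrite !exprS IH -[x * _]/(x *m _) -[T * _]/(T *m _) {1}xE !mulmxA.
  by rewrite (mulmxK PU).
by rewrite pw Tn mulmx0 mul0mx.
Qed.
End Cartan.

(** * From sl2-triples to regularity *)

Lemma cartan_criterion (C : numClosedFieldType) n (x : 'M[C]_n) (r : 'M[C]_n -> Prop) :
  lin_closed r -> (forall Z, r Z -> r (lie_br x Z)) ->
  (forall y, (forall Z, r Z -> r (lie_br y Z)) -> \tr (x *m y) = 0) -> x ^+ n = 0.
Proof.
case: n x r => [|n] x r; first by move=> *; apply: mx_empty; left.
exact: cartan_nilpotent.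
Qed.

Lemma mxtrace_br (K : fieldType) n (A B C : 'M[K]_n) :
  \tr (lie_br A B *m C) = - \tr (B *m lie_br A C).
Proof.
rewrite /lie_br mulmxBl mulmxBr !linearB /= opprB !mulmxA.
by rewrite [\tr (B *m C *m A)]mxtrace_mulC mulmxA.
Qed.

Lemma lie_brJ (K : fieldType) n (g A B : 'M[K]_n) : g \in unitmx ->
  lie_br (g *m A *m invmx g) (g *m B *m invmx g) = g *m lie_br A B *m invmx g.
Proof. by move=> gU; rewrite /lie_br mulmxBr mulmxBl !mulmxA !mulmxKV. Qed.

Lemma mulmxJ (K : fieldType) n (g A B : 'M[K]_n) : g \in unitmx ->
  (g *m A *m invmx g) *m (g *m B *m invmx g) = g *m (A *m B) *m invmx g.
Proof. by move=> gU; rewrite !mulmxA mulmxKV. Qed.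

Lemma mxtrace_J (K : fieldType) n (g A : 'M[K]_n) : g \in unitmx ->
  \tr (g *m A *m invmx g) = \tr A.
Proof. by move=> gU; rewrite mxtrace_mulC mulmxA mulVmx // mul1mx. Qed.

(** * The trace form on the derived algebra of a reductive group *)

Section TraceForm.
Variables (C : numClosedFieldType) (n : nat) (G : set 'M[C]_n).
Hypotheses (hG : lin_alg_group G) (hred : reductive_group G).
Hypothesis hsum : direct_sum (Lie G) (lie_center (Lie G)) (derived (Lie G)).

Let charC : [pchar C] =i pred0. Proof. exact: pchar_num. Qed.
Let s := derived (Lie G).
Let sL A : s A -> Lie G A. Proof. exact: derived_Lie. Qed.
Let ls : lin_closed s. Proof. exact: lin_span_closed. Qed.
Let sbr A B : Lie G A -> Lie G B -> s (lie_br A B).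
Proof. by move=> LA LB h _; apply; exists A, B. Qed.

Lemma span_J (S : set 'M[C]_n) g : (forall A, S A -> S (g *m A *m invmx g)) ->
  forall A, lin_span S A -> lin_span S (g *m A *m invmx g).
Proof.
move=> SJ A SA; apply: (SA (fun A => lin_span S (g *m A *m invmx g))).
  split=> [|c u v Hu Hv]; first by rewrite mulmx0 mul0mx; case: (lin_span_closed S).
  by rewrite mulmxDr mulmxDl -scalemxAr -scalemxAl; apply: (proj2 (lin_span_closed S)).
by move=> B /SJ SB h _; apply.
Qed.

Let sJ g A : G g -> s A -> s (g *m A *m invmx g).
Proof.
move=> Gg; apply: span_J => _ [P [Q [LP LQ ->]]].
exists (g *m P *m invmx g), (g *m Q *m invmx g).
by split; [exact: Lie_Ad|exact: Lie_Ad|rewrite lie_brJ // (lagU hG)].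
Qed.

(* Let r be the radical of the trace form on s = [g, g].  By Cartan's criterion [s, r] consists of
   nilpotent matrices; its center is G-stable and abelian, hence 0, so [s, r] = 0 by Engel's
   theorem and r lies in the intersection of s with the center of g. *)
Lemma derived_trace_nondeg A : derived (Lie G) A ->
  (forall D, derived (Lie G) D -> \tr (A *m D) = 0) -> A = 0.
Proof.
pose r A := s A /\ forall D, s D -> \tr (A *m D) = 0.
have lr : lin_closed r.
  split=> [|c u v [su ru] [sv rv]]; first by split=> [|D _]; [case: ls|rewrite mul0mx mxtrace0].
  split=> [|D sD]; first by apply: (proj2 ls).
  by rewrite mulmxDl -scalemxAl linearP /= ru // rv // mulr0 addr0.
have rbr x Z : Lie G x -> r Z -> r (lie_br x Z).
  move=> Lx [sZ rZ]; split=> [|D sD]; first by apply: sbr => //; apply: sL.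
  by rewrite mxtrace_br rZ ?oppr0 //; apply: sbr => //; apply: sL.
have rJ g Z : G g -> r Z -> r (g *m Z *m invmx g).
  move=> Gg [sZ rZ]; split=> [|D sD]; first exact: sJ.
  have gU := lagU hG Gg.
  have DE : D = g *m (invmx g *m D *m g) *m invmx g.
    by rewrite !mulmxA mulmxV // mul1mx mulmxK.
  rewrite DE mulmxJ // mxtrace_J // rZ //.
  by have := sJ (lagV hG Gg) sD; rewrite invmxK.
pose S : set 'M[C]_n := [set X | exists P Q, [/\ s P, r Q & X = lie_br P Q]].
pose nn := lin_span S.
have lnn : lin_closed nn by exact: lin_span_closed.
have nr X : nn X -> r X.
  move=> nX; apply: (nX r) => // _ [P [Q [sP rQ ->]]]; apply: rbr => //; exact: sL.
have nbr X Z : nn X -> nn Z -> nn (lie_br X Z).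
  by move=> /nr [sX _] /nr rZ h _; apply; exists X, Z.
have nJ g X : G g -> nn X -> nn (g *m X *m invmx g).
  move=> Gg; apply: span_J => _ [P [Q [sP rQ ->]]].
  exists (g *m P *m invmx g), (g *m Q *m invmx g).
  by split; [exact: sJ|exact: rJ|rewrite lie_brJ // (lagU hG)].
have nnil X : nn X -> X ^+ n = 0.
  move=> nX; have [sX _] := nr X nX; apply: (cartan_criterion lr).
    by move=> Z; apply: rbr; apply: sL.
  move=> y yr; apply: (nX (fun X => \tr (X *m y) = 0)).
    split=> [|c u v Hu Hv]; first by rewrite mul0mx mxtrace0.
    by rewrite mulmxDl -scalemxAl linearP /= Hu Hv mulr0 addr0.
  move=> _ [P [Q [sP rQ ->]]].
  (* As y normalizes r, the bracket [y, Q] lies in r, which is orthogonal to P. *)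
  have -> : \tr (lie_br P Q *m y) = - \tr (lie_br y Q *m P).
    rewrite /lie_br !mulmxBl !linearB /= opprB; congr (_ - _).
      by rewrite -mulmxA mxtrace_mulC.
    by rewrite mxtrace_mulC mulmxA.
  by have [_ ->] := yr Q rQ; rewrite ?oppr0.
have n0 X : nn X -> X = 0.
  move=> nX; apply: contrapT => X0.
  have [z [nz z0 cz]] := engel_center lnn nbr nnil (ex_intro2 _ _ X nX X0).
  pose a Z := nn Z /\ forall Y, nn Y -> lie_br Y Z = 0.
  apply: z0; apply: (@reductive_no_abelian_nil _ _ charC G a) => //.
  - split=> [|c u v [nu hu] [nv hv]].
      by split=> [|Y _]; [case: lnn|rewrite lie_br0].
    by split=> [|Y nY]; [apply: (proj2 lnn)|rewrite lie_br_linr hu // hv // scaler0 addr0].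
  - by move=> Z [/nr [/sL]].
  - move=> g Z Gg [nZ hZ]; split=> [|Y nY]; first exact: nJ.
    have gU := lagU hG Gg.
    have YE : Y = g *m (invmx g *m Y *m g) *m invmx g.
      by rewrite !mulmxA mulmxV // mul1mx mulmxK.
    rewrite YE lie_brJ // hZ ?mulmx0 ?mul0mx //.
    by have := nJ _ _ (lagV hG Gg) nY; rewrite invmxK.
  - move=> P Q [nP _] [_ hQ]; apply/eqP; rewrite -subr_eq0; apply/eqP; exact: hQ.
  - by move=> Z [/nnil].
move=> sA rA; have rAA : r A by [].
have brA B : s B -> lie_br B A = 0 by move=> sB; apply: n0 => h _; apply; exists B, A.
case: hsum => LE /seteqP [I _]; apply: (I A); split=> //; split; first exact: sL.
move=> B LB; move: LB; rewrite {1}LE => -[Z [LZ cZ] [D sD <-]].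
rewrite lie_brC -[Z]scale1r lie_br_linl (brA D) // cZ ?scaler0 ?addr0 ?oppr0 //; exact: sL.
Qed.

End TraceForm.

Section Main.
Variables (C : numClosedFieldType) (n m : nat) (G : set 'M[C]_n) (rho drho : 'M[C]_n -> 'M[C]_m).
Hypotheses (hG : lin_alg_group G) (hred : reductive_group G).
Hypotheses (hrho : rational_rep G rho) (hdrho : infinitesimal_rep G rho drho).
Hypothesis hsum : direct_sum (Lie G) (lie_center (Lie G)) (derived (Lie G)).
Hypothesis hdim : one_dimensional (lie_center (Lie G)).
Hypothesis hscal : drho @` lie_center (Lie G) = [set c%:M | c in [set: C]].
Let charC : [pchar C] =i pred0. Proof. exact: pchar_num. Qed.
Let LL := Lie_lin_closed G.

Lemma invariant_form_exists : (0 < m)%N -> exists B, nondeg_invariant_form (Lie G) B.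
Proof.
move=> m_gt0; have [Z cZ dZ] := central_unit hscal; have LZ : Lie G Z by case: cZ.
have om_lin := omega2_lin hG hdrho; have om_br := omega2_br hG hrho hdrho.
have om_der D : derived (Lie G) D -> omega2 drho D = 0.
  by move=> dD; have [] := derived_zero hG om_lin om_br dD.
have omZ : omega2 drho Z = 2 * m%:R by rewrite /omega2 dZ mxtrace_scalar.
have omZ0 : omega2 drho Z != 0.
  by rewrite omZ mulf_neq0 ?pnatr_eq0 // -lt0n.
(* omega2 vanishes on [g, g], so adding a multiple of its square leaves the trace form there
   unchanged. This multiple makes B(Z, Z) = 1 whatever tr(Z^2) is. *)
pose c := (1 - \tr (Z *m Z)) / omega2 drho Z ^+ 2.
pose B A D := \tr (A *m D) + c * (omega2 drho A * omega2 drho D).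
have trZ D : derived (Lie G) D -> \tr (Z *m D) = 0.
  move=> dD; suff [] : Lie G D /\ \tr (Z *m D) = 0 by [].
  apply: (@derived_zero _ _ _ hG (fun D => \tr (Z *m D))) dD => [x u v _ _|P Q LP LQ].
    by rewrite mulmxDr -scalemxAr linearP.
  have /eqP : lie_br Z P = 0 by case: cZ => _; apply.
  rewrite /lie_br subr_eq0 => /eqP ZP.
  rewrite mulmxBr linearB /= mulmxA ZP; apply/eqP; rewrite subr_eq0; apply/eqP.
  by rewrite -mulmxA mxtrace_mulC mulmxA.
have BC A D : B A D = B D A by rewrite /B mxtrace_mulC [omega2 _ A * _]mulrC.
have Bl x A A' D : Lie G A -> Lie G A' -> Lie G D -> B (x *: A + A') D = x * B A D + B A' D.
  move=> LA LA' LD; rewrite /B mulmxDl -scalemxAl linearP /= om_lin //.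
  by rewrite /GRing.scale /=; ring.
have nd A : Lie G A -> (forall D, Lie G D -> B A D = 0) -> A = 0.
  move=> LA BA; have [z [t [dt AE]]] := central_decomp hG hdrho hsum hdim cZ dZ m_gt0 LA.
  have Lt := derived_Lie hG dt.
  have t0 : t = 0.
    apply: (derived_trace_nondeg hG hred hsum dt) => D dD.
    have := BA D (derived_Lie hG dD); rewrite /B (om_der D) // !mulr0 addr0 AE.
    by rewrite mulmxDl -scalemxAl linearP /= trZ // mulr0 add0r.
  have := BA Z LZ; rewrite AE t0 Bl //; last by case: LL.
  have -> : B 0 Z = 0.
    by rewrite /B mul0mx mxtrace0 (om_der 0) ?mul0r ?mulr0 ?addr0 //; case: (lin_span_closed [set C0 | exists A0 B0, [/\ Lie G A0, Lie G B0 & C0 = lie_br A0 B0]]).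
  have -> : B Z Z = 1.
    by rewrite /B -expr2 /c divfK ?expf_neq0 // addrC subrK.
  by rewrite mulr1 addr0 => ->; rewrite scale0r addr0.
exists B; split.
- exact: Bl.
- by move=> x A D D' LA LD LD'; rewrite BC Bl // !(BC _ A).
- move=> A D E LA LD LE; rewrite /B om_br // om_br // mul0r mulr0 !mulr0 !addr0.
  by rewrite lie_brC mulNmx linearN /= mxtrace_br opprK.
- exact: nd.
- by move=> D LD BD; apply: nd => // A LA; rewrite BC BD.
Qed.

Lemma Phi_exists B : nondeg_invariant_form (Lie G) B ->
  exists Phi, is_Phi_map (Lie G) drho B Phi.
Proof.
move=> hB; have dl := drho_lin hG hdrho; case: (hB) => _ _ _ nl _.
have H (vp : 'cV[C]_m * 'rV[C]_m) : exists b, Lie G b /\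
    forall a, Lie G a -> B a b = pairing (drho a *m vp.1) vp.2.
  have [|b Lb bE] := riesz LL (form_lin_l hB) (form_lin_r hB) nl
    (l := fun a => pairing (drho a *m vp.1) vp.2); last by exists b.
  move=> c u v Lu Lv; rewrite /pairing dl // mulmxDl mulmxDr -scalemxAl -scalemxAr.
  by rewrite !mxE.
have [f fE] := choice H; exists (fun v phi => f (v, phi)) => v phi.
exact: (fE (v, phi)).
Qed.

Lemma sl2_regular_pv :
  (forall (B : 'M[C]_n -> 'M[C]_n -> C) (Phi : 'cV[C]_m -> 'rV[C]_m -> 'M[C]_n),
     nondeg_invariant_form (Lie G) B -> is_Phi_map (Lie G) drho B Phi ->
     exists (H0 : 'M[C]_n) (X : 'cV[C]_m) (Y : 'rV[C]_m),
       [/\ grading_element (Lie G) drho H0, sl2_triple drho Phi Y H0 X,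
           P_HX drho Phi H0 X & P_YH drho Phi Y H0]) -> regular_pv G rho drho.
Proof.
move=> H; have dl := drho_lin hG hdrho; have L0 := proj1 LL.
(* On V = 0 the form omega2 is zero and cannot complete the trace form, but the tangency conditions
   hold trivially. *)
have [m0|m_gt0] := posnP m.
  apply: (@regular_pv_of_tangent _ _ _ _ rho drho charC hG hrho hdrho 0 0).
  - by move=> v; exists 0 => //; apply: mx_empty; left.
  - by move=> v; exists 0 => //; apply: mx_empty; right.
  - move=> A _; rewrite !mul0mx mxE /omega2 (_ : drho A = 0) ?mxtrace0 ?mulr0 //.
    by apply: mx_empty; left.
have [B hB] := invariant_form_exists m_gt0; have [Phi hPhi] := Phi_exists hB.
have [H0 [X [Y [[LH cH gX gY] hs PX PY]]]] := H B Phi hB hPhi.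
have two0 : (2 : C) != 0 by rewrite pnatr_eq0.
have dH : drho H0 = 2%:M.
  apply/matrixP => i j; have := gX (delta_mx j 0); rewrite /br01 -colE.
  by move/matrixP/(_ i 0); rewrite !mxE eqxx andbT => ->; rewrite mulr_natr.
have d0 : drho 0 = 0 by exact: drho0 hG hdrho.
pose Z := 2^-1 *: H0.
have ZE : Z = 2^-1 *: H0 + 0 by rewrite addr0.
have LZ : Lie G Z by rewrite ZE; apply: (proj2 LL).
have cZ : lie_center (Lie G) Z.
  split=> // A LA; rewrite /Z /lie_br -scalemxAl -scalemxAr -scalerBr.
  by have := cH A LA; rewrite /lie_br => ->; rewrite scaler0.
have dZ : drho Z = 1%:M.
  by rewrite ZE dl // dH d0 addr0 scale_scalar_mx mulVf.
have LPhi v phi : Lie G (Phi v phi) by case: (hPhi v phi).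
have [_ _ _ _ nr] := hB.
have uniqPhi v phi E : Lie G E -> (forall A, Lie G A -> (phi *m drho A *m v) 0 0 = B A E) -> Phi v phi = E.
  move=> LE hE; apply/eqP; rewrite -subr_eq0; apply/eqP.
  have LN : Lie G (Phi v phi - E) by rewrite -scaleN1r addrC; apply: (proj2 LL).
  apply: nr => // A LA; rewrite addrC -scaleN1r (form_lin_r hB) //.
  case: (hPhi v phi) => _ -> //; rewrite /pairing mulmxA hE //.
  by rewrite /GRing.scale /= mulN1r addNr.
have pr A : Lie G A -> (Y *m drho A *m X) 0 0 = B A H0.
  by move=> LA; exact: (sl2_pairing hPhi LA hs).
have Lin_col (x : 'cV[C]_m) : lin_closed (fun v => exists2 A, Lie G A & drho A *m x = v).
  split=> [|c u v [A LA <-] [D LD <-]]; first by exists 0; rewrite // d0 mul0mx.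
  exists (c *: A + D); first by apply: (proj2 LL).
  by rewrite dl // mulmxDl -scalemxAl.
have Lin_row (y : 'rV[C]_m) : lin_closed (fun v => exists2 A, Lie G A & y *m drho A = v).
  split=> [|c u v [A LA <-] [D LD <-]]; first by exists 0; rewrite // d0 mulmx0.
  exists (c *: A + D); first by apply: (proj2 LL).
  by rewrite dl // mulmxDr -scalemxAr.
(* A row c killing drho(g) X can be added to Y without changing the bracket with X. Uniqueness gives
   c = 0, so drho(g) X has zero annihilator. *)
have tX : tangent_col G drho X.
  apply: (lin_closed_full_col (Lin_col X)) => c hc.
  case: PX => Y1 [_ uY].
  have E1 := uY _ hs; have E2 : Y1 = Y + c.
    apply: uY; split; [exact: gX|exact: gY|apply: uniqPhi => // A LA].
    rewrite !mulmxDl -mulmxA -[c *m drho A *m X]mulmxA (hc (drho A *m X)); last by exists A.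
    by rewrite addr0 mulmxA pr.
  by move/eqP: E2; rewrite E1 -[X in X == _]addr0 (inj_eq (addrI _)) => /eqP.
have tY : tangent_row G drho Y.
  apply: (lin_closed_full (Lin_row Y)) => c hc.
  case: PY => X1 [_ uX].
  have E1 := uX _ hs; have E2 : X1 = X + c.
    apply: uX; split; [exact: gX|exact: gY|apply: uniqPhi => // A LA].
    rewrite mulmxDr (hc (Y *m drho A)); last by exists A.
    by rewrite addr0 pr.
  by move/eqP: E2; rewrite E1 -[X in X == _]addr0 (inj_eq (addrI _)) => /eqP.
have om_lin := omega2_lin hG hdrho.
have om_der D : derived (Lie G) D -> omega2 drho D = 0.
  by move=> dD; have [] := derived_zero hG om_lin (omega2_br hG hrho hdrho) dD.
have BZ := form_center_neq0 hG hdrho hsum hdim cZ dZ m_gt0 hB.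
have prop := form_central_proportional hG hdrho hsum hdim cZ dZ m_gt0 hB om_lin om_der.
(* With H0 = 2 Z and omega2 proportional to B(-, Z), this factor makes t Y pair with drho(A) X to
   omega2(A) exactly. *)
pose t := omega2 drho Z / (2 * B Z Z).
have t0 : t != 0.
  have oZ : omega2 drho Z != 0.
    have -> : omega2 drho Z = 2 * m%:R by rewrite /omega2 dZ mxtrace_scalar.
    by rewrite mulf_neq0 // pnatr_eq0 -lt0n.
  by apply: mulf_neq0 => //; rewrite invr_neq0 // mulf_neq0.
apply: (@regular_pv_of_tangent _ _ _ _ rho drho charC hG hrho hdrho X (t *: Y) tX).
  move=> v; have [A LA dA] := tY (t^-1 *: v); exists A => //.
  by rewrite -scalemxAl dA scalerA mulfV // scale1r.
move=> A LA; rewrite -!scalemxAl mxE pr //.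
have -> : H0 = 2 *: Z + 0 by rewrite addr0 /Z scalerA mulfV // scale1r.
rewrite (form_lin_r hB) //.
have -> : B A 0 = 0.
  have := form_lin_r hB LA (-1) L0 L0.
  by rewrite scaler0 addr0 scaleN1r addNr.
rewrite addr0 /GRing.scale /= /t.
have -> : omega2 drho Z / (2 * B Z Z) * (2 * B A Z) = B A Z * omega2 drho Z / B Z Z.
  by field; rewrite ?two0 ?BZ.
by rewrite prop // mulfK.
Qed.

Lemma regular_pv_iff_sl2 : regular_pv G rho drho <->
  (forall (B : 'M[C]_n -> 'M[C]_n -> C) (Phi : 'cV[C]_m -> 'rV[C]_m -> 'M[C]_n),
     nondeg_invariant_form (Lie G) B -> is_Phi_map (Lie G) drho B Phi ->
     exists (H0 : 'M[C]_n) (X : 'cV[C]_m) (Y : 'rV[C]_m),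
       [/\ grading_element (Lie G) drho H0, sl2_triple drho Phi Y H0 X,
           P_HX drho Phi H0 X & P_YH drho Phi Y H0]).
Proof.
split; last exact: sl2_regular_pv.
exact: (regular_pv_sl2 charC hG hrho hdrho hsum hdim hscal).
Qed.
End Main.

Unset Implicit Arguments.

Theorem theorem2p6 (R : realType) (n m : nat) (G : set 'M[R[i]]_n)
    (rho drho : 'M[R[i]]_n -> 'M[R[i]]_m)
    (hG : lin_alg_group G) (hconn : zariski_connected G)
    (hred : reductive_group G)
    (hrho : rational_rep G rho) (hdrho : infinitesimal_rep G rho drho)
    (hsum : direct_sum (Lie G) (lie_center (Lie G)) (derived (Lie G)))
    (hdim : one_dimensional (lie_center (Lie G)))
    (hscal : drho @` lie_center (Lie G) = [set c%:M | c in [set: R[i]]]) :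
  regular_pv G rho drho
  <->
  (forall (B : 'M[R[i]]_n -> 'M[R[i]]_n -> R[i])
          (Phi : 'cV[R[i]]_m -> 'rV[R[i]]_m -> 'M[R[i]]_n),
     nondeg_invariant_form (Lie G) B ->
     is_Phi_map (Lie G) drho B Phi ->
     exists (H0 : 'M[R[i]]_n) (X : 'cV[R[i]]_m) (Y : 'rV[R[i]]_m),
       [/\ grading_element (Lie G) drho H0,
           sl2_triple drho Phi Y H0 X,
           P_HX drho Phi H0 X
         & P_YH drho Phi Y H0]).
Proof.
exact: (regular_pv_iff_sl2 hG hred hrho hdrho hsum hdim hscal).
Qed.
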